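(* Let $(A,\rho_A,[\cdot,\cdot]_A)$ be a Lie algebroid on a manifold $M$, $E$ a vector bundle over $M$, $k\in\mathbb{N}$, and let $\nabla^0,\dots,\nabla^k:\Gamma(A)\to\mathscr{CDO}(E)$ be $\mathbb{R}$-linear connections of $A$ on $E$. Then $$(-1)^{k+1}\,d_{A,\mathbb{R}}\bigl(\mathrm{cs}_p(\nabla^0,\dots,\nabla^k)\bigr)=\sum_{j=0}^{k}(-1)^j\,\mathrm{cs}_p(\nabla^0,\dots,\widehat{\nabla^j},\dots,\nabla^k)$$ for all integers $p$ such that $0<k\le 2p$ (the hat denotes omission), and $d_{A,\mathbb{R}}(\mathrm{cs}_p(\nabla^0))=0$.
   Context: All manifolds, bundles and sections are smooth; vector bundles are real. A Lie algebroid $(A,\rho_A,[\cdot,\cdot]_A)$ over $M$ is a vector bundle $A\to M$ with a vector bundle homomorphism $\rho_A:A\to TM$ (the anchor) and a real Lie algebra structure $[\cdot,\cdot]_A$ on $\Gamma(A)$ satisfying $[a,fb]_A=f[a,b]_A+\rho_A(a)(f)\,b$ for $a,b\in\Gamma(A)$, $f\in C^\infty(M)$. The anchor induces a Lie algebra homomorphism $\Gamma(A)\to\mathfrak{X}(M)$, $a\mapsto\rho_A\circ a$. $\mathscr{CDO}(E)$ is the space of covariant differential operators of $E$: $\mathbb{R}$-linear $\ell:\Gamma(E)\to\Gamma(E)$ for which there is exactly one vector field $\tilde\ell\in\mathfrak{X}(M)$ with $\ell(f\zeta)=f\ell(\zeta)+\tilde\ell(f)\zeta$ for all $f\in C^\infty(M)$,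 $\zeta\in\Gamma(E)$. An $\mathbb{R}$-linear connection of $A$ on $E$ is an $\mathbb{R}$-linear (not necessarily $C^\infty(M)$-linear, nor local) map $\nabla:\Gamma(A)\to\mathscr{CDO}(E)$, $a\mapsto\nabla_a$, with $\widetilde{\nabla_a}=\rho_A\circ a$. Its curvature is $R^\nabla_{a,b}=\nabla_a\nabla_b-\nabla_b\nabla_a-\nabla_{[a,b]_A}\in\Gamma(\mathrm{End}\,E)$. $\mathcal{A}lt^n_{\mathbb{R}}(\Gamma(A);C^\infty(M))$ is the space of $\mathbb{R}$-multilinear antisymmetric maps $\Gamma(A)^n\to C^\infty(M)$ (for $n=0$: $C^\infty(M)$). The operator $d_{A,\mathbb{R}}$ on these is $$(d_{A,\mathbb{R}}\eta)(a_1,\dots,a_{n+1})=\sum_i(-1)^{i+1}(\rho_A\circ a_i)\bigl(\eta(a_1,\dots\hat{\imath}\dots,a_{n+1})\bigr)+\sum_{i<j}(-1)^{i+j}\eta([a_i,a_j]_A,a_1,\dots\hat{\imath}\dots\hat{\jmath}\dots,a_{n+1}).$$ For $p\ge1$, $\mathrm{ch}_p(\nabla)=\mathrm{Tr}_*(R^\nabla)^p\in\mathcal{A}lt^{2p}_{\mathbb{R}}(\Gamma(A);C^\infty(M))$, where $$(R^\nabla)^p(a_1,\dots,a_{2p})=\frac1{2^p}\sum_{\tau\in S_{2p}}\mathrm{sgn}\,\tau\; R^\nabla_{a_{\tau(1)},a_{\tau(2)}}\circ\cdots\circ R^\nabla_{a_{\tau(2p-1)},a_{\tau(2p)}}$$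 and $\mathrm{Tr}_*$ takes the fibrewise trace of the values. Let $\mathrm{pr}_2:\mathbb{R}^k\times M\to M$ be the projection and $T\mathbb{R}^k\times A$ the product Lie algebroid over $\mathbb{R}^k\times M$; write $a$ for the section $0\times a$ ($a\in\Gamma(A)$) and $\partial/\partial t^j$ for $\frac{\partial}{\partial t^j}\times0$. The affine combination $\nabla^{\mathrm{aff}_k}$ of $\nabla^0,\dots,\nabla^k$ is the $\mathbb{R}$-linear connection of $T\mathbb{R}^k\times A$ on $\mathrm{pr}_2^*E$ given by $$\bigl(\nabla^{\mathrm{aff}_k}_{(X,\sum_i r^i\otimes a^i)}(\nu\circ\mathrm{pr}_2)\bigr)(t,\cdot)=\Bigl(1-\sum_{i=1}^kt_i\Bigr)\nabla^0_{\sum_i r^i(t,\cdot)a^i}(\nu)+\sum_{i=1}^kt_i\,\nabla^i_{\sum_i r^i(t,\cdot)a^i}(\nu)$$ for $\nu\in\Gamma(E)$, extended to all sections of $\mathrm{pr}_2^*E$ by the Leibniz rule. Only the following operators enter the definition of $\mathrm{cs}_p$ below: $\nabla^{\mathrm{aff}_k}_{\partial/\partial t^j}(\nu\circ\mathrm{pr}_2)=0$ and $\nabla^{\mathrm{aff}_k}_a(\nu\circ\mathrm{pr}_2)(t,\cdot)=(1-\sum_it_i)\nabla^0_a\nu+\sum_it_i\nabla^i_a\nu$, with $[\partial/\partial t^i,\partial/\partial t^j]=0$, $[\partial/\partial t^j,a]=0$, and $[a,b]=[a,b]_A$ for the constant sections. Let $\Delta^k=\{t\in\mathbb{R}^k: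 t_i\ge0,\ \sum_it_i\le1\}$. For $0<k\le2p$ the Chern–Simons form $\mathrm{cs}_p(\nabla^0,\dots,\nabla^k)\in\mathcal{A}lt^{2p-k}_{\mathbb{R}}(\Gamma(A);C^\infty(M))$ is $$\mathrm{cs}_p(\nabla^0,\dots,\nabla^k)(a_1,\dots,a_{2p-k})=\int_{\Delta^k}\mathrm{ch}_p(\nabla^{\mathrm{aff}_k})\Bigl(\frac{\partial}{\partial t^1},\dots,\frac{\partial}{\partial t^k},a_1,\dots,a_{2p-k}\Bigr)\Big|_{(t_1,\dots,t_k,\cdot)}dt_1\cdots dt_k,$$ and $\mathrm{cs}_p(\nabla^0)=\mathrm{ch}_p(\nabla^0)$. *)

(* Defs.v *)
From HB Require Import structures.
From mathcomp Require Import all_boot all_order all_algebra.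
From mathcomp Require Import perm.
From mathcomp Require Import all_classical all_reals all_analysis.

Set Implicit Arguments.
Unset Strict Implicit.
Unset Printing Implicit Defensive.

Import Order.TTheory GRing.Theory Num.Theory.
Import numFieldNormedType.Exports.

Local Open Scope classical_set_scope.
Local Open Scope ring_scope.

Section EuclideanSmoothness.
Context {R : realType} {m : nat}.
Implicit Types (V : set 'rV[R]_m) (g : 'rV[R]_m -> R).

(* Only used for V open, so that differentiability at a point of V involves
   the values of g on V only. *)
Fixpoint Cn_on (n : nat) V g : Prop :=
  (forall y, V y -> {for y, continuous g}) /\
  match n with
  | 0 => True
  | n'.+1 => forall i : 'I_m, exists dg : 'rV[R]_m -> R,
      (forall y, V y -> is_derive y (delta_mx 0 i) g (dg y)) /\ Cn_on n' V dg
  end.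

Definition Csmooth_on V g := forall n, Cn_on n V g.

Lemma Cn_on_cst n V (c : R) : Cn_on n V (fun=> c).
Proof.
elim: n c => [|n IH] c /=; split=> //; try by move=> y _; exact: cst_continuous.
by move=> i; exists (fun=> 0); split=> // y _; exact: is_derive_cst.
Qed.

Lemma Cn_onS n V g : Cn_on n.+1 V g -> Cn_on n V g.
Proof.
elim: n g => [|n IH] g [cg dg]; first by split.
split=> // i; have [h [hg /IH Hh]] := dg i.
by exists h.
Qed.

Lemma Cn_onD n V g h : Cn_on n V g -> Cn_on n V h ->
  Cn_on n V (fun y => g y + h y).
Proof.
elim: n g h => [|n IH] g h [cg dg] [ch dh]; split => //;
  try by move=> y Vy; apply: continuousD; [exact: cg|exact: ch].
move=> i; have [g' [Hg Hg']] := dg i; have [h' [Hh Hh']] := dh i.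
exists (fun y => g' y + h' y); split; last exact: IH.
by move=> y Vy; apply: is_deriveD; [exact: Hg|exact: Hh].
Qed.

Lemma Cn_onM n V g h : Cn_on n V g -> Cn_on n V h ->
  Cn_on n V (fun y => g y * h y).
Proof.
elim: n g h => [|n IH] g h Cg Ch; have [cg dg] := Cg; have [ch dh] := Ch;
  split => //; try by move=> y Vy; apply: continuousM; [exact: cg|exact: ch].
move=> i; have [g' [Hg Hg']] := dg i; have [h' [Hh Hh']] := dh i.
exists (fun y => g y * h' y + h y * g' y); split.
  by move=> y Vy; apply: is_deriveM; [exact: Hg|exact: Hh].
by apply: Cn_onD; apply: IH => //; apply: Cn_onS.
Qed.

End EuclideanSmoothness.

Record chart (R : realType) (T : topologicalType) (m : nat) := Chart {
  chart_dom : set T;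
  chart_map : T -> 'rV[R]_m;
  chart_inv : 'rV[R]_m -> T;
  chart_open : open chart_dom;
  chart_open_im : open (chart_map @` chart_dom);
  chart_mapK : forall x, chart_dom x -> chart_inv (chart_map x) = x;
  chart_cont : forall x, chart_dom x -> {for x, continuous chart_map};
  chart_inv_cont : forall y, (chart_map @` chart_dom) y ->
    {for y, continuous chart_inv} }.

Record manifold (R : realType) := Manifold {
  mcar :> topologicalType;
  mdim : nat;
  atlas : set (chart R mcar mdim);
  man_hausdorff : hausdorff_space mcar;
  man_second_countable : @second_countable mcar;
  atlas_cover : forall x : mcar, exists2 c, atlas c & chart_dom c x;
  atlas_compat : forall c d, atlas c -> atlas d -> forall i : 'I_mdim,
    Csmooth_on (chart_map c @` (chart_dom c `&` chart_dom d))
               (fun y => chart_map d (chart_inv c y) 0 i) }.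

Section SmoothFunctions.
Context {R : realType} {M : manifold R}.
Implicit Types (U : set M) (f g h : M -> R).

Definition smooth_on U h := forall c, atlas c ->
  Csmooth_on (chart_map c @` (U `&` chart_dom c)) (h \o chart_inv c).

Definition smooth h := smooth_on setT h.

Lemma smooth_on_cst U (c : R) : smooth_on U (fun=> c).
Proof. by move=> d _ n; exact: Cn_on_cst. Qed.

Lemma smooth_onD U g h : smooth_on U g -> smooth_on U h ->
  smooth_on U (fun x => g x + h x).
Proof. by move=> sg sh c ac n; apply: Cn_onD; [exact: sg|exact: sh]. Qed.

Lemma smooth_onM U g h : smooth_on U g -> smooth_on U h ->
  smooth_on U (fun x => g x * h x).
Proof. by move=> sg sh c ac n; apply: Cn_onM; [exact: sg|exact: sh]. Qed.

Lemma smooth_onZ U (k : R) h : smooth_on U h -> smooth_on U (fun x => k * h x).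
Proof. by move=> sh; apply: smooth_onM => //; exact: smooth_on_cst. Qed.

Lemma smooth_onN U h : smooth_on U h -> smooth_on U (fun x => - h x).
Proof.
by move=> /(@smooth_onZ _ (-1)); congr smooth_on; apply/funext => x; rewrite mulN1r.
Qed.

Lemma smooth_onW U h : smooth h -> smooth_on U h.
Proof.
move=> sh c ac n; elim: n (h \o _) {sh}(sh c ac n) => [|n IH] g [cg dg]; split=> //;
  try by move=> y [x [Ux cx] <-]; apply: cg; exists x.
move=> i; have [g' [Hg /IH Hg']] := dg i; exists g'; split=> //.
by move=> y [x [Ux cx] <-]; apply: Hg; exists x.
Qed.

End SmoothFunctions.

Record smoothfun (R : realType) (M : manifold R) := SmoothFun {
  sfun :> M -> R;
  sfunP : smooth sfun }.

Section SmoothFunAlgebra.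
Context {R : realType} {M : manifold R}.
Local Notation C := (smoothfun M).
Implicit Types f g h : C.

Lemma sfun_eq f g : f =1 g -> f = g.
Proof.
case: f g => [f sf] [g sg] /= /funext fg; subst g.
by congr SmoothFun; exact: Prop_irrelevance.
Qed.

HB.instance Definition _ := gen_eqMixin C.
HB.instance Definition _ := gen_choiceMixin C.

Definition sfun_cst (c : R) : C := SmoothFun (@smooth_on_cst R M setT c).
Definition sfun_add f g : C := SmoothFun (smooth_onD (sfunP f) (sfunP g)).
Definition sfun_opp f : C := SmoothFun (smooth_onN (sfunP f)).
Definition sfun_mul f g : C := SmoothFun (smooth_onM (sfunP f) (sfunP g)).
Definition sfun_scale (c : R) f : C := SmoothFun (smooth_onZ c (sfunP f)).

Let addA : associative sfun_add.
Proof. by move=> f g h; apply: sfun_eq => x /=; rewrite addrA. Qed.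
Let addC : commutative sfun_add.
Proof. by move=> f g; apply: sfun_eq => x /=; rewrite addrC. Qed.
Let add0 : left_id (sfun_cst 0) sfun_add.
Proof. by move=> f; apply: sfun_eq => x /=; rewrite add0r. Qed.
Let addN : left_inverse (sfun_cst 0) sfun_opp sfun_add.
Proof. by move=> f; apply: sfun_eq => x /=; rewrite addNr. Qed.
HB.instance Definition _ := GRing.isZmodule.Build C addA addC add0 addN.

Let mulA : associative sfun_mul.
Proof. by move=> f g h; apply: sfun_eq => x /=; rewrite mulrA. Qed.
Let mulC : commutative sfun_mul.
Proof. by move=> f g; apply: sfun_eq => x /=; rewrite mulrC. Qed.
Let mul1 : left_id (sfun_cst 1) sfun_mul.
Proof. by move=> f; apply: sfun_eq => x /=; rewrite mul1r. Qed.
Let mulD : left_distributive sfun_mul sfun_add.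
Proof. by move=> f g h; apply: sfun_eq => x /=; rewrite mulrDl. Qed.
HB.instance Definition _ :=
  GRing.Zmodule_isComPzRing.Build C mulA mulC mul1 mulD.

Let scaleA a b f : sfun_scale a (sfun_scale b f) = sfun_scale (a * b) f.
Proof. by apply: sfun_eq => x /=; rewrite mulrA. Qed.
Let scale1 : left_id 1 sfun_scale.
Proof. by move=> f; apply: sfun_eq => x /=; rewrite mul1r. Qed.
Let scaleDr : right_distributive sfun_scale +%R.
Proof. by move=> c f g; apply: sfun_eq => x /=; rewrite mulrDr. Qed.
Let scaleDl f : {morph sfun_scale^~ f : a b / a + b}.
Proof. by move=> a b; apply: sfun_eq => x /=; rewrite mulrDl. Qed.
HB.instance Definition _ :=
  GRing.Zmodule_isLmodule.Build R C scaleA scale1 scaleDr scaleDl.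

(* Total version of the inverse of the coercion sfun: the value on a function
   that is not smooth is irrelevant. *)
Definition to_smooth (h : M -> R) : C :=
  if pselect (smooth h) is left sh then SmoothFun sh else 0.

End SmoothFunAlgebra.

(* T_x M as the space of derivations at x of C^oo(M). *)
Record tangent (R : realType) (M : manifold R) (x : M) := Tangent {
  tder :> smoothfun M -> R;
  tder_linear : forall (c : R) (f g : smoothfun M),
    tder (c *: f + g) = c * tder f + tder g;
  tder_leibniz : forall f g : smoothfun M,
    tder (f * g) = f x * tder g + tder f * g x }.

Definition smooth_vfield (R : realType) (M : manifold R)
    (X : forall x : M, tangent x) :=
  forall f : smoothfun M, smooth (fun x => X x f).

(* A local trivialization of a family of vector spaces; the rank may depend on
   the trivialization, hence on the connected component. *)
Record ltriv (R : realType) (M : manifold R) (F : M -> vectType R) := LTriv {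
  lt_dom : set M;
  lt_rank : nat;
  lt_map : forall x, {linear F x -> 'rV[R]_lt_rank};
  lt_inv : forall x, 'rV[R]_lt_rank -> F x;
  lt_open : open lt_dom;
  lt_mapK : forall x, lt_dom x -> cancel (lt_map x) (lt_inv x);
  lt_invK : forall x, lt_dom x -> cancel (lt_inv x) (lt_map x) }.
Arguments lt_map {R M F} t x : rename.
Arguments lt_inv {R M F} t x : rename.

(* A vector bundle presented by its fibres and a bundle atlas with smooth
   transition functions; these determine the smooth structure of the total
   space. *)
Record vbundle (R : realType) (M : manifold R) := VBundle {
  fiber :> M -> vectType R;
  trivs : set (ltriv fiber);
  trivs_cover : forall x : M, exists2 t, trivs t & lt_dom t x;
  trivs_compat : forall s t, trivs s -> trivs t ->
    forall (i : 'I_(lt_rank s)) (j : 'I_(lt_rank t)),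
    smooth_on (lt_dom s `&` lt_dom t)
      (fun x => lt_map t x (lt_inv s x (delta_mx 0 i)) 0 j) }.

Definition smooth_section (R : realType) (M : manifold R) (E : vbundle M)
    (s : forall x, E x) :=
  forall t, trivs t -> forall j : 'I_(lt_rank t),
    smooth_on (lt_dom t) (fun x => lt_map t x (s x) 0 j).

Record section (R : realType) (M : manifold R) (E : vbundle M) := MkSection {
  sec :> forall x, E x;
  secP : smooth_section sec }.

Section Sections.
Context {R : realType} {M : manifold R} {E : vbundle M}.
Local Notation G := (section E).
Implicit Types s u : G.

Lemma sec_eq s u : (forall x, s x = u x) -> s = u.
Proof.
case: s u => [s ss] [u su] /= suE.
have {}suE : s = u by exact: functional_extensionality_dep.
subst u.
by congr MkSection; exact: Prop_irrelevance.
Qed.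

Lemma sec0_subproof : smooth_section (fun x => 0 : E x).
Proof.
move=> t tt j; rewrite (_ : (fun _ => _) = fun=> 0); first exact: smooth_on_cst.
by apply/funext => x; rewrite linear0 mxE.
Qed.
Lemma secD_subproof s u : smooth_section (fun x => s x + u x).
Proof.
move=> t tt j; have := smooth_onD (secP s tt j) (secP u tt j).
by congr smooth_on; apply/funext => x; rewrite linearD mxE.
Qed.
Lemma secN_subproof s : smooth_section (fun x => - s x).
Proof.
move=> t tt j; have := smooth_onN (secP s tt j).
by congr smooth_on; apply/funext => x; rewrite linearN mxE.
Qed.
Lemma secZ_subproof (c : R) s : smooth_section (fun x => c *: s x).
Proof.
move=> t tt j; have := smooth_onZ c (secP s tt j).
by congr smooth_on; apply/funext => x; rewrite linearZ mxE.
Qed.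
Lemma secM_subproof (f : smoothfun M) s : smooth_section (fun x => f x *: s x).
Proof.
move=> t tt j; have := smooth_onM (@smooth_onW _ _ (lt_dom t) _ (sfunP f)) (secP s tt j).
by congr smooth_on; apply/funext => x; rewrite linearZ mxE.
Qed.

HB.instance Definition _ := gen_eqMixin G.
HB.instance Definition _ := gen_choiceMixin G.

Definition sec0 : G := MkSection sec0_subproof.
Definition sec_add s u : G := MkSection (secD_subproof s u).
Definition sec_opp s : G := MkSection (secN_subproof s).
Definition sec_scale (c : R) s : G := MkSection (secZ_subproof c s).
Definition sec_mul (f : smoothfun M) s : G := MkSection (secM_subproof f s).

Let addA : associative sec_add.
Proof. by move=> f g h; apply: sec_eq => x /=; rewrite addrA. Qed.
Let addC : commutative sec_add.
Proof. by move=> f g; apply: sec_eq => x /=; rewrite addrC. Qed.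
Let add0 : left_id sec0 sec_add.
Proof. by move=> f; apply: sec_eq => x /=; rewrite add0r. Qed.
Let addN : left_inverse sec0 sec_opp sec_add.
Proof. by move=> f; apply: sec_eq => x /=; rewrite addNr. Qed.
HB.instance Definition _ := GRing.isZmodule.Build G addA addC add0 addN.

Let scaleA a b s : sec_scale a (sec_scale b s) = sec_scale (a * b) s.
Proof. by apply: sec_eq => x /=; rewrite scalerA. Qed.
Let scale1 : left_id 1 sec_scale.
Proof. by move=> f; apply: sec_eq => x /=; rewrite scale1r. Qed.
Let scaleDr : right_distributive sec_scale +%R.
Proof. by move=> c f g; apply: sec_eq => x /=; rewrite scalerDr. Qed.
Let scaleDl s : {morph sec_scale^~ s : a b / a + b}.
Proof. by move=> a b; apply: sec_eq => x /=; rewrite scalerDl. Qed.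
HB.instance Definition _ :=
  GRing.Zmodule_isLmodule.Build R G scaleA scale1 scaleDr scaleDl.

End Sections.

Record algebroid (R : realType) (M : manifold R) := Algebroid {
  abundle :> vbundle M;
  anchor : forall x : M, abundle x -> tangent x;
  anchor_linear : forall (x : M) (c : R) (u v : abundle x) (f : smoothfun M),
    anchor (c *: u + v) f = c * anchor u f + anchor v f;
  (* smoothness of the bundle map, read on the local frames of A *)
  anchor_smooth : forall t, trivs t -> forall (i : 'I_(lt_rank t)) (f : smoothfun M),
    smooth_on (lt_dom t) (fun x => anchor (lt_inv t x (delta_mx 0 i)) f);
  bracket : section abundle -> section abundle -> section abundle;
  bracket_linearl : forall (c : R) a a' b,
    bracket (c *: a + a') b = c *: bracket a b + bracket a' b;
  bracket_linearr : forall (c : R) a b b',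
    bracket a (c *: b + b') = c *: bracket a b + bracket a b';
  bracket_alt : forall a, bracket a a = 0;
  bracket_jacobi : forall a b c,
    bracket a (bracket b c) + bracket b (bracket c a) + bracket c (bracket a b) = 0;
  bracket_leibniz : forall a (f : smoothfun M) b (x : M),
    bracket a (sec_mul f b) x = f x *: bracket a b x + anchor (a x) f *: b x }.

Section CovariantDifferentialOperators.
Context {R : realType} {M : manifold R} (E : vbundle M).
Implicit Types (l : section E -> section E) (X Y : forall x : M, tangent x).

Definition leibniz_for l X := forall (f : smoothfun M) (z : section E) (x : M),
  l (sec_mul f z) x = f x *: l z x + X x f *: z x.

(* l is a covariant differential operator and X its associated vector field *)
Definition cdo_with_symbol l X :=
  [/\ forall (c : R) (z w : section E), l (c *: z + w) = c *: l z + l w,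
      smooth_vfield X, leibniz_for l X &
      forall Y, smooth_vfield Y -> leibniz_for l Y -> forall x f, Y x f = X x f].

End CovariantDifferentialOperators.

Record connection (R : realType) (M : manifold R) (A : algebroid M)
    (E : vbundle M) := Connection {
  nabla :> section A -> section E -> section E;
  nabla_linear : forall (c : R) a b z, nabla (c *: a + b) z = c *: nabla a z + nabla b z;
  nabla_cdo : forall a, cdo_with_symbol (nabla a) (fun x => anchor (a x)) }.

Section Chern.
Context {R : realType}.

Definition curvature (S : Type) (W : zmodType) (br : S -> S -> S)
    (D : S -> W -> W) (a b : S) (w : W) : W :=
  D a (D b w) - D b (D a w) - D (br a b) w.

(* The endomorphism of the fibre E_x given by a C^oo(M)-linear operator L on
   sections. *)
Definition fiber_endo (M : manifold R) (E : vbundle M)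
    (L : section E -> section E) (x : M) : 'End(E x) :=
  xget 0 [set phi : 'End(E x) | forall z : section E, L z x = phi (z x)].

Definition lfun_trace (V : vectType R) (phi : 'End(V)) : R :=
  \tr (passmx.mxof (vbasis {:V}) (vbasis {:V}) phi).

Lemma even_ord_subproof p (i : 'I_p) : (2 * i < 2 * p)%N.
Proof. by rewrite ltn_pmul2l. Qed.
Lemma odd_ord_subproof p (i : 'I_p) : ((2 * i).+1 < 2 * p)%N.
Proof. by rewrite !mul2n ltn_Sdouble. Qed.
Definition even_ord p (i : 'I_p) := Ordinal (even_ord_subproof i).
Definition odd_ord p (i : 'I_p) := Ordinal (odd_ord_subproof i).

(* The value on u of the p-th power of an End(V)-valued 2-cochain Q; only the
   first 2p entries of u matter. *)
Definition cochain_pow (V : vectType R) (S : zmodType) (p : nat)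
    (Q : S -> S -> 'End(V)) (u : seq S) : 'End(V) :=
  (2 ^+ p)^-1 *: \sum_(tau : 'S_(2 * p)) (-1) ^+ tau *:
    \big[@comp_lfun _ _ _ _ / \1%VF]_(i < p)
      Q u`_(tau (even_ord i)) u`_(tau (odd_ord i)).

Context {M : manifold R} (A : algebroid M) (E : vbundle M).

(* A cochain of degree n is a function on sequences of sections of A, of which
   only the values on sequences of length n are relevant. *)
Definition cochain := seq (section A) -> M -> R.

Definition delete (T : Type) (i : nat) (s : seq T) := take i s ++ drop i.+1 s.

(* Indices start from 0, which does not change the sign (-1)^(i+j) and turns
   (-1)^(i+1) into (-1)^i. *)
Definition dA (eta : cochain) : cochain := fun a x =>
  \sum_(i < size a) (-1) ^+ i * anchor (a`_i x) (to_smooth (eta (delete i a)))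
  + \sum_(j < size a) \sum_(i < size a | (i < j)%N) (-1) ^+ (i + j) *
      eta (bracket a`_i a`_j :: delete i (delete j a)) x.

Definition ch (p : nat) (nb : connection A E) : cochain := fun a x =>
  lfun_trace (cochain_pow p
    (fun b c => fiber_endo (curvature (@bracket _ _ A) nb b c) x) a).

End Chern.

Section AffineCombination.
Context {R : realType} {M : manifold R} {A : algebroid M} {E : vbundle M}.
Context {k : nat}.

(* Constant sections X x a of the Lie algebroid TR^k x A over R^k x M; they form
   a Lie subalgebra and are the only arguments needed in cs. *)
Definition const_section : zmodType := ('rV[R]_k * section A)%type.

Definition const_bracket (u v : const_section) : const_section :=
  (0, bracket u.2 v.2).

(* Sections of pr_2^* E, as families of sections of E indexed by R^k. *)
Definition family : zmodType := 'rV[R]_k -> section E.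

(* The derivative at t of the family s in the direction X; the derivative in
   the finite-dimensional space E_x is tested on linear forms. The value on a
   family without such a derivative is irrelevant. *)
Definition family_derive (X t : 'rV[R]_k) (s : family) : section E :=
  xget 0 [set z : section E | forall (x : M) (phi : {linear E x -> R^o}),
    is_derive t X (fun t' => phi (s t' x) : R) (phi (z x))].

(* The affine combination along constant sections. On the smooth sections of
   pr_2^* E this is the extension by the Leibniz rule of its values on the
   families that do not depend on t: there the first summand vanishes. *)
Definition nabla_aff (nb : 'I_k.+1 -> connection A E)
    (u : const_section) (s : family) : family := fun t =>
  family_derive u.1 t s +
  ((1 - \sum_(i < k) t 0 i) *: nb ord0 u.2 (s t) +
   \sum_(i < k) t 0 i *: nb (lift ord0 i) u.2 (s t)).

Definition ch_aff (p : nat) (nb : 'I_k.+1 -> connection A E)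
    (u : seq const_section) (t : 'rV[R]_k) (x : M) : R :=
  lfun_trace (cochain_pow p
    (fun v w => fiber_endo
       (fun z => curvature const_bracket (nabla_aff nb) v w (fun=> z) t) x) u).

End AffineCombination.

Definition simplex (R : realType) (k : nat) : set 'rV[R]_k :=
  [set t | (forall i, 0 <= t 0 i) /\ \sum_i t 0 i <= 1].

(* The Lebesgue integral over R^k, as an iterated integral. *)
Fixpoint integral_rV (R : realType) (k : nat) : ('rV[R]_k -> R) -> R :=
  match k with
  | 0 => fun f => f 0
  | k'.+1 => fun f =>
      \int[@lebesgue_measure R]_s
        integral_rV (fun t : 'rV[R]_k' => f (row_mx (s%:M : 'rV_1) t))
  end.

Definition integral_simplex (R : realType) (k : nat) (f : 'rV[R]_k -> R) : R :=
  integral_rV (fun t => \1_(@simplex R k) t * f t).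

Definition cs (R : realType) (M : manifold R) (A : algebroid M) (E : vbundle M)
    (p k : nat) : ('I_k.+1 -> connection A E) -> cochain A :=
  match k with
  | 0 => fun nb => ch p (nb ord0)
  | k'.+1 => fun nb a x =>
      integral_simplex (fun t => ch_aff p nb
        ([seq (delta_mx 0 j, 0) | j <- enum 'I_k'.+1] ++ [seq (0, b) | b <- a]) t x)
  end.

(* Main.v *)
Require Import Defs.
From HB Require Import structures.
From mathcomp Require Import all_boot all_order all_algebra.
From mathcomp Require Import perm.
From mathcomp Require Import all_classical all_reals all_analysis.
From mathcomp Require Import zify ring lra.

(** The curvature of the affine combination at constant sections is a polynomial
in the barycentric coordinates t_j of R^k whose values are C^oo(M)-linear
operators on the sections of E: it only involves the curvature of nabla^0, the
differences nabla^j - nabla^0 and their commutators with nabla^0. The connections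
need not be local in A, but these operators are tensorial in E, so that their
fibrewise trace is a smooth function, computed in a frame of E that is cut off by
a bump function; differentiating it along the anchor of a is taking the trace of
the commutator with nabla_a. Together with the Bianchi identity this makes the
trace of the alternating p-th power of the curvature closed for the differential
of TR^k x A. Evaluate this identity on d/dt^1, ..., d/dt^k, a_1, ..., a_n and
integrate over the simplex: the terms that differentiate along M give the
differential of cs_p, and those that differentiate in t reduce to the faces by
Stokes' formula, which for polynomials follows from Dirichlet's value of the
integrals of the monomials in barycentric coordinates. On the face t_j = 0 the
affine combination is that of the other connections. *)

Set Implicit Arguments.
Unset Strict Implicit.
Unset Printing Implicit Defensive.

Import Order.TTheory GRing.Theory Num.Theory.
Import numFieldNormedType.Exports.

Local Open Scope ring_scope.

(** * Alternating sums and powers of a curvature *)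

(** The affine family is written as nabla^0 + sum_j t_j theta_j with theta_j = nabla^j - nabla^0,
    for free values of all k+1 coordinates; where they add up to 1 this is the affine combination.
    Independent coordinates make the faces symmetric: Stokes' formula says that the integral of the
    j-th partial derivative plus the integral over the face b_j = 0 does not depend on j. As theta_0
    = 0, the derivative for j = 0 vanishes, and every other one becomes a difference of two faces.
    The resulting copies of the face b_0 = 0 combine into a single form. Polynomials with values in
    operators or smooth functions are finite lists of exponents and coefficients, and integration
    replaces each monomial by a number. Smoothness of cs_p and differentiation under the integral
    sign thereby reduce to finite sums. Closedness of the alternating power holds in the algebra of
    operators itself, before traces are taken. *)

Definition papp n (s : 'S_n) (k : nat) : nat :=
  oapp (fun i : 'I_n => s i : nat) k (insub k).

Lemma papp_ord n (s : 'S_n) (i : 'I_n) : papp s i = s i.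
Proof. by rewrite /papp valK. Qed.

Lemma papp_lt n (s : 'S_n) k (kn : (k < n)%N) : papp s k = s (Ordinal kn).
Proof. by rewrite -papp_ord. Qed.

Lemma papp_ge n (s : 'S_n) k : (n <= k)%N -> papp s k = k.
Proof. by move=> nk; rewrite /papp insubN // -leqNgt. Qed.

Lemma pappM n (s t : 'S_n) : papp (s * t)%g = papp t \o papp s.
Proof.
apply/funext => k /=; have [kn|nk] := ltnP k n; last by rewrite !papp_ge.
by rewrite !(papp_lt _ kn) permM papp_ord.
Qed.

Lemma papp1 n : papp (1%g : 'S_n) = id.
Proof.
apply/funext => k /=; have [kn|nk] := ltnP k n; last by rewrite papp_ge.
by rewrite (papp_lt _ kn) perm1.
Qed.

Lemma papp_tperm n (i j : 'I_n) k :
  papp (tperm i j) k =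
  if k == i then j : nat else if k == j then i : nat else k.
Proof.
have [kn|nk] := ltnP k n; last first.
  rewrite papp_ge // !ifF //; apply/eqP => kE.
    by have := ltn_ord j; rewrite -kE ltnNge nk.
  by have := ltn_ord i; rewrite -kE ltnNge nk.
rewrite (papp_lt _ kn); case: tpermP => [/(congr1 val) /= ->|/(congr1 val) /= ->|/eqP ki /eqP kj] /=.
- by rewrite eqxx.
- by rewrite eqxx; case: eqP.
- by move: ki kj; rewrite -!val_eqE /= => /negPf -> /negPf ->.
Qed.

Lemma papp_lift n (i j : 'I_n.+1) (s : 'S_n) k :
  papp (lift_perm i j s) k =
  if k == i then j : nat else bump j (papp s (unbump i k)).
Proof.
have [kn|nk] := ltnP k n.+1; last first.
  have li := ltn_ord i; have lj := ltn_ord j.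
  rewrite papp_ge // ifF; last by apply/eqP => kE; move: nk; rewrite kE; lia.
  by rewrite papp_ge /unbump /bump; lia.
rewrite (papp_lt _ kn); have [kE|/eqP kE] := eqVneq k i.
  by rewrite (_ : Ordinal kn = i) ?lift_perm_id //; apply: val_inj.
have [k' kk'|kk'] := unliftP i (Ordinal kn); last by case: kE; rewrite -kk'.
rewrite kk' lift_perm_lift /= -(papp_ord s).
by rewrite (_ : k = bump i k') ?bumpK //; case: kk'.
Qed.

Definition ins (S : Type) (q : nat) (x : S) (y : nat -> S) (k : nat) : S :=
  if k == q then x else y (unbump q k).

(** A permutation is determined by the image of [i] and by what it induces on the remaining points;
    injectivity suffices because both sides have (n+1)! elements. *)
Lemma lift_perm_bij n (i : 'I_n.+1) :
  bijective (fun js : 'I_n.+1 * 'S_n => lift_perm i js.1 js.2).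
Proof.
apply: inj_card_bij; last by rewrite card_prod !card_Sn card_ord factS.
move=> [j s] [j' s'] /= e.
have jj : j = j' by have := congr1 (fun t : 'S_n.+1 => t i) e; rewrite !lift_perm_id.
subst j'; congr pair; apply/permP => k.
have := congr1 (fun t : 'S_n.+1 => t (lift i k)) e.
by rewrite !lift_perm_lift => /lift_inj.
Qed.

Lemma lift_perm_bijV n (j : 'I_n.+1) :
  bijective (fun js : 'I_n.+1 * 'S_n => lift_perm js.1 j js.2).
Proof.
apply: inj_card_bij; last by rewrite card_prod !card_Sn card_ord factS.
move=> [i s] [i' s'] /= e.
have : lift_perm j i s^-1 = lift_perm j i' s'^-1 by rewrite -!lift_permV e.
have [g gK _] := lift_perm_bij j.
by move=> /(congr1 g); rewrite (gK (i, _)) (gK (i', _)) => -[-> /invg_inj ->].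
Qed.

Section Alternation.
Variables (R : pzRingType) (V : lmodType R) (S : Type).
Implicit Types (Phi : (nat -> S) -> V) (u : nat -> S).

(** Arguments are infinite sequences and [papp] extends a permutation by the identity, so that
    permuting arguments is mere composition and no degree occurs in the type of [Phi]. *)
Definition alt n Phi u : V :=
  \sum_(s : 'S_n) (-1) ^+ s *: Phi (u \o papp s).

Lemma altD n Phi Phi' u :
  alt n (fun y => Phi y + Phi' y) u = alt n Phi u + alt n Phi' u.
Proof. by rewrite -big_split; apply: eq_bigr => s _; rewrite scalerDr. Qed.

Lemma altN n Phi u : alt n (fun y => - Phi y) u = - alt n Phi u.
Proof. by rewrite -sumrN; apply: eq_bigr => s _; rewrite scalerN. Qed.

Lemma alt_sum (I : finType) n (Phi : I -> (nat -> S) -> V) u :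
  alt n (fun y => \sum_i Phi i y) u = \sum_i alt n (Phi i) u.
Proof. by rewrite exchange_big; apply: eq_bigr => s _; rewrite scaler_sumr. Qed.

Lemma eq_alt n Phi Phi' u : Phi =1 Phi' -> alt n Phi u = alt n Phi' u.
Proof. by move=> e; apply: eq_bigr => s _; rewrite e. Qed.

(** Here the slots of [Phi] are permuted, in [alt_perm] the arguments: these are translations of the
    symmetric group on opposite sides. *)
Lemma alt_comp_perm n Phi (t : 'S_n) u :
  alt n (fun y => Phi (y \o papp t)) u = (-1) ^+ t *: alt n Phi u.
Proof.
rewrite /alt scaler_sumr [RHS](reindex_inj (mulgI t)); apply: eq_bigr => s _.
rewrite pappM scalerA -signr_addb odd_permM addbA addbb addFb.
by congr (_ *: Phi _).
Qed.

Lemma alt_perm n Phi (t : 'S_n) u :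
  alt n Phi (u \o papp t) = (-1) ^+ t *: alt n Phi u.
Proof.
rewrite /alt scaler_sumr [RHS](reindex_inj (mulIg t)); apply: eq_bigr => s _.
rewrite pappM scalerA -signr_addb odd_permM addbC -addbA addbb addbF.
by congr (_ *: Phi _).
Qed.

(** Permutations are sorted by the argument that lands in slot 0; [alt_ins0] sorts them by the slot
    that receives argument 0. *)
Lemma alt_expand n Phi u :
  alt n.+1 Phi u =
  \sum_(i < n.+1) (-1) ^+ i *: alt n (fun y => Phi (ins 0 (u i) y)) (u \o bump i).
Proof.
rewrite /alt (reindex _ (onW_bij _ (lift_perm_bij ord0))) /=.
under [RHS]eq_bigr do rewrite scaler_sumr.
rewrite pair_big /=; apply: eq_bigr => -[i s] _ /=.
rewrite odd_lift_perm /= signr_addb signr_odd -scalerA; congr (_ *: (_ *: Phi _)).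
by apply/funext => k /=; rewrite papp_lift /ins /=; case: eqP.
Qed.

Lemma alt_expand_eq n N Phi u : n = N.+1 -> alt n Phi u =
  \sum_(i < n) (-1) ^+ i *: alt N (fun y => Phi (ins 0 (u i) y)) (u \o bump i).
Proof. by move=> ->; rewrite alt_expand. Qed.

Lemma alt_ins0 n Phi x u :
  alt n.+1 Phi (ins 0 x u) =
  \sum_(q < n.+1) (-1) ^+ q *: alt n (fun y => Phi (ins q x y)) u.
Proof.
rewrite /alt (reindex _ (onW_bij _ (lift_perm_bijV ord0))) /=.
under [RHS]eq_bigr do rewrite scaler_sumr.
rewrite pair_big /=; apply: eq_bigr => -[i s] _ /=.
rewrite odd_lift_perm addbF signr_addb signr_odd -scalerA.
congr (_ *: (_ *: Phi _)).
apply/funext => k /=; rewrite papp_lift /ins /=; case: (k == i) => //=.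
by rewrite /unbump /= subn1.
Qed.

Lemma alt_ins n Phi (q : 'I_n.+1) x u :
  alt n.+1 Phi (ins q x u) = (-1) ^+ q *: alt n.+1 Phi (ins 0 x u).
Proof.
rewrite (_ : ins q x u = ins 0 x u \o papp (lift_perm q ord0 1)).
  by rewrite alt_perm odd_lift_perm odd_perm1 !addbF signr_odd.
apply/funext => k /=; rewrite papp_lift papp1 /ins; case: (k == q) => //=.
by rewrite /unbump /= subn1.
Qed.

End Alternation.

(** The left side enumerates ordered pairs of distinct positions [i] and [bump i j]; the right side
    groups the two orders of each pair. *)
Lemma sum_pairs (V : zmodType) n (g : nat -> nat -> V) :
  \sum_(i < n.+1) \sum_(j < n) g i j =
  \sum_(j < n.+1) \sum_(i < n.+1 | (i < j)%N) (g j i + g i j.-1).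
Proof.
under [RHS]eq_bigr do rewrite big_split /=.
rewrite big_split /=.
under eq_bigr => i _ do rewrite (bigID (fun j : 'I_n => (j < i)%N)) /=.
rewrite big_split /=; congr (_ + _).
  apply: eq_bigr => i _.
  rewrite -(big_mkord (fun j => j < i)%N (g i)) -(big_mkord (fun j => j < i)%N (g i)).
  rewrite [RHS]big_mkcond /= big_nat_recr //= ifF ?addr0 -?big_mkcond //.
  by rewrite ltnNge -ltnS ltn_ord.
rewrite (exchange_big_dep xpredT) //= [RHS]big_ord_recl /=.
rewrite [X in _ = X + _]big_pred0 // add0r; apply: eq_bigr => j _ /=.
by apply: eq_bigl => i; rewrite /bump /= add1n ltnS -leqNgt.
Qed.

Lemma big_ord_double (V : zmodType) p (f : nat -> V) :
  \sum_(q < 2 * p) f q = \sum_(m < p) (f (2 * m)%N + f (2 * m).+1).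
Proof.
elim: p => [|p IH]; first by rewrite !big_ord0.
by rewrite mulnS !big_ord_recr /= IH addrA.
Qed.

Section ProdOneSlot.
Variables (Rg : pzRingType) (p : nat) (m : 'I_p).
Implicit Types f g : nat -> Rg.

Definition slot x f := \prod_(l < p) (if l == m then x else f l).

Lemma slot_split x f :
  slot x f = (\prod_(0 <= l < m) f l) * x * \prod_(m.+1 <= l < p) f l.
Proof.
rewrite /slot.
rewrite -(big_mkord xpredT (fun l => if l == m :> nat then x else f l)).
rewrite (big_cat_nat (leq0n m) (ltnW (ltn_ord m))) /=.
rewrite -mulrA; congr (_ * _).
  by apply: eq_big_nat => l /andP[_ lm]; rewrite ltn_eqF.
rewrite big_ltn // eqxx; congr (_ * _).
by apply: eq_big_nat => l /andP[lm _]; rewrite gtn_eqF.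
Qed.

Lemma slotD x y f : slot (x + y) f = slot x f + slot y f.
Proof. by rewrite !slot_split mulrDr mulrDl. Qed.

Lemma slotN x f : slot (- x) f = - slot x f.
Proof. by rewrite !slot_split mulrN mulNr. Qed.

Lemma eq_slot x f g : (forall l, l != m -> f l = g l) -> slot x f = slot x g.
Proof.
move=> fg; apply: eq_bigr => l _; case: eqP => // /eqP lm.
by rewrite fg.
Qed.

Lemma slot_id f : slot (f m) f = \prod_(l < p) f l.
Proof. by apply: eq_bigr => l _; case: eqP => [->|]. Qed.

End ProdOneSlot.

(** * Closedness of the alternating powers of a curvature *)

Section Chern.
Variables (R : numDomainType) (Rg : algType R) (S : zmodType).
Variables (Q : S -> S -> Rg) (br : S -> S -> S) (DQ : S -> S -> S -> Rg).
Hypothesis Qanti : forall x y, Q x y = - Q y x.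
Hypothesis QN : forall x y, Q (- x) y = - Q x y.
Hypothesis branti : forall x y, br x y = - br y x.
Hypothesis bianchi : forall x y z,
  DQ x y z + DQ y z x + DQ z x y = Q (br x y) z + Q (br y z) x + Q (br z x) y.
Hypothesis inj_nat : forall n (x y : Rg), n.+1%:R *: x = n.+1%:R *: y -> x = y.

Definition qprod p (y : nat -> S) := \prod_(l < p) Q (y (2 * l)%N) (y (2 * l).+1).

(** The Leibniz expansion of the covariant derivative of [qprod] in the direction [x], with [DQ] as
    the covariant derivative of [Q]. *)
Definition dqprod p (x : S) (y : nat -> S) : Rg :=
  \sum_(m < p) slot m (DQ x (y (2 * m)%N) (y (2 * m).+1))
                      (fun l => Q (y (2 * l)%N) (y (2 * l).+1)).

(* Off the slot of x the inserted value is irrelevant; 0 is a placeholder. *)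
Lemma qprod_ins_even p (m : 'I_p) x y : qprod p (ins (2 * m) x y) =
  slot m (Q x (y (2 * m)%N))
    (fun l => Q (ins (2 * m) 0 y (2 * l)%N) (ins (2 * m) 0 y (2 * l).+1)).
Proof.
rewrite /qprod -(@slot_id _ _ m (fun l => Q (ins (2 * m) x y (2 * l)%N) (ins (2 * m) x y (2 * l).+1))).
have -> : ins (2 * m) x y (2 * m)%N = x by rewrite /ins eqxx.
have -> : ins (2 * m) x y (2 * m).+1 = y (2 * m)%N.
  by rewrite /ins gtn_eqF //; congr y; rewrite /unbump; lia.
apply: eq_slot => l lm; have lm' : (l : nat) != m by [].
by rewrite /ins !ifF //; apply/negP => /eqP; lia.
Qed.

Lemma qprod_insN p (m : 'I_p) x y :
  qprod p (ins (2 * m) (- x) y) = - qprod p (ins (2 * m) x y).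
Proof. by rewrite !qprod_ins_even QN slotN. Qed.

Lemma qprod_ins_odd p (m : 'I_p) x y :
  qprod p (ins (2 * m).+1 x y) = - qprod p (ins (2 * m) x y).
Proof.
rewrite qprod_ins_even -slotN -Qanti /qprod.
rewrite -(@slot_id _ _ m (fun l => Q (ins (2 * m).+1 x y (2 * l)%N) (ins (2 * m).+1 x y (2 * l).+1))).
rewrite [in LHS]/ins eqxx ltn_eqF // (_ : unbump _ _ = (2 * m)%N); last first.
  by rewrite /unbump; lia.
apply: eq_slot => l lm; rewrite /ins /unbump.
have lm' : (l : nat) != m by [].
by rewrite !ifF; try (apply/negP => /eqP; lia); congr (Q (y _) (y _)); lia.
Qed.

(** Slots come in pairs, one for each factor [Q]. Passing from slot 2m to slot 2m+1 reverses both
    the sign of the product and the sign of the position, whence the factor 2. *)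
Lemma alt_qprod_ins0 p N x u : (2 * p = N.+1)%N ->
  alt (2 * p) (qprod p) (ins 0 x u) =
  (\sum_(m < p) alt N (fun y => qprod p (ins (2 * m) x y)) u) *+ 2.
Proof.
move=> pN; rewrite pN alt_ins0 -pN.
rewrite (@big_ord_double _ _ (fun q => (-1) ^+ q *: alt N (fun y => qprod p (ins q x y)) u)).
rewrite -sumrMnl; apply: eq_bigr => m _.
rewrite (@eq_alt _ _ _ _ _ _ u (fun y => qprod_ins_odd m x y)) altN exprS !mulN1r scaleNr scalerN opprK.
by rewrite mul2n -signr_odd odd_double expr0 scale1r.
Qed.

(** Factor [l] takes the arguments 2l+1 and 2l+2, which leaves argument 0 free: it enters factor [m]
    through a bracket here and as the direction of differentiation in [deriv_slot]. *)
Definition bracket_slot p (m : 'I_p) (y : nat -> S) :=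
  slot m (Q (br (y 0%N) (y (2 * m).+1)) (y (2 * m).+2)) (fun l => Q (y (2 * l).+1) (y (2 * l).+2)).

Definition deriv_slot p (m : 'I_p) (y : nat -> S) :=
  slot m (DQ (y 0%N) (y (2 * m).+1) (y (2 * m).+2)) (fun l => Q (y (2 * l).+1) (y (2 * l).+2)).

(** The cyclic permutations of the arguments 0, 2m+1, 2m+2 are even, so that summing over them
    multiplies an alternating sum by 3; the cyclic sums of the two sides agree by the Bianchi
    identity. *)
Lemma alt_deriv_slot p (m : 'I_p) u : alt (2 * p).+1 (deriv_slot m) u = alt (2 * p).+1 (bracket_slot m) u.
Proof.
have lb : ((2 * m).+1 < (2 * p).+1)%N by have := ltn_ord m; lia.
have lc : ((2 * m).+2 < (2 * p).+1)%N by have := ltn_ord m; lia.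
pose a : 'I_(2 * p).+1 := ord0; pose b := Ordinal lb; pose c := Ordinal lc.
pose s := (tperm a b * tperm b c)%g; pose t := (tperm b c * tperm a b)%g.
have ab : a != b by [].
have bc : b != c by rewrite -val_eqE /=; lia.
have os : (s : bool) = false by rewrite odd_permM !odd_tperm ab bc.
have ot : (t : bool) = false by rewrite odd_permM !odd_tperm ab bc.
have K (Phi : (nat -> S) -> Rg) :
    alt (2 * p).+1 (fun y => Phi y + Phi (y \o papp t) + Phi (y \o papp s)) u
    = 3%:R *: alt (2 * p).+1 Phi u.
  by rewrite !altD !alt_comp_perm os ot !scale1r scaler_nat !mulrS mulr0n addr0 addrA.
(* [inj_nat 2] cancels the factor 3. *)
apply: (@inj_nat 2); rewrite -!K; apply: eq_alt => y.
have sE : [/\ papp s 0 = (2 * m).+2, papp s (2 * m).+1 = 0%N &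
              papp s (2 * m).+2 = (2 * m).+1].
  by rewrite !pappM /= !papp_tperm /=; split;
    do ?[rewrite eqxx /= | rewrite (ltn_eqF (ltnSn _)) /= | rewrite (gtn_eqF (ltnSn _)) /=].
have tE : [/\ papp t 0 = (2 * m).+1, papp t (2 * m).+1 = (2 * m).+2 &
              papp t (2 * m).+2 = 0%N].
  by rewrite !pappM /= !papp_tperm /=; split;
    do ?[rewrite eqxx /= | rewrite (ltn_eqF (ltnSn _)) /= | rewrite (gtn_eqF (ltnSn _)) /=].
have E l : l != m -> (forall e, e \in [:: s; t] ->
    papp e (2 * l).+1 = (2 * l).+1 /\ papp e (2 * l).+2 = (2 * l).+2).
  move=> lm e; have : l != m :> nat by [].
  rewrite !inE => lm' /orP[] /eqP ->; rewrite pappM /= !papp_tperm /=.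
    by split; do ?case: ifP; lia.
  by split; do ?case: ifP; lia.
case: sE => s1 s2 s3; case: tE => t1 t2 t3.
have GE (X : S -> S -> S -> Rg) e : e \in [:: s; t] ->
  slot m (X (y (papp e 0)) (y (papp e (2 * m).+1)) (y (papp e (2 * m).+2)))
    (fun l => Q (y (papp e (2 * l).+1)) (y (papp e (2 * l).+2))) =
  slot m (X (y (papp e 0)) (y (papp e (2 * m).+1)) (y (papp e (2 * m).+2)))
    (fun l => Q (y (2 * l).+1) (y (2 * l).+2)).
  by move=> es; apply: eq_slot => l lm; have [-> ->] := E l lm e es.
rewrite /deriv_slot /bracket_slot /= !GE ?inE ?eqxx ?orbT //.
rewrite !(GE (fun x y z => Q (br x y) z)) ?inE ?eqxx ?orbT //.
rewrite s1 s2 s3 t1 t2 t3 -!slotD; congr slot.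
exact: bianchi.
Qed.

Lemma alt_bracket_slot p (m : 'I_p) u N : (2 * p = N.+1)%N -> alt (2 * p).+1 (bracket_slot m) u =
  \sum_(i < (2 * p).+1) \sum_(j < 2 * p) (-1) ^+ (i + j) *:
    alt N (fun y => qprod p (ins (2 * m) (br (u i) (u (bump i j))) y))
      (u \o bump i \o bump j).
Proof.
move=> pN.
have lb : ((2 * m).+1 < (2 * p).+1)%N by have := ltn_ord m; lia.
have l1 : (1 < (2 * p).+1)%N by lia.
(* Takes 1 to 2m+1 and keeps the order of the others; both positions are odd, so that the sign is
   +1. *)
pose s := lift_perm (Ordinal l1) (Ordinal lb) 1.
pose H' (z : nat -> S) := qprod p (ins (2 * m) (br (z 0%N) (z 1%N)) (fun k => z k.+2)).
have -> : alt (2 * p).+1 (bracket_slot m) u = alt (2 * p).+1 H' u.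
  transitivity ((-1) ^+ s *: alt (2 * p).+1 H' u); last first.
    by rewrite odd_lift_perm odd_perm1 /= mul2n odd_double scale1r.
  rewrite -alt_comp_perm; apply: eq_alt => y.
  rewrite /H' qprod_ins_even /bracket_slot /= !papp_lift !papp1 /=.
  have -> : bump (2 * m).+1 (unbump 1 0) = 0%N by rewrite /bump /unbump; lia.
  have -> : bump (2 * m).+1 (unbump 1 (2 * m).+2) = (2 * m).+2.
    by rewrite /bump /unbump; lia.
  apply: eq_slot => l lm; have lm' : l != m :> nat by [].
  rewrite /ins !papp_lift !papp1 /= !ifF; try by apply/negP => /eqP; lia.
  by congr (Q (y _) (y _)); rewrite /bump /unbump; lia.
rewrite alt_expand; apply: eq_bigr => i _; rewrite (alt_expand_eq _ _ pN) scaler_sumr.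
apply: eq_bigr => j _; rewrite scalerA -exprD; congr (_ *: _).
apply: eq_alt => y; congr (qprod _ (ins _ (br _ (u _)) _)).
by apply/funext => k; rewrite /ins /unbump /= !subn1.
Qed.

(** Bianchi turns the first sum into one over ordered pairs of arguments, while the second runs over
    unordered ones; the factor 2 of [alt_qprod_ins0] makes them cancel. *)
Lemma alt_qprod_closed p (u : nat -> S) : (0 < p)%N ->
  \sum_(i < (2 * p).+1) (-1) ^+ i *: alt (2 * p) (dqprod p (u i)) (u \o bump i) +
  \sum_(j < (2 * p).+1) \sum_(i < (2 * p).+1 | (i < j)%N) (-1) ^+ (i + j) *:
    alt (2 * p) (qprod p) (ins 0 (br (u i) (u j)) (u \o bump j \o bump i)) = 0.
Proof.
move=> p0; have pN : (2 * p = (2 * p).-1.+1)%N by lia.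
set N := (2 * p).-1 in pN.
have -> : \sum_(i < (2 * p).+1) (-1) ^+ i *: alt (2 * p) (dqprod p (u i)) (u \o bump i)
    = \sum_(m < p) alt (2 * p).+1 (deriv_slot m) u.
  under [RHS]eq_bigr do rewrite alt_expand.
  rewrite exchange_big; apply: eq_bigr => i _ /=.
  rewrite -scaler_sumr -alt_sum; congr (_ *: _); apply: eq_alt => y.
  apply: eq_bigr => m _; rewrite /deriv_slot /ins /= {1 2}/unbump /= !subn1 /=.
  by apply: eq_slot => l _; rewrite /unbump /= !subn1.
under eq_bigr do rewrite alt_deriv_slot (alt_bracket_slot _ _ pN).
rewrite exchange_big /=; under eq_bigr do rewrite exchange_big /=.
pose h i j := (-1) ^+ (i + j) *: \sum_(m < p)
   alt N (fun y => qprod p (ins (2 * m) (br (u i) (u (bump i j))) y))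
      (u \o bump i \o bump j).
have -> : \sum_(i < (2 * p).+1) \sum_(j < 2 * p) \sum_(m < p)
    (-1) ^+ (i + j) *: alt N (fun y => qprod p (ins (2 * m) (br (u i) (u (bump i j))) y))
      (u \o bump i \o bump j) = \sum_(i < (2 * p).+1) \sum_(j < 2 * p) h i j.
  by apply: eq_bigr => i _; apply: eq_bigr => j _; rewrite /h scaler_sumr.
rewrite sum_pairs -big_split /= big1 // => j _; rewrite -big_split /= big1 // => i ij.
(* Exchanging the arguments of the bracket changes the sign, and so does the shift of the position
   by one. *)
have hE : h i j.-1 = h j i.
  rewrite /h.
  have -> : bump i j.-1 = j by rewrite /bump; lia.
  have -> : bump j i = i by rewrite /bump; lia.
  have -> : u \o bump i \o bump j.-1 = u \o bump j \o bump i.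
    by apply/funext => k /=; congr (u _); rewrite /bump; lia.
  have -> : (j + i = (i + j.-1).+1)%N by lia.
  rewrite exprS mulN1r scaleNr -scalerN -sumrN; congr (_ *: _).
  apply: eq_bigr => m _; rewrite -altN; apply: eq_alt => y.
  by rewrite branti qprod_insN.
rewrite hE -mulr2n (alt_qprod_ins0 _ _ pN) scalerMnr /h.
have -> : bump j i = i by rewrite /bump; lia.
rewrite [(j + i)%N]addnC -scalerDr -mulrnDl -big_split /= big1 ?mul0rn ?scaler0 // => m _.
rewrite -altD /alt big1 // => s _.
by rewrite branti qprod_insN addNr scaler0.
Qed.

Hypothesis QD : forall x y z, Q (x + y) z = Q x z + Q y z.
Variable p : nat.

Definition altpow (s : seq S) : Rg := alt (2 * p) (qprod p) (nth 0 s).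

Lemma nth_cat_ins (a b : seq S) x :
  nth 0 (a ++ x :: b) = ins (size a) x (nth 0 (a ++ b)).
Proof.
apply/funext => k; rewrite /ins !nth_cat; have [ka|ka|->] := ltngtP k (size a).
- by rewrite (_ : unbump (size a) k = k) ?ka // /unbump; lia.
- case: k ka => // k ka; rewrite (_ : unbump (size a) k.+1 = k).
    by rewrite ltnNge -ltnS ka /= subSn.
  by rewrite /unbump ka subn1.
- by rewrite subnn.
Qed.

Lemma altpow_move (a : seq S) x (b : seq S) : (size a < 2 * p)%N ->
  altpow (a ++ x :: b) = (-1) ^+ size a *: altpow (x :: a ++ b).
Proof.
rewrite /altpow (nth_cat_ins [::] (a ++ b)) nth_cat_ins /=.
case: (2 * p)%N => // N aN.
by rewrite (alt_ins (qprod p) (Ordinal aN)).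
Qed.

Lemma altpowB (a b : seq S) x y : (size a < 2 * p)%N ->
  altpow (a ++ (x - y) :: b) = altpow (a ++ x :: b) - altpow (a ++ y :: b).
Proof.
move=> ap; have pN : (2 * p = (2 * p).-1.+1)%N by lia.
rewrite !altpow_move // -scalerBr; congr (_ *: _).
rewrite /altpow !(nth_cat_ins [::] (a ++ b)) !(alt_qprod_ins0 _ _ pN).
rewrite -mulrnBl -sumrB; congr (_ *+ _); apply: eq_bigr => m _.
rewrite -altN -altD; apply: eq_alt => z.
by rewrite -qprod_insN !qprod_ins_even QD slotD.
Qed.

Lemma altpow_dup (s : seq S) i j : (i < j)%N -> (j < 2 * p)%N ->
  nth 0 s i = nth 0 s j -> altpow s = 0.
Proof.
move=> ij jp sij; have ip := ltn_trans ij jp.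
have nij : Ordinal ip != Ordinal jp by rewrite -val_eqE /= neq_ltn ij.
have : altpow s = - altpow s.
  rewrite {1}/altpow (_ : nth 0 s = nth 0 s \o papp (tperm (Ordinal ip) (Ordinal jp))).
    by rewrite alt_perm odd_tperm nij scaleN1r.
  apply/funext => k /=; rewrite papp_tperm /=.
  by case: eqP => [->//|_]; case: eqP => [->//|].
move/eqP; rewrite -addr_eq0 => /eqP e; apply: (@inj_nat 1).
by rewrite scaler0 scaler_nat mulr2n.
Qed.

(** A subtracted [v0] would repeat an entry of [a], and repetitions vanish. *)
Lemma altpow_sub_mem (a vs b : seq S) v0 : v0 \in a ->
  (size a + size vs <= 2 * p)%N ->
  altpow (a ++ [seq v - v0 | v <- vs] ++ b) = altpow (a ++ vs ++ b).
Proof.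
elim: vs a => [//|v vs IH] a v0a /= sz.
rewrite altpowB; last lia.
rewrite [X in _ - X](@altpow_dup _ (index v0 a) (size a)); last 3 first.
- by rewrite index_mem.
- lia.
- by rewrite !nth_cat index_mem v0a nth_index // ltnn subnn.
rewrite subr0 -!(cat_rcons v a) IH //; first by rewrite mem_rcons inE v0a orbT.
by rewrite size_rcons; lia.
Qed.

Lemma altpow_sub_pre (a vs b : seq S) v0 : (size a + size vs <= 2 * p)%N ->
  altpow (a ++ [seq v - v0 | v <- vs] ++ b) = altpow (a ++ vs ++ b) -
  \sum_(i < size vs) (-1) ^+ (size a + i) *:
     altpow (v0 :: a ++ delete i vs ++ b).
Proof.
elim: vs a => [|v vs IH] a /= sz; first by rewrite big_ord0 subr0.
rewrite altpowB; last lia.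
rewrite -!(cat_rcons v a) IH ?size_rcons; last lia.
rewrite -(cat_rcons v0 a) altpow_sub_mem; last 2 first.
- by rewrite mem_rcons inE eqxx.
- by rewrite size_rcons; lia.
rewrite !cat_rcons (altpow_move v0); last lia.
rewrite big_ord_recl /= addn0 /delete /= drop0 opprD addrA addrAC.
congr (_ - _ - _).
by apply: eq_bigr => i _; rewrite addnS cat_rcons.
Qed.

(** At most one difference can contribute its [v0]. Applied to the coordinate vectors, whose
    differences span the face opposite to the origin. *)
Lemma altpow_sub (vs b : seq S) v0 : (size vs <= 2 * p)%N ->
  altpow ([seq v - v0 | v <- vs] ++ b) =
  \sum_(i < (size vs).+1) (-1) ^+ i *: altpow (delete i (v0 :: vs) ++ b).
Proof.
move=> sz; rewrite (altpow_sub_pre (a := [::])) // big_ord_recl /delete /= drop0.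
rewrite scale1r; congr (_ + _); rewrite -sumrN; apply: eq_bigr => i _.
by rewrite exprS mulN1r scaleNr.
Qed.

End Chern.

(** * Stokes' formula for polynomials on the simplex *)

Section MonomialSums.
Variables (R : realType) (n : nat).
Implicit Types (al be : 'I_n -> nat) (b : 'I_n -> R).

Definition mono al b : R := \prod_i b i ^+ al i.

Lemma monoD al be b : mono (fun i => al i + be i)%N b = mono al b * mono be b.
Proof. by rewrite -big_split; apply: eq_bigr => i _; rewrite exprD. Qed.

(** Truncated subtraction: an exponent 0 stays 0, which is harmless since [mderiv] multiplies the
    coefficient by that exponent. *)
Definition lower (j : 'I_n) al i := (al i - (i == j))%N.

Section Values.
Variable V : lmodType R.
Implicit Types s : seq (('I_n -> nat) * V).

Definition meval s b : V := \sum_(l <- s) mono l.1 b *: l.2.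

Definition mderiv (j : 'I_n) s := [seq (lower j l.1, l.2 *+ l.1 j) | l <- s].

(* The values lie in a vector space without topology, so that the derivative is
   a formal one. *)
Definition pder (f : ('I_n -> R) -> V) (g : 'I_n -> ('I_n -> R) -> V) :=
  exists2 s, f =1 meval s & forall j, g j =1 meval (mderiv j s).

Lemma meval_cat s1 s2 b : meval (s1 ++ s2) b = meval s1 b + meval s2 b.
Proof. exact: big_cat. Qed.

Lemma pder_ext f f' g g' : f =1 f' -> (forall j, g j =1 g' j) -> pder f g -> pder f' g'.
Proof.
move=> ff gg [s fs gs]; exists s => [b|j b]; first by rewrite -ff fs.
by rewrite -gg gs.
Qed.

Lemma pder_cst v : pder (fun=> v) (fun _ _ => 0).
Proof.
exists [:: (fun=> 0%N, v)] => [b|j b].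
  rewrite /meval big_seq1 /mono big1 ?scale1r // => i _.
by rewrite /meval /mderiv /= big_seq1 /= mulr0n scaler0.
Qed.

Lemma pderD f g f' g' : pder f g -> pder f' g' ->
  pder (fun b => f b + f' b) (fun j b => g j b + g' j b).
Proof.
move=> [s fs gs] [s' fs' gs']; exists (s ++ s') => [b|j b].
  by rewrite meval_cat fs fs'.
by rewrite /mderiv map_cat meval_cat gs gs'.
Qed.

Lemma pder_sum (I : Type) (r : seq I) (F : I -> ('I_n -> R) -> V) G :
  (forall i, pder (F i) (G i)) ->
  pder (fun b => \sum_(i <- r) F i b) (fun j b => \sum_(i <- r) G i j b).
Proof.
move=> FG; elim: r => [|i r IH].
  apply: pder_ext (pder_cst 0) => [b|j b]; by rewrite big_nil.
apply: pder_ext (pderD (FG i) IH) => [b|j b]; by rewrite big_cons.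
Qed.

Lemma pder_linear_form (v : 'I_n -> V) :
  pder (fun b => \sum_i b i *: v i) (fun j _ => v j).
Proof.
exists [seq ((fun k => (k == i) : nat), v i) | i <- index_enum 'I_n] => [b|j b].
  rewrite /meval big_map; apply: eq_bigr => i _ /=; congr (_ *: _).
  rewrite /mono (bigD1 i) //= eqxx expr1 big1 ?mulr1 // => k /negPf ->.
  by rewrite expr0.
rewrite /meval /mderiv -map_comp big_map (bigD1 j) //= eqxx mulr1n.
rewrite big1 ?addr0 => [|i /negPf ij]; last by rewrite eq_sym ij mulr0n scaler0.
by rewrite /mono big1 ?scale1r // => k _; rewrite /lower subnn.
Qed.

End Values.

(** Carries formal derivatives through commutators, traces and evaluation at a point. *)
Lemma pder_linear (V W : lmodType R) (T : V -> W) f g :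
  (forall c x y, T (c *: x + y) = c *: T x + T y) ->
  pder f g -> pder (fun b => T (f b)) (fun j b => T (g j b)).
Proof.
move=> TL [s fs gs].
have T0 : T 0 = 0.
  by have := TL (-1) 0 0; rewrite !scaleN1r addNr addNr.
have TD x y : T (x + y) = T x + T y by rewrite -{1}[x]scale1r TL scale1r.
have TZ c x : T (c *: x) = c *: T x by rewrite -[c *: x]addr0 TL T0 addr0.
have TS r b : T (meval r b) = meval [seq (l.1, T l.2) | l <- r] b.
  rewrite /meval; elim: r => [|l r IH]; first by rewrite !big_nil.
  by rewrite /= !big_cons TD IH TZ.
exists [seq (l.1, T l.2) | l <- s] => [b|j b]; first by rewrite fs TS.
rewrite gs TS /mderiv -!map_comp; congr meval; apply: eq_map => l /=.
by congr pair; rewrite -[in LHS]scaler_nat TZ scaler_nat.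
Qed.

Lemma pderM (W : algType R) (f f' : ('I_n -> R) -> W) g g' :
  pder f g -> pder f' g' ->
  pder (fun b => f b * f' b) (fun j b => g j b * f' b + f b * g' j b).
Proof.
move=> [s fs gs] [s' fs' gs'].
exists [seq ((fun i => l.1 i + l'.1 i)%N, l.2 * l'.2) | l <- s, l' <- s'] => [b|j b].
  rewrite /meval big_allpairs_dep fs fs' mulr_suml; apply: eq_bigr => l _.
  rewrite mulr_sumr; apply: eq_bigr => l' _ /=.
  by rewrite monoD -scalerAl -scalerAr scalerA.
rewrite /meval /mderiv big_map big_allpairs_dep fs fs' gs gs' /meval /mderiv !big_map.
rewrite !mulr_suml -big_split /=; apply: eq_bigr => l _.
rewrite !mulr_sumr -big_split /=; apply: eq_bigr => l' _ /=.
rewrite -!scalerAl -!scalerAr !scalerA mulrnDr scalerDr.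
congr (_ + _).
  (* For exponent 0 the truncated subtractions on the two sides may differ, but the coefficient
     vanishes. *)
  have [->|l0] := posnP (l.1 j); first by rewrite !mulr0n mul0r !scaler0.
  rewrite -monoD mulrnAl; congr (mono _ _ *: _); apply/funext => i; rewrite /lower.
  by case: eqP => [->|_] /=; lia.
have [->|l0] := posnP (l'.1 j); first by rewrite !mulr0n mulr0 !scaler0.
rewrite -monoD mulrnAr; congr (mono _ _ *: _); apply/funext => i; rewrite /lower.
by case: eqP => [->|_] /=; lia.
Qed.

Lemma pder_prod (W : algType R) p (F : nat -> ('I_n -> R) -> W) G :
  (forall l, pder (F l) (G l)) ->
  pder (fun b => \prod_(l < p) F l b)
       (fun j b => \sum_(m < p) slot m (G m j b) (fun l => F l b)).
Proof.
move=> FG; elim: p => [|p IH].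
  by apply: pder_ext (pder_cst 1) => [b|j b]; rewrite big_ord0.
apply: pder_ext (pderM IH (FG p)) => [b|j b]; first by rewrite big_ord_recr.
rewrite [RHS]big_ord_recr /= mulr_suml; congr (_ + _); last first.
  rewrite /slot big_ord_recr /= eqxx; congr (_ * _); apply: eq_bigr => l _.
  by rewrite -val_eqE /= ltn_eqF.
apply: eq_bigr => m _; rewrite /slot big_ord_recr /= ifF //.
by rewrite -val_eqE /= gtn_eqF.
Qed.

End MonomialSums.

(** * Integrals of monomials over simplices *)

Section DirichletIntegrals.
Variable R : realType.
Local Notation mu := (@lebesgue_measure R).

Lemma Rintegral_poly (F : {poly R}) (c : R) :
  \int[mu]_s (if 0 <= s <= c then F^`().[s] else 0) =
  if 0 <= c then F.[c] - F.[0] else 0.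
Proof.
have -> : \int[mu]_s (if 0 <= s <= c then F^`().[s] else 0) =
          \int[mu]_(s in `[0, c]) F^`().[s].
  rewrite [RHS]Rintegral_mkcond; congr Rintegral; apply/funext => s; rewrite patchE.
  by rewrite mem_setE in_itv.
case: ltgtP => [c0|c0|<-].
- rewrite /Rintegral (@continuous_FTC2 _ (horner F^`()) (horner F)) //.
  + by apply: continuous_subspaceT => s; exact: continuous_horner.
  + split => [s _| |].
    * exact: derivable_horner.
    * exact/cvg_at_right_filter/continuous_horner.
    * exact/cvg_at_left_filter/continuous_horner.
  + by move=> s _; rewrite derivE.
- by rewrite set_itv_ge ?bnd_simp -?ltNge // /Rintegral integral_set0.
- by rewrite set_itv1 /Rintegral integral_set1 subrr.
Qed.

(** The Beta integral; integration by parts trades a factor x for a factor c - x. *)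
Lemma beta_primitive (a b : nat) (c : R) : exists F : {poly R},
  F^`() = 'X^a * (c%:P - 'X) ^+ b /\
  F.[c] - F.[0] = c ^+ (a + b).+1 * (a`! * b`!)%:R / ((a + b).+1)`!%:R.
Proof.
have dY k : ((c%:P - 'X) ^+ k.+1)^`() = - ((c%:P - 'X) ^+ k *+ k.+1).
  by rewrite deriv_exp derivB derivC derivX sub0r mulN1r mulNrn.
elim: a b => [|a IH] b.
  exists (- (b.+1%:R^-1 *: (c%:P - 'X) ^+ b.+1)); split.
    rewrite derivN derivZ dY scalerN opprK -scalerMnr scalerMnl -mulr_natr mulVf ?scale1r ?mul1r ?pnatr_eq0 //.
  have E x : (- (b.+1%:R^-1 *: (c%:P - 'X) ^+ b.+1)).[x] = - (b.+1%:R^-1 * (c - x) ^+ b.+1).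
    by rewrite !hornerE.
  rewrite !E subrr subr0 expr0n /= mulr0 oppr0 sub0r opprK fact0 mul1n add0n factS natrM.
  have : b`!%:R != 0 :> R by rewrite pnatr_eq0 -lt0n fact_gt0.
  have : b.+1%:R != 0 :> R by rewrite pnatr_eq0.
  by move: b.+1%:R b`!%:R => x y x0 y0; field; rewrite x0 y0.
have [F [dF vF]] := IH b.+1.
(* The boundary term of the integration by parts, plus the primitive of the remaining integrand. *)
exists (- (b.+1%:R^-1 *: ('X^(a.+1) * (c%:P - 'X) ^+ b.+1)) + (a.+1%:R / b.+1%:R) *: F).
split.
  rewrite derivD derivN !derivZ dF derivM dY derivXn /= -!mul_polyC.
  set i := (b.+1%:R^-1)%:P; have iK : i * b.+1%:R = 1.
    by rewrite /i -polyC_natr -polyCM mulVf // pnatr_eq0.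
  rewrite polyCM -/i polyC_natr.
  transitivity ((i * b.+1%:R) * ('X^(a.+1) * (c%:P - 'X) ^+ b)); last by rewrite iK mul1r.
  by rewrite exprS; ring.
have E x : (- (b.+1%:R^-1 *: ('X^(a.+1) * (c%:P - 'X) ^+ b.+1)) + (a.+1%:R / b.+1%:R) *: F).[x] =
    - (b.+1%:R^-1 * (x ^+ a.+1 * (c - x) ^+ b.+1)) + (a.+1%:R / b.+1%:R) * F.[x].
  by rewrite !(hornerD, hornerZ, hornerM, hornerXn, horner_exp, hornerN, hornerC, hornerX).
rewrite !E subrr !expr0n /= mul0r !mulr0 oppr0 !add0r -mulrBr vF addnS addSn !factS.
have f0 (k : nat) : k`!%:R != 0 :> R by rewrite pnatr_eq0 -lt0n fact_gt0.
rewrite !natrM !invfM; field.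
by rewrite f0 !gt_eqF // ltr_pwDl ?addr_ge0 ?ler0n.
Qed.

Definition dirichlet k (al : 'I_k.+1 -> nat) : R :=
  (\prod_i (al i)`!)%:R / (k + \sum_i al i)`!%:R.

(** The size [c] is a parameter because slicing a simplex at its first coordinate s leaves one of
    size c - s. Index 0 is the dependent coordinate. *)
Definition barycentric (c : R) k (t : 'rV[R]_k) (j : 'I_k.+1) : R :=
  if unlift ord0 j is Some i then t 0 i else c - \sum_i t 0 i.

Lemma barycentric0 c k (t : 'rV[R]_k) : barycentric c t ord0 = c - \sum_i t 0 i.
Proof. by rewrite /barycentric unlift_none. Qed.

Lemma barycentric_lift c k (t : 'rV[R]_k) i : barycentric c t (lift ord0 i) = t 0 i.
Proof. by rewrite /barycentric liftK. Qed.

Lemma lift1_lift0 k (i : 'I_k) :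
  lift (lift ord0 ord0) (lift ord0 i) = lift ord0 (lift ord0 i) :> 'I_k.+2.
Proof. by apply: val_inj. Qed.

Lemma lift1_0 k : lift (lift ord0 ord0) ord0 = ord0 :> 'I_k.+2.
Proof. by apply: val_inj. Qed.

Lemma row_mx0 k (s : R) (t : 'rV[R]_k) :
  (row_mx (s%:M : 'rV_1) t : 'rV_k.+1) 0 ord0 = s.
Proof.
transitivity (row_mx (s%:M : 'rV_1) t 0 (lshift k ord0)).
  by congr (row_mx _ _ 0 _); apply: val_inj.
by rewrite row_mxEl mxE.
Qed.

Lemma row_mxS k (s : R) (t : 'rV[R]_k) i :
  (row_mx (s%:M : 'rV_1) t : 'rV_k.+1) 0 (lift ord0 i) = t 0 i.
Proof.
transitivity (row_mx (s%:M : 'rV_1) t 0 (rshift 1 i)); last by rewrite row_mxEr.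
by congr (row_mx _ _ 0 _); apply: val_inj.
Qed.

Lemma barycentric_row c k s (t : 'rV[R]_k) j :
  barycentric c (row_mx (s%:M : 'rV_1) t : 'rV_k.+1) (lift (lift ord0 ord0) j) =
  barycentric (c - s) t j.
Proof.
case: (unliftP ord0 j) => [i|] ->.
  by rewrite lift1_lift0 !barycentric_lift row_mxS.
rewrite lift1_0 !barycentric0 big_ord_recl row_mx0 opprD addrA; congr (_ - _).
by apply: eq_bigr => i _; rewrite row_mxS.
Qed.

(** The inductive step of Dirichlet's formula: the integral over the slice at [x] is a power of c -
    x, so that a Beta integral in [x] remains. The sliced coordinate has index 1, written
    [lift ord0 ord0]. *)
Lemma dirichlet_primitive k (s : seq (('I_k.+2 -> nat) * R)) c : exists F : {poly R},
  (forall x, F^`().[x] = \sum_(l <- s) (c - x) ^+ (k + \sum_i l.1 (lift (lift ord0 ord0) i))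
     * dirichlet (l.1 \o lift (lift ord0 ord0)) * (x ^+ l.1 (lift ord0 ord0) * l.2)) /\
  F.[c] - F.[0] = \sum_(l <- s) c ^+ (k.+1 + \sum_i l.1 i) * dirichlet l.1 * l.2.
Proof.
elim: s => [|[al v] s [F [dF vF]]] /=.
  by exists 0; split => [x|]; rewrite !big_nil ?deriv0 !horner0 ?subrr.
set a := al (lift ord0 ord0); set b := (k + \sum_i al (lift (lift ord0 ord0) i))%N.
have [H [dH vH]] := beta_primitive a b c.
set d := dirichlet (al \o lift (lift ord0 ord0)).
exists ((d * v) *: H + F); split=> [x|].
  rewrite big_cons [(al, v).1]/= [(al, v).2]/= -/a -/b -/d -dF derivD derivZ dH.
  rewrite !(hornerD, hornerZ, hornerM, hornerXn, horner_exp, hornerN, hornerC, hornerX).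
  by ring.
rewrite big_cons -vF !(hornerD, hornerZ) /= opprD addrACA -mulrBr vH; congr (_ + _).
have f0 (m : nat) : m`!%:R != 0 :> R by rewrite pnatr_eq0 -lt0n fact_gt0.
have -> : (k.+1 + \sum_i al i = (a + b).+1)%N.
  by rewrite (bigD1_ord (lift ord0 ord0)) //= addSn addnCA.
rewrite /d /dirichlet.
have -> : (k.+1 + \sum_i al i = (a + b).+1)%N.
  by rewrite (bigD1_ord (lift ord0 ord0)) //= addSn addnCA.
rewrite [in RHS](bigD1_ord (lift ord0 ord0)) // -/a -/b /comp.
move: ((a + b).+1)`!%:R (f0 (a + b).+1) => x x0; rewrite !natrM.
move: b`!%:R (f0 b) => y y0.
by field; rewrite x0 y0.
Qed.

(** The integral is iterated by definition, so that induction on [k] works slice by slice; c < 0 is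
    included because the slices beyond x = c are empty. *)
Lemma integral_rV_simplex k (s : seq (('I_k.+1 -> nat) * R^o)) (c : R) :
  integral_rV (fun t : 'rV[R]_k =>
    if (\big[andb/true]_i (0 <= t 0 i)) && (\sum_i t 0 i <= c)
    then meval s (barycentric c t) else 0) =
  if 0 <= c then \sum_(l <- s) c ^+ (k + \sum_i l.1 i) * dirichlet l.1 * l.2 else 0.
Proof.
elim: k s c => [|k IH] s c /=.
  rewrite !big_ord0 /=; case: ifP => // c0; rewrite /meval; apply: eq_bigr => l _.
  rewrite /mono /dirichlet !big_ord1 barycentric0 big_ord0 subr0 add0n.
  by rewrite divff ?mulr1 // pnatr_eq0 -lt0n fact_gt0.
have [F [dF vF]] := dirichlet_primitive s c; rewrite -vF -Rintegral_poly.
congr Rintegral; apply/funext => x.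
(* For x < 0 the integrand is 0, which is integrated as the empty sum of monomials. *)
have [x0|x0] := boolP (0 <= x); last first.
  rewrite /=; transitivity (integral_rV (fun t : 'rV[R]_k =>
    if (\big[andb/true]_i (0 <= t 0 i)) && (\sum_i t 0 i <= c)
    then meval ([::] : seq (('I_k.+1 -> nat) * R^o)) (barycentric c t) else 0)).
    congr integral_rV; apply/funext => t; rewrite big_ord_recl row_mx0 (negPf x0) /=.
    by rewrite /meval big_nil; case: ifP.
  by rewrite IH big_nil; case: ifP.
(* The polynomial on the slice, where the coordinate of index 1 is the constant x. *)
pose s' := [seq (l.1 \o lift (lift ord0 ord0), x ^+ l.1 (lift ord0 ord0) * l.2) | l <- s].
rewrite /= dF -subr_ge0; transitivity (integral_rV (fun t : 'rV[R]_k =>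
    if (\big[andb/true]_i (0 <= t 0 i)) && (\sum_i t 0 i <= c - x)
    then meval (s' : seq (('I_k.+1 -> nat) * R^o)) (barycentric (c - x) t) else 0)).
  congr integral_rV; apply/funext => t; rewrite !big_ord_recl row_mx0 x0 /=.
  under eq_bigr do rewrite row_mxS.
  under [X in _ + X]eq_bigr do rewrite row_mxS.
  rewrite lerBrDl; case: ifP => // _; rewrite /meval /s' big_map; apply: eq_bigr => l _ /=.
  rewrite /mono (bigD1_ord (lift ord0 ord0)) //= barycentric_lift row_mx0.
  under eq_bigr do rewrite barycentric_row.
  by rewrite /GRing.scale /=; ring.
by rewrite IH /s' big_map.
Qed.

Lemma integral_simplex_meval k (s : seq (('I_k.+1 -> nat) * R^o)) :
  integral_simplex (fun t : 'rV[R]_k => meval s (barycentric 1 t)) =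
  \sum_(l <- s) dirichlet l.1 * l.2.
Proof.
have := integral_rV_simplex s 1; rewrite ler01.
under [X in _ = X -> _]eq_bigr do rewrite expr1n mul1r.
move=> <-; congr integral_rV; apply/funext => t.
rewrite indicE /simplex; case: ifP => [/andP[t0 t1]|tN].
  rewrite mem_set ?mul1r //=; split=> // i.
  by move: t0; rewrite big_andE => /forallP/(_ i).
rewrite memNset ?mul0r // => -[t0 t1]; move/negP: tN; apply.
by rewrite t1 andbT big_andE; apply/forallP.
Qed.

(* The inclusion of the face [b_j = 0] in barycentric coordinates. *)
Definition face n (j : 'I_n.+1) (b : 'I_n -> R) (i : 'I_n.+1) : R :=
  if unlift j i is Some i' then b i' else 0.

Lemma meval_face n (s : seq (('I_n.+1 -> nat) * R^o)) j b :
  meval s (face j b) =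
  meval [seq (l.1 \o lift j, if l.1 j == 0%N then l.2 else 0) | l <- s] b.
Proof.
rewrite /meval big_map; apply: eq_bigr => l _ /=.
rewrite /mono (bigD1_ord j) //= /face unlift_none expr0n.
under eq_bigr do rewrite liftK.
by case: eqP => _; rewrite ?mul1r // mul0r scale0r scaler0.
Qed.

(** The difference of two partial derivatives is tangent to the simplex; the terms are arranged so
    that each index stays on its side. On a monomial one term per side survives: the face term if
    the exponent is 0, otherwise the derivative, both with the same value. *)
Lemma stokes_simplex k (f : ('I_k.+2 -> R) -> R^o) g i j : pder f g ->
  integral_simplex (fun t : 'rV[R]_k.+1 => g i (barycentric 1 t)) +
  integral_simplex (fun t : 'rV[R]_k => f (face i (barycentric 1 t))) =
  integral_simplex (fun t : 'rV[R]_k.+1 => g j (barycentric 1 t)) +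
  integral_simplex (fun t : 'rV[R]_k => f (face j (barycentric 1 t))).
Proof.
move=> [s fs gs].
suff K i' : integral_simplex (fun t : 'rV[R]_k.+1 => g i' (barycentric 1 t)) +
  integral_simplex (fun t : 'rV[R]_k => f (face i' (barycentric 1 t))) =
  \sum_(l <- s) (\prod_i (l.1 i)`!)%:R / (k + \sum_i l.1 i)`!%:R * l.2 by rewrite !K.
have -> : (fun t : 'rV[R]_k.+1 => g i' (barycentric 1 t)) =
    (fun t => meval (mderiv i' s) (barycentric 1 t)) by apply/funext => t; rewrite gs.
have -> : (fun t : 'rV[R]_k => f (face i' (barycentric 1 t))) =
    (fun t => meval [seq (l.1 \o lift i', if l.1 i' == 0%N then l.2 else 0) | l <- s]
      (barycentric 1 t)) by apply/funext => t; rewrite fs meval_face.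
rewrite !integral_simplex_meval !big_map -big_split /=; apply: eq_bigr => -[al v] _ /=.
rewrite /dirichlet; have [a0|a0] := eqVneq (al i') 0%N.
  rewrite a0 mulr0n mulr0 add0r.
  by rewrite [in RHS](bigD1_ord i') //= [in RHS](bigD1_ord i') //= a0 mul1n add0n.
rewrite mulr0 addr0 -[v *+ _]mulr_natl mulrA; congr (_ * _).
have -> : (k.+1 + \sum_i lower i' al i = k + \sum_i al i)%N.
  rewrite (bigD1_ord i') // [in RHS](bigD1_ord i') //= /lower eqxx.
  under eq_bigr do rewrite eq_sym (negPf (neq_lift _ _)) subn0.
  by lia.
rewrite mulrAC -natrM; congr (_%:R / _).
rewrite [LHS]mulnC (bigD1_ord i') // [in RHS](bigD1_ord i') //= /lower eqxx.
under eq_bigr do rewrite eq_sym (negPf (neq_lift _ _)) subn0.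
by rewrite mulnA; congr (_ * _)%N; case: (al i') a0 => // m _; rewrite subn1 -factS.
Qed.

End DirichletIntegrals.

(** * Bump functions and frames *)

Local Open Scope classical_set_scope.
Local Open Scope ring_scope.

Section FlatFunctions.
Variable R : realType.
Implicit Types (P : {poly R}) (t : R).

(** The family of these functions is stable under differentiation by [is_derive_flat], so that their
    smoothness follows by induction. *)
Definition flat P t : R := if 0 < t then P.[t^-1] * expR (- t^-1) else 0.

Lemma flat_bound_aux P k : exists2 C, 0 <= C &
  forall s, 0 < s -> s ^+ k.+1 * `|P.[s]| * expR (- s) <= C.
Proof.
elim/poly_ind: P k => [|P c IH] k.
  by exists 0 => // s _; rewrite horner0 normr0 mulr0 mul0r.
have [C C0 HC] := IH k.+1.
exists (C + `|c| * k.+1`!%:R) => [|s s0].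
  by rewrite addr_ge0 // mulr_ge0.
have es := expR_gt0 (- s).
(* The exponential series bounds e^s below by s^(k+1)/(k+1)!. *)
have sk : s ^+ k.+1 * expR (- s) <= k.+1`!%:R.
  rewrite expRN ler_pdivrMr ?expR_gt0 // mulrC -ler_pdivrMr ?ltr0n ?fact_gt0 //.
  by apply: le_trans (expR_ge1Dxn k (ltW s0)); rewrite lerDr ler01.
rewrite !hornerE.
apply: (@le_trans _ _ (s ^+ k.+2 * `|P.[s]| * expR (- s) + `|c| * (s ^+ k.+1 * expR (- s)))).
  have -> : s ^+ k.+2 * `|P.[s]| * expR (- s) + `|c| * (s ^+ k.+1 * expR (- s)) =
     s ^+ k.+1 * (`|P.[s]| * s + `|c|) * expR (- s) by rewrite (exprS s k.+1); ring.
  rewrite ler_pM2r // ler_pM2l ?exprn_gt0 //.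
  by apply: le_trans (ler_normD _ _) _; rewrite normrM (gtr0_norm s0).
by apply: lerD; [exact: HC|rewrite ler_wpM2l].
Qed.

Lemma flat_bound P : exists2 C, 0 <= C & forall t, `|flat P t| <= C * t ^+ 2.
Proof.
have [C C0 HC] := flat_bound_aux P 1; exists C => // t.
rewrite /flat; case: ifP => [t0|_]; last by rewrite normr0 mulr_ge0 // sqr_ge0.
have := HC _ (etrans (invr_gt0 t) t0).
rewrite normrM (gtr0_norm (expR_gt0 _)) -mulrA exprVn mulrC.
by rewrite ler_pdivrMr // exprn_gt0.
Qed.

Lemma is_derive_flat P t : is_derive t 1 (flat P) (flat ('X^2 * (P - P^`())) t).
Proof.
have [t0|t0|->] := ltgtP t 0.
- rewrite {2}/flat ifF; last by apply/negbTE; rewrite -leNgt ltW.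
  apply: (near_eq_is_derive (f := cst 0)).
  near=> x; rewrite /flat ifF //; apply/negbTE; rewrite -leNgt ltW //.
  by near: x; exact: lt_nbhsl.
- rewrite {2}/flat t0.
  pose g (x : R) : R := P.[x^-1] * expR (- x^-1).
  apply: (near_eq_is_derive (f := g)).
    by near=> x; rewrite /g /flat ifT //; near: x; exact: lt_nbhsr.
  have t1 : t != 0 by rewrite gt_eqF.
  have dV := is_deriveV t1 (is_derive_id t 1).
  have dP := is_derive1_comp (is_derive_poly P t^-1) dV.
  have dE := @is_derive1_comp R expR (fun x => - x^-1) t _ _ (is_derive_expR _) (is_deriveN dV).
  apply: is_derive_eq (is_deriveM dP dE) _.
  rewrite !(hornerD, hornerM, hornerN, hornerX) /GRing.scale /=.
  by field.
- rewrite {2}/flat ltxx.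
  (* The quadratic bound makes the difference quotient at 0 at most C|h|. *)
  have [C C0 HC] := flat_bound P.
  have L : (fun h => h^-1 *: ((flat P \o shift 0) (h *: 1) - flat P 0)) @ 0^' --> (0 : R).
    apply/cvgrPdist_le => e e0; near=> h.
    have h0 : h != 0 by near: h; exact: nbhs_dnbhs_neq.
    rewrite /= addr0 [h *: 1]mulr1 {2}/flat ltxx subr0 sub0r normrN.
    rewrite /GRing.scale /= normrM normfV mulrC ler_pdivrMr ?normr_gt0 //.
    apply: le_trans (HC h) _; rewrite -real_normK ?num_real // expr2 mulrA.
    rewrite ler_wpM2r //; have he : `|h| <= e / (C + 1).
      by near: h; apply: dnbhs0_le; rewrite divr_gt0 // ltr_wpDl.
    apply: (@le_trans _ _ ((C + 1) * `|h|)); first by rewrite ler_wpM2r // lerDl.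
    by rewrite mulrC -ler_pdivlMr // ltr_wpDl.
  by apply: DeriveDef; [apply/cvg_ex; exists 0|exact: cvg_lim].
Unshelve. all: by end_near. Qed.

Lemma continuous_flat P : continuous (flat P).
Proof.
move=> t; apply/differentiable_continuous/derivable1_diffP.
by have [] := is_derive_flat P t.
Qed.

End FlatFunctions.

Section EuclideanCalculus.
Variables (R : realType) (m : nat).
Implicit Types (V W : set 'rV[R]_m) (g u : 'rV[R]_m -> R).
Local Notation e_ i := (delta_mx 0 i : 'rV[R]_m).

Lemma Cn_on_eq n V g u : open V -> (forall y, V y -> g y = u y) ->
  Cn_on n V g -> Cn_on n V u.
Proof.
move=> oV gu.
have E y : V y -> \forall z \near y, g z = u z.
  by move=> Vy; exact: filterS gu (open_nbhs_nbhs (conj oV Vy)).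
have cu : (forall y, V y -> {for y, continuous g}) -> forall y, V y -> {for y, continuous u}.
  move=> cg y Vy; have := cg y Vy; rewrite /prop_for /continuous_at -gu //.
  have Eq : {near nbhs y, g =1 u} := E y Vy.
  by move=> c; exact: cvg_trans (near_eq_cvg Eq) c.
case: n => [|n] [/cu cu' dg]; split=> //.
move=> i; have [g' [Hg Hg']] := dg i; exists g'; split=> // y Vy.
exact: near_eq_is_derive (E y Vy) (Hg y Vy).
Qed.

Lemma Cn_onS_derive n V g i : open V -> Cn_on n.+1 V g ->
  (forall y, V y -> derivable g y (e_ i)) /\ Cn_on n V (fun y => 'D_(e_ i) g y).
Proof.
move=> oV [_ /(_ i) [g' [Hg Hg']]]; split; first by move=> y /Hg [].
by apply: Cn_on_eq oV _ Hg' => y /Hg [].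
Qed.

(** The derivatives in [Cn_on] are existential; the directional derivative is a choice common to all
    neighbourhoods, which allows gluing. *)
Lemma Cn_on_local n V g :
  (forall y, V y -> exists W, [/\ open W, W y & Cn_on n W g]) -> Cn_on n V g.
Proof.
elim: n g => [|n IH] g Vg.
  by split=> // y /Vg [W [_ Wy [cg _]]]; exact: cg.
split; first by move=> y /Vg [W [_ Wy [cg _]]]; exact: cg.
move=> i; exists (fun y => 'D_(e_ i) g y); split.
  by move=> y /Vg [W [oW Wy /(Cn_onS_derive i oW) [dg _]]]; apply/derivableP/dg.
by apply: IH => y /Vg [W [oW Wy /(Cn_onS_derive i oW) [_ ?]]]; exists W.
Qed.

(** Restriction to the line through [y] along [e_ i] reduces this to the chain rule in one
    variable. *)
Lemma is_derive_comp1 (F : R -> R) dF u y i du :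
  is_derive (u y) 1 F dF -> is_derive y (e_ i) u du ->
  is_derive y (e_ i) (fun x => F (u x)) (dF * du).
Proof.
have line (f : 'rV[R]_m -> R) d :
    is_derive y (e_ i) f d <-> is_derive (0 : R) 1 (fun h => f (h *: e_ i + y)) d.
  have E : 'D_(e_ i) f y = 'D_1 (fun h : R => f (h *: e_ i + y)) 0.
    rewrite /derive; set g1 := fun h => h^-1 *: _; set g2 := fun h => h^-1 *: _.
    suff -> : g1 = g2 by []; apply/funext => h; rewrite /g1 /g2 /=.
    by rewrite addr0 scale0r add0r [h *: 1]mulr1.
  split=> -[ex <-]; apply: DeriveDef; rewrite ?E //.
    by move/derivable1P: ex.
  exact: (derivable1P _ _ _).2 ex.
move=> HF /line Hu; apply/line.
rewrite -[u y](_ : u (0 *: e_ i + y) = _) in HF; last by rewrite scale0r add0r.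
exact: is_derive1_comp HF Hu.
Qed.

Lemma Cn_on_flat n V P u : Cn_on n V u -> Cn_on n V (fun y => flat P (u y)).
Proof.
elim: n P u => [|n IH] P u Cu; have [cu du] := Cu; split=> //;
  try by move=> y Vy; apply: (continuous_comp (cu y Vy)); exact: continuous_flat.
move=> i; have [u' [Hu Hu']] := du i.
exists (fun y => flat ('X^2 * (P - P^`())) (u y) * u' y); split.
  by move=> y /Hu; apply: is_derive_comp1; exact: is_derive_flat.
by apply: Cn_onM => //; apply: IH; exact: Cn_onS.
Qed.

Lemma Cn_onV n V u : (forall y, V y -> u y != 0) -> Cn_on n V u ->
  Cn_on n V (fun y => (u y)^-1).
Proof.
elim: n u => [|n IH] u u0 Cu; have [cu du] := Cu; split=> //;
  try by move=> y Vy; apply: continuousV; [exact: u0|exact: cu].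
move=> i; have [u' [Hu Hu']] := du i.
exists (fun y => (- 1 * ((u y)^-1 * (u y)^-1)) * u' y); split.
  move=> y Vy; have uy := u0 y Vy.
  have dV := is_deriveV uy (is_derive_id (u y) 1).
  apply: is_derive_comp1 (Hu y Vy); apply: is_derive_eq dV _.
  by rewrite [_%:A]mulr1 mulN1r -invfM -expr2.
apply: Cn_onM => //; apply: Cn_onM; first exact: Cn_on_cst.
by apply: Cn_onM; apply: IH => //; exact: Cn_onS.
Qed.

Lemma Cn_on_sum n V (I : Type) (r : seq I) (F : I -> 'rV[R]_m -> R) :
  (forall i, Cn_on n V (F i)) -> Cn_on n V (fun y => \sum_(i <- r) F i y).
Proof.
move=> CF; elim: r => [|i r IH].
  rewrite (_ : (fun _ => _) = fun=> 0); first exact: Cn_on_cst.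
  by apply/funext => y; rewrite big_nil.
rewrite (_ : (fun _ => _) = fun y => F i y + \sum_(i <- r) F i y).
  exact: Cn_onD.
by apply/funext => y; rewrite big_cons.
Qed.

End EuclideanCalculus.

Section SmoothLocal.
Variables (R : realType) (M : manifold R).
Implicit Types (U W K : set M) (g h : M -> R) (c : chart R M (mdim M)).

Lemma open_chart_image c W : open W -> open (chart_map c @` (W `&` chart_dom c)).
Proof.
move=> oW; rewrite openE => y [x [Wx cx] <-]; rewrite /interior.
have im : (chart_map c @` chart_dom c) (chart_map c x) by exists x.
have n1 := open_nbhs_nbhs (conj (@chart_open_im _ _ _ c) im).
have n2 : nbhs (chart_map c x) (chart_inv c @^-1` W).
  apply: (chart_inv_cont im); rewrite chart_mapK //.
  exact: open_nbhs_nbhs (conj oW Wx).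
apply: filterS (filterI n1 n2) => y' [[x' cx' <-] /=].
by rewrite chart_mapK // => Wx'; exists x'.
Qed.

Lemma smooth_on_eq U g h : open U -> (forall x, U x -> g x = h x) ->
  smooth_on U g -> smooth_on U h.
Proof.
move=> oU gh sg c ac n; apply: Cn_on_eq (sg c ac n); first exact: open_chart_image.
by move=> y [x [Ux cx] <-] /=; rewrite chart_mapK // gh.
Qed.

Lemma smooth_on_local U h :
  (forall x, U x -> exists W, [/\ open W, W x & smooth_on W h]) -> smooth_on U h.
Proof.
move=> loc c ac n; apply: Cn_on_local => y [x [Ux cx] <-].
have [W [oW Wx sW]] := loc x Ux.
exists (chart_map c @` (W `&` chart_dom c)); split.
- exact: open_chart_image.
- by exists x.
- exact: sW.
Qed.

Lemma smooth_on_sum U (I : Type) (r : seq I) (F : I -> M -> R) :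
  (forall i, smooth_on U (F i)) -> smooth_on U (fun x => \sum_(i <- r) F i x).
Proof.
move=> sF c ac n; have := @Cn_on_sum _ _ n _ _ r (fun i => F i \o chart_inv c).
by apply => i; exact: sF.
Qed.

Lemma smooth_onV U h : (forall x, U x -> h x != 0) -> smooth_on U h ->
  smooth_on U (fun x => (h x)^-1).
Proof.
move=> h0 sh c ac n; apply: Cn_onV (sh c ac n) => y [x [Ux cx] <-] /=.
by rewrite chart_mapK // h0.
Qed.

Lemma smooth_on_flat U P h : smooth_on U h -> smooth_on U (fun x => flat P (h x)).
Proof. by move=> sh c ac n; apply: Cn_on_flat; exact: sh. Qed.

Lemma smooth_chart_coord c i : atlas c -> smooth_on (chart_dom c) (fun x => chart_map c x 0 i).
Proof.
by move=> ac d ad n; rewrite setIC; exact: (atlas_compat ad ac i n).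
Qed.

(** In a chart at [x] the function is e^(-1/u) where u = r^2 - |y - y0|^2 is positive, normalised at
    [x]; it extends smoothly by 0 because the chart domain and the complement of [K] cover the
    manifold. *)
Lemma bump_function U (x : M) : open U -> U x ->
  exists (chi : smoothfun M) (K : set M),
    [/\ chi x = 1, closed K, K `<=` U & forall y, ~ K y -> chi y = 0].
Proof.
move=> oU Ux; have [c ac cx] := atlas_cover x; set y0 := chart_map c x.
have imy0 : (chart_map c @` (U `&` chart_dom c)) y0 by exists x.
have /nbhs_ballP[e /= e0 be] := open_nbhs_nbhs (conj (open_chart_image oU) imy0).
(* Half the radius keeps the closed box inside the ball, which is a cube for row vectors. *)
pose r := e / 2; have r0 : 0 < r by rewrite divr_gt0.
pose box := [set v : 'rV[R]_(mdim M) | forall i, `[y0 0 i - r, y0 0 i + r]%classic (v 0 i)].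
have box_im v : box v -> (chart_map c @` (U `&` chart_dom c)) v.
  move=> bv; apply: be; split=> // i j; rewrite ord1 /ball /= ltr_distlC.
  have := bv j; rewrite /= in_itv /= => /andP[b1 b2].
  have re : r < e by rewrite /r ltr_pdivrMr // mulr_natr mulr2n ltrDl.
  by apply/andP; split; lra.
pose K := chart_inv c @` box.
have K_U : K `<=` U.
  by move=> _ [v /box_im [z [Uz cz] <-] <-]; rewrite chart_mapK.
have cK : closed K.
  apply: compact_closed (@man_hausdorff _ M) _; apply: continuous_compact.
    apply: continuous_in_subspaceT => v /set_mem /box_im [z [Uz cz] <-].
    by apply: chart_inv_cont; exists z.
  apply: (@rV_compact R _ (fun i => `[y0 0 i - r, y0 0 i + r]%classic)) => i.
  exact: segment_compact.
pose u (z : M) := r ^+ 2 - \sum_i (chart_map c z 0 i - y0 0 i) ^+ 2.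
have su : smooth_on (chart_dom c) u.
  apply: smooth_onD; first exact: smooth_on_cst.
  apply: smooth_onN; apply: smooth_on_sum => i.
  have s1 := smooth_onD (smooth_chart_coord i ac) (smooth_on_cst (chart_dom c) (- y0 0 i)).
  by apply: smooth_onM.
pose h (z : M) := if pselect (chart_dom c z) then flat 1 (u z) else 0.
have hK z : ~ K z -> h z = 0.
  move=> nK; rewrite /h; case: pselect => // cz; rewrite /flat; case: ifP => // u0.
  case: nK; exists (chart_map c z); last by rewrite chart_mapK.
  move=> i; rewrite /= in_itv /=.
  have : (chart_map c z 0 i - y0 0 i) ^+ 2 <= r ^+ 2.
    move: u0; rewrite /u subr_gt0 => /ltW; apply: le_trans.
    rewrite (bigD1 i) //= lerDl; apply: sumr_ge0 => j _; exact: sqr_ge0.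
  by move=> d2; apply/andP; split; nra.
have sh : smooth h.
  apply: smooth_on_local => z _; have [cz|ncz] := pselect (chart_dom c z).
    exists (chart_dom c); split => //; first exact: chart_open.
    apply: smooth_on_eq (smooth_on_flat 1 su); first exact: chart_open.
    by move=> w cw; rewrite /h; case: pselect.
  exists (~` K); split.
  - exact: closed_openC.
  - by move=> [v /box_im [w [_ cw] <-] zE]; apply: ncz; rewrite -zE chart_mapK.
  - apply: smooth_on_eq (smooth_on_cst _ 0); first exact: closed_openC.
    by move=> w /hK.
have hx : 0 < h x.
  rewrite /h; case: pselect => [?|//] /=; rewrite /flat /u big1 => [|i _].
    by rewrite subr0 exprn_gt0 // hornerC mul1r expR_gt0.
  by rewrite subrr expr0n.
exists (SmoothFun (smooth_onZ (h x)^-1 sh)), K; split => //=.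
  by rewrite mulVf // gt_eqF.
by move=> y /hK ->; rewrite mulr0.
Qed.

Lemma smooth_cutoff U W K (chi : smoothfun M) h : closed K -> K `<=` U -> open U ->
  (forall x, ~ K x -> chi x = 0) -> open W -> smooth_on (U `&` W) h ->
  smooth_on W (fun x => chi x * h x).
Proof.
move=> cK KU oU chi0 oW sh; apply: smooth_on_local => x Wx.
have [Ux|nUx] := pselect (U x).
  exists (U `&` W); split => //; first exact: openI.
  by apply: smooth_onM => //; apply: smooth_onW; exact: sfunP.
exists (~` K); split; first exact: closed_openC.
  by move=> /KU.
apply: smooth_on_eq (smooth_on_cst _ 0); first exact: closed_openC.
by move=> y /chi0 ->; rewrite mul0r.
Qed.

End SmoothLocal.

Lemma smooth_continuous (R : realType) (M : manifold R) (h : smoothfun M) (x : M) :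
  {for x, continuous h}.
Proof.
have [c ac cx] := atlas_cover x.
have im : (chart_map c @` (setT `&` chart_dom c)) (chart_map c x) by exists x.
have [ch _] := sfunP h ac 0; have {}ch := ch _ im.
have cc := continuous_comp (chart_cont cx) ch.
have Eq : {near nbhs x, (h \o chart_inv c) \o chart_map c =1 h}.
  have := open_nbhs_nbhs (conj (@chart_open _ _ _ c) cx).
  by apply: filterS => z cz /=; rewrite chart_mapK.
rewrite /prop_for /continuous_at.
have -> : h x = ((h \o chart_inv c) \o chart_map c) x by rewrite /= chart_mapK.
by move=> P hP; apply: (near_eq_cvg Eq); exact: cc hP.
Qed.

Section TangentVectors.
Variables (R : realType) (M : manifold R) (x : M) (X : tangent x).
Implicit Types f g : smoothfun M.

Lemma tder0 : X 0 = 0.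
Proof.
have := tder_linear X (-1) 0 0; rewrite scaleN1r oppr0 addr0 mulN1r.
by rewrite addNr.
Qed.

Lemma tderD f g : X (f + g) = X f + X g.
Proof. by have := tder_linear X 1 f g; rewrite scale1r mul1r. Qed.

Lemma tderZ k f : X (k *: f) = k * X f.
Proof. by have := tder_linear X k f 0; rewrite !addr0 tder0 addr0. Qed.

Lemma tderN f : X (- f) = - X f.
Proof. by rewrite -scaleN1r tderZ mulN1r. Qed.

Lemma tder_sum (I : Type) (r : seq I) (F : I -> smoothfun M) :
  X (\sum_(i <- r) F i) = \sum_(i <- r) X (F i).
Proof.
by elim: r => [|i r IH]; rewrite ?big_nil ?tder0 // !big_cons tderD IH.
Qed.

End TangentVectors.

Lemma sfun_sumE (R : realType) (M : manifold R) (I : Type) (r : seq I)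
    (F : I -> smoothfun M) x : (\sum_(i <- r) F i) x = \sum_(i <- r) F i x.
Proof. by elim: r => [|i r IH]; rewrite ?big_nil // !big_cons -IH. Qed.

Lemma sec_sumE (R : realType) (M : manifold R) (E : vbundle M) (I : Type)
    (r : seq I) (F : I -> section E) x :
  (\sum_(i <- r) F i) x = \sum_(i <- r) F i x.
Proof. by elim: r => [|i r IH]; rewrite ?big_nil // !big_cons -IH. Qed.

Section Frames.
Variables (R : realType) (M : manifold R) (E : vbundle M).

(* A local frame and its dual coframe, both multiplied by a bump function, so
   that they are globally defined; the bump function is stationary at x. *)
Record frame (x : M) := Frame {
  fr_rank : nat;
  fr_bump : smoothfun M;
  fr_sec : 'I_fr_rank -> section E;
  fr_coord : 'I_fr_rank -> forall z, E z -> R;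
  fr_lin : forall i z k u v,
    fr_coord i (k *: u + v : E z) = k * fr_coord i u + fr_coord i v;
  fr_smooth : forall i (s : section E), smooth (fun z => fr_coord i (s z));
  fr_bump1 : fr_bump x = 1;
  fr_bumpX : forall X : tangent x, X fr_bump = 0;
  fr_expand : forall z (v : E z),
    fr_bump z ^+ 2 *: v = \sum_i fr_coord i v *: fr_sec i z;
  fr_dual : forall i j z,
    fr_coord i (fr_sec j z) = fr_bump z ^+ 2 * (i == j)%:R }.

Lemma frame_exists x : exists fr : frame x, True.
Proof.
have [t tt tx] := trivs_cover E x.
have [chi0 [K [chi0x cK KU chi0K]]] := bump_function (@lt_open _ _ _ t) tx.
have [chi [chi_x chiX chiK]] : exists chi : smoothfun M, [/\ chi x = 1,
    forall X : tangent x, X chi = 0 & forall z, ~ K z -> chi z = 0].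
  (* The polynomial 2s - s^2 has value 1 and derivative 0 at s = 1. *)
  exists (2%:R *: chi0 - chi0 * chi0); split => [|X|z /chi0K c0].
  - by rewrite /= chi0x; ring.
  - by rewrite tderD tderZ tderN tder_leibniz chi0x; ring.
  - by rewrite /= c0; ring.
pose S i z := chi z *: lt_inv t z (delta_mx 0 i).
have sS i : smooth_section (S i).
  move=> s ts j; have := smooth_cutoff cK KU (@lt_open _ _ _ t) chiK
    (@lt_open _ _ _ s) (trivs_compat tt ts i j).
  by congr smooth_on; apply/funext => z; rewrite /S linearZ mxE.
pose co i z (v : E z) := chi z * lt_map t z v 0 i.
have sco i (s : section E) : smooth (fun z => co i z (s z)).
  apply: (smooth_cutoff cK KU (@lt_open _ _ _ t) chiK openT).
  rewrite setIT; exact: secP.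
unshelve eexists (@Frame x (lt_rank t) chi (fun i => MkSection (sS i)) co _ sco _ _ _ _) => //.
- by move=> i z k u v; rewrite /co linearP !mxE; ring.
(* Off [K] both sides vanish with the bump; on [K] the trivialization is available. *)
- move=> z v; have [Kz|/chiK c0] := pselect (K z); last first.
    rewrite c0 expr0n scale0r big1 // => i _; by rewrite /co c0 mul0r scale0r.
  rewrite -[v in LHS](lt_mapK (KU _ Kz)) /S.
  have inj := can_inj (lt_mapK (KU _ Kz)); apply: inj.
  rewrite linearZ linear_sum /= lt_invK; last exact: KU.
  rewrite {1}(row_sum_delta (lt_map t z v)) scaler_sumr; apply: eq_bigr => i _.
  rewrite !linearZ /= lt_invK; last exact: KU.
  by rewrite !scalerA /co; congr (_ *: _); ring.
- move=> i j z; have [Kz|/chiK c0] := pselect (K z); last first.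
    by rewrite /co c0 mul0r expr0n mul0r.
  rewrite /co /S linearZ /= lt_invK; last exact: KU.
  by rewrite !mxE eqxx /=; ring.
Qed.

End Frames.

Arguments fr_sec {R M E x} f i : rename.
Arguments fr_coord {R M E x} f i {z} v : rename.
Arguments fr_lin {R M E x} f i {z} : rename.
Arguments fr_smooth {R M E x} f i s : rename.

(** Expanding in a basis and exchanging the two sums is the cyclicity of the trace. The factor [k]
    accommodates frames cut off by a bump function, even where it vanishes. *)
Lemma lfun_trace_expand (R : realType) (V : vectType R) (phi : 'End(V)) n
    (e : 'I_n -> V) (c : 'I_n -> V -> R) k :
  (forall i a u v, c i (a *: u + v) = a * c i u + c i v) ->
  (forall v, k *: v = \sum_i c i v *: e i) ->
  k * lfun_trace phi = \sum_i c i (phi (e i)).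
Proof.
move=> clin cE.
have c0 i : c i 0 = 0.
  by have := clin i (-1) 0 0; rewrite scaleN1r oppr0 addr0 mulN1r addNr.
have csum i (r : seq 'I_(\dim {:V})) (a : 'I_(\dim {:V}) -> R) (v : 'I_(\dim {:V}) -> V) :
    c i (\sum_(j <- r) a j *: v j) = \sum_(j <- r) a j * c i (v j).
  by elim: r => [|j r IH]; rewrite ?big_nil ?c0 // !big_cons clin IH.
set b := vbasis {:V}.
have bE v : v = \sum_j coord b j v *: b`_j by apply: coord_vbasis; exact: memvf.
have -> : lfun_trace phi = \sum_j coord b j (phi b`_j).
  rewrite /lfun_trace /mxtrace; apply: eq_bigr => j _.
  by rewrite !mxE /= passmx.vecof_delta.
rewrite mulr_sumr.
under [RHS]eq_bigr => i _ do rewrite [phi (e i)]bE csum.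
rewrite exchange_big /=; apply: eq_bigr => j _.
under eq_bigr do rewrite mulrC.
transitivity (coord b j (phi (k *: b`_j))); first by rewrite !linearZ.
by rewrite cE !linear_sum; apply: eq_bigr => i _; rewrite !linearZ.
Qed.

(** * Tensorial operators and their traces *)

Section TensorialOperators.
Variables (R : realType) (M : manifold R) (E : vbundle M).
Implicit Types (z w : section E) (f : smoothfun M).

(* The algebra of tensorial operators; the extra scalar, which plays no role
   otherwise, makes it nontrivial even if all the fibres of E are 0. *)
Record tens := Tens {
  tens_fun :> section E -> section E;
  tens_sc : R;
  tensD : forall z w, tens_fun (z + w) = tens_fun z + tens_fun w;
  tensM : forall f z, tens_fun (sec_mul f z) = sec_mul f (tens_fun z) }.
Implicit Types L : tens.

Lemma tens_eq L L' : (forall z, L z = L' z) -> tens_sc L = tens_sc L' -> L = L'.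
Proof.
case: L L' => [L c LD LM] [L' c' LD' LM'] /= /funext LL cc; subst L' c'.
by congr Tens; exact: Prop_irrelevance.
Qed.

HB.instance Definition _ := gen_eqMixin tens.
HB.instance Definition _ := gen_choiceMixin tens.

Lemma sec_mul0 f : sec_mul f (0 : section E) = 0.
Proof. by apply: sec_eq => x /=; rewrite scaler0. Qed.
Lemma sec_mulD f z w : sec_mul f (z + w) = sec_mul f z + sec_mul f w.
Proof. by apply: sec_eq => x /=; rewrite scalerDr. Qed.
Lemma sec_mulN f z : sec_mul f (- z) = - sec_mul f z.
Proof. by apply: sec_eq => x /=; rewrite scalerN. Qed.
Lemma sec_mulZ f k z : sec_mul f (k *: z) = k *: sec_mul f z.
Proof. by apply: sec_eq => x /=; rewrite scalerA mulrC scalerA. Qed.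
Lemma sec_mul_cst k z : sec_mul (sfun_cst k) z = k *: z.
Proof. by apply: sec_eq. Qed.

Definition tens_zero : tens.
Proof. by apply: (@Tens (fun=> 0) 0) => [z w|f z]; rewrite ?addr0 ?sec_mul0. Defined.
Definition tens_add L L' : tens.
Proof.
apply: (@Tens (fun z => L z + L' z) (tens_sc L + tens_sc L')) => [z w|f z].
  by rewrite !tensD addrACA.
by rewrite !tensM sec_mulD.
Defined.
Definition tens_opp L : tens.
Proof.
apply: (@Tens (fun z => - L z) (- tens_sc L)) => [z w|f z]; first by rewrite tensD opprD.
by rewrite tensM sec_mulN.
Defined.
Definition tens_one : tens.
Proof. exact: (@Tens id 1). Defined.
Definition tens_mul L L' : tens.
Proof.
apply: (@Tens (fun z => L (L' z)) (tens_sc L * tens_sc L')) => [z w|f z].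
  by rewrite !tensD.
by rewrite !tensM.
Defined.
Definition tens_scale (k : R) L : tens.
Proof.
apply: (@Tens (fun z => k *: L z) (k * tens_sc L)) => [z w|f z].
  by rewrite tensD scalerDr.
by rewrite tensM sec_mulZ.
Defined.

Let addA : associative tens_add.
Proof. by move=> a b c; apply: tens_eq => [z|] /=; rewrite addrA. Qed.
Let addC : commutative tens_add.
Proof. by move=> a b; apply: tens_eq => [z|] /=; rewrite addrC. Qed.
Let add0 : left_id tens_zero tens_add.
Proof. by move=> a; apply: tens_eq => [z|] /=; rewrite add0r. Qed.
Let addN : left_inverse tens_zero tens_opp tens_add.
Proof. by move=> a; apply: tens_eq => [z|] /=; rewrite addNr. Qed.
HB.instance Definition _ := GRing.isZmodule.Build tens addA addC add0 addN.

Let scaleA a b L : tens_scale a (tens_scale b L) = tens_scale (a * b) L.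
Proof. by apply: tens_eq => [z|] /=; rewrite ?scalerA ?mulrA. Qed.
Let scale1 : left_id 1 tens_scale.
Proof. by move=> a; apply: tens_eq => [z|] /=; rewrite ?scale1r ?mul1r. Qed.
Let scaleDr : right_distributive tens_scale +%R.
Proof. by move=> c a b; apply: tens_eq => [z|] /=; rewrite ?scalerDr ?mulrDr. Qed.
Let scaleDl L : {morph tens_scale^~ L : a b / a + b}.
Proof. by move=> a b; apply: tens_eq => [z|] /=; rewrite ?scalerDl ?mulrDl. Qed.
HB.instance Definition _ :=
  GRing.Zmodule_isLmodule.Build R tens scaleA scale1 scaleDr scaleDl.

Lemma tensZ L k z : L (k *: z) = k *: L z.
Proof. by rewrite -!sec_mul_cst tensM. Qed.
Lemma tensN L z : L (- z) = - L z.
Proof. by have := tensZ L (-1) z; rewrite !scaleN1r. Qed.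
Lemma tens_at0 L : L 0 = 0.
Proof. by have := tensZ L 0 0; rewrite !scale0r. Qed.

Let mulA : associative tens_mul.
Proof. by move=> a b c; apply: tens_eq => [z|] //=; rewrite mulrA. Qed.
Let mul1 : left_id tens_one tens_mul.
Proof. by move=> a; apply: tens_eq => [z|] //=; rewrite mul1r. Qed.
Let mul1' : right_id tens_one tens_mul.
Proof. by move=> a; apply: tens_eq => [z|] //=; rewrite mulr1. Qed.
Let mulDl : left_distributive tens_mul +%R.
Proof. by move=> a b c; apply: tens_eq => [z|] //=; rewrite mulrDl. Qed.
Let mulDr : right_distributive tens_mul +%R.
Proof. by move=> a b c; apply: tens_eq => [z|] /=; rewrite ?tensD ?mulrDr. Qed.
Let one0 : tens_one != 0.
Proof.
by apply/eqP => /(congr1 tens_sc) /= /eqP; rewrite oner_eq0.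
Qed.
HB.instance Definition _ :=
  GRing.Zmodule_isNzRing.Build tens mulA mul1 mul1' mulDl mulDr one0.

Let scaleAl (k : R) L L' : k *: (L * L') = (k *: L) * L'.
Proof. by apply: tens_eq => [z|] //=; rewrite mulrA. Qed.
HB.instance Definition _ := GRing.Lmodule_isLalgebra.Build R tens scaleAl.
Let scaleAr (k : R) L L' : k *: (L * L') = L * (k *: L').
Proof. by apply: tens_eq => [z|] /=; rewrite ?tensZ // mulrCA. Qed.
HB.instance Definition _ := GRing.Lalgebra_isAlgebra.Build R tens scaleAr.

Lemma tens_addE L L' z : (L + L') z = L z + L' z. Proof. by []. Qed.
Lemma tens_oppE L z : (- L) z = - L z. Proof. by []. Qed.
Lemma tens_scD L L' : tens_sc (L + L') = tens_sc L + tens_sc L'. Proof. by []. Qed.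
Lemma tens_scN L : tens_sc (- L) = - tens_sc L. Proof. by []. Qed.

Lemma tens_sumE (I : Type) (r : seq I) (F : I -> tens) z :
  (\sum_(i <- r) F i) z = \sum_(i <- r) F i z.
Proof. by elim: r => [|i r IH]; rewrite ?big_nil // !big_cons -IH. Qed.

Lemma tens_sum L (I : Type) (r : seq I) (F : I -> section E) :
  L (\sum_(i <- r) F i) = \sum_(i <- r) L (F i).
Proof.
by elim: r => [|i r IH]; rewrite ?big_nil ?tens_at0 // !big_cons tensD IH.
Qed.

Lemma sec_expand x (fr : frame E x) z :
  sec_mul (fr_bump fr * fr_bump fr) z =
  \sum_i sec_mul (SmoothFun (fr_smooth fr i z)) (fr_sec fr i).
Proof. by apply: sec_eq => y; rewrite sec_sumE /= -expr2 fr_expand. Qed.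

Definition is_fiber L x (phi : 'End(E x)) := forall z, L z x = phi (z x).

(** By [sec_expand], with bump 1 at [x], L z x is a combination of the values of [L] on the frame
    whose coefficients depend on [z x] only. *)
Lemma is_fiber_exists L x : exists phi, is_fiber L (x := x) phi.
Proof.
have [fr _] := frame_exists E x.
pose g (v : E x) := \sum_j fr_coord fr j v *: L (fr_sec fr j) x.
have glin : linear g.
  move=> k u v; rewrite /g scaler_sumr -big_split; apply: eq_bigr => j _ /=.
  by rewrite fr_lin scalerDl scalerA.
pose G := HB.pack_for {linear E x -> E x} g (GRing.isLinear.Build R _ _ _ g glin).
exists (linfun G) => z; rewrite lfunE /=.
have := congr1 (fun s => L s x) (sec_expand fr z).
rewrite tensM /= fr_bump1 mulr1 scale1r => ->.
rewrite tens_sum sec_sumE; apply: eq_bigr => j _; by rewrite tensM.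
Qed.

Lemma sec_through x (v : E x) : exists z : section E, z x = v.
Proof.
have [fr _] := frame_exists E x.
exists (\sum_i fr_coord fr i v *: fr_sec fr i).
by have := fr_expand fr v; rewrite fr_bump1 expr1n scale1r sec_sumE.
Qed.

Lemma fiber_endoE L x (phi : 'End(E x)) : is_fiber L phi -> fiber_endo L x = phi.
Proof.
move=> Lphi; rewrite /fiber_endo; case: xgetP => [psi _ /= Lpsi|/(_ phi)//].
apply/lfunP => v; have [z <-] := sec_through v.
by rewrite -Lphi Lpsi.
Qed.

Lemma fiber_endo_spec L x : is_fiber L (fiber_endo L x).
Proof. by have [phi Lphi] := is_fiber_exists L x; rewrite (fiber_endoE Lphi). Qed.

Definition trace_at L x := lfun_trace (fiber_endo L x).

Lemma trace_expand L x (fr : frame E x) y :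
  fr_bump fr y ^+ 2 * trace_at L y = \sum_i fr_coord fr i (L (fr_sec fr i) y).
Proof.
rewrite (lfun_trace_expand _ (fun i => fr_lin fr i (z := y)) (fr_expand fr (z := y))).
by apply: eq_bigr => i _; rewrite -fiber_endo_spec.
Qed.

(** Where the bump does not vanish, [trace_expand] can be divided by its square. *)
Lemma smooth_trace L : smooth (trace_at L).
Proof.
apply: smooth_on_local => x _; have [fr _] := frame_exists E x.
pose W := [set y : M | fr_bump fr y != 0].
have oW : open W.
  rewrite openE => y /= Wy; rewrite /interior.
  change (nbhs y (fr_bump fr @^-1` [set k : R | k != 0])).
  apply: smooth_continuous.
  by apply: open_nbhs_nbhs; split => //; exact: open_neq.
exists W; split => //; first by rewrite /W /= fr_bump1 oner_neq0.
apply: (@smooth_on_eq _ _ _ (fun y => (fr_bump fr y * fr_bump fr y)^-1 *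
    \sum_i fr_coord fr i (L (fr_sec fr i) y))) => //.
  by move=> y Wy; rewrite -trace_expand -expr2 mulKf // expf_neq0.
apply: smooth_onM.
  apply: smooth_onV; first by move=> y Wy; rewrite mulf_neq0.
  by apply: smooth_onM; apply: smooth_onW; exact: sfunP.
apply: smooth_on_sum => i; apply: smooth_onW; exact: fr_smooth.
Qed.

Definition Tr L : smoothfun M := SmoothFun (smooth_trace L).

Lemma Tr_linear (k : R) L L' : Tr (k *: L + L') = k *: Tr L + Tr L'.
Proof.
apply: sfun_eq => x /=; have [fr _] := frame_exists E x.
have E1 K : trace_at K x = \sum_i fr_coord fr i (K (fr_sec fr i) x).
  by rewrite -trace_expand fr_bump1 expr1n mul1r.
rewrite !E1 mulr_sumr -big_split; apply: eq_bigr => i _ /=.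
by rewrite fr_lin.
Qed.

End TensorialOperators.

Section Derivations.
Variables (R : realType) (M : manifold R) (E : vbundle M).
Implicit Types (L : tens E) (f : smoothfun M) (z w : section E).

Record cdop := Cdop {
  cdop_fun :> section E -> section E;
  cdop_symbol : forall x : M, tangent x;
  cdopD : forall z w, cdop_fun (z + w) = cdop_fun z + cdop_fun w;
  cdop_smooth : smooth_vfield cdop_symbol;
  cdop_leibniz : leibniz_for cdop_fun cdop_symbol }.
Implicit Types N : cdop.

Definition vapply N f : smoothfun M := SmoothFun (cdop_smooth N f).

Lemma cdopM N f z : N (sec_mul f z) = sec_mul f (N z) + sec_mul (vapply N f) z.
Proof. by apply: sec_eq => x; rewrite cdop_leibniz. Qed.

Lemma cdop0 N : N 0 = 0.
Proof. by apply: (addrI (N 0)); rewrite -cdopD !addr0. Qed.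

Lemma cdopN N z : N (- z) = - N z.
Proof. by apply: (addrI (N z)); rewrite -cdopD !subrr cdop0. Qed.

Lemma cdop_sum N (I : Type) (r : seq I) (F : I -> section E) :
  N (\sum_(i <- r) F i) = \sum_(i <- r) N (F i).
Proof. by elim: r => [|i r IH]; rewrite ?big_nil ?cdop0 // !big_cons cdopD IH. Qed.

Definition cdop_add N L : cdop.
Proof.
apply: (@Cdop (fun z => N z + L z) (cdop_symbol N)) => [z w||f z x].
- by rewrite cdopD tensD addrACA.
- exact: cdop_smooth.
- by rewrite cdopM tensM /= scalerDr addrAC.
Defined.

(** The symbol terms of the two compositions cancel, which makes the commutator tensorial. *)
Definition ad N L : tens E.
Proof.
apply: (@Tens _ _ _ (fun z => N (L z) - L (N z)) 0) => [z w|f z].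
  by rewrite !(tensD, cdopD) opprD addrACA.
by rewrite tensM !cdopM tensD !tensM opprD addrACA subrr addr0 sec_mulD sec_mulN.
Defined.

Lemma ad_linear N (k : R) L L' : ad N (k *: L + L') = k *: ad N L + ad N L'.
Proof.
apply: tens_eq => [z|] /=; last by rewrite mulr0 addr0.
(* Homogeneity comes from the Leibniz rule, since a derivation kills constants. *)
have NZ w : N (k *: w) = k *: N w.
  rewrite -sec_mul_cst cdopM sec_mul_cst; apply: sec_eq => x /=.
  suff -> : cdop_symbol N x (sfun_cst k) = 0 by rewrite scale0r addr0.
  have -> : sfun_cst k = k *: (1 : smoothfun M) by apply: sfun_eq => y /=; rewrite mulr1.
  rewrite tderZ; apply/eqP; rewrite mulf_eq0; apply/orP; right.
  have := tder_leibniz (cdop_symbol N x) 1 1; rewrite mulr1 /= mul1r mulr1 => /eqP.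
  by rewrite -subr_eq0 opprD addrA subrr sub0r oppr_eq0.
by rewrite cdopD NZ opprD addrACA -scalerBr.
Qed.

Lemma adM N L L' : ad N (L * L') = ad N L * L' + L * ad N L'.
Proof.
apply: tens_eq => [z|] /=; last by rewrite mul0r mulr0 addr0.
by rewrite tensD tensN addrA subrK.
Qed.

(* Differentiate the expansion of L e_i in the frame at the centre of the
   bump function: the Christoffel symbols of N cancel in the commutator. *)
Lemma Tr_ad N L x : cdop_symbol N x (Tr L) = Tr (ad N L) x.
Proof.
have [fr _] := frame_exists E x.
pose l i j := SmoothFun (fr_smooth fr j (L (fr_sec fr i))).
have b1 : fr_bump fr x ^+ 2 = 1 by rewrite fr_bump1 expr1n.
have lin0 j : fr_coord fr j (0 : E x) = 0.
  by have := fr_lin fr j (-1) (0 : E x) 0; rewrite scaleN1r oppr0 addr0 mulN1r addNr.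
have lin_sum j (a : 'I_(fr_rank fr) -> R) (v : 'I_(fr_rank fr) -> E x) :
    fr_coord fr j (\sum_i a i *: v i) = \sum_i a i * fr_coord fr j (v i).
  elim: (index_enum _) => [|i r IH]; first by rewrite !big_nil.
  by rewrite !big_cons fr_lin IH.
have linD j u v : fr_coord fr j (u + v : E x) = fr_coord fr j u + fr_coord fr j v.
  by rewrite -{1}[u]scale1r fr_lin mul1r.
have linN j u : fr_coord fr j (- u : E x) = - fr_coord fr j u.
  by have := fr_lin fr j (-1) u 0; rewrite !addr0 lin0 addr0 scaleN1r mulN1r.
have NL i : N (L (fr_sec fr i)) x = \sum_j (l i j x *: N (fr_sec fr j) x +
    cdop_symbol N x (l i j) *: fr_sec fr j x).
  have := congr1 (fun s => N s x) (sec_expand fr (L (fr_sec fr i))).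
  rewrite cdopM cdop_sum sec_sumE /= tder_leibniz fr_bumpX mulr0 mul0r addr0.
  rewrite scale0r addr0 fr_bump1 mulr1 scale1r => ->.
  by apply: eq_bigr => j _; rewrite cdop_leibniz.
have NE i : N (fr_sec fr i) x = \sum_j fr_coord fr j (N (fr_sec fr i) x) *: fr_sec fr j x.
  by rewrite -fr_expand b1 scale1r.
have -> : Tr (ad N L) x = \sum_i fr_coord fr i (ad N L (fr_sec fr i) x).
  by rewrite -trace_expand b1 mul1r.
(* The diagonal coefficients add up to Tr L times the squared bump, which is 1 and stationary at
   [x]. *)
have -> : cdop_symbol N x (Tr L) = \sum_i cdop_symbol N x (l i i).
  rewrite -tder_sum.
  have -> : \sum_i l i i = fr_bump fr * fr_bump fr * Tr L.
    by apply: sfun_eq => y; rewrite sfun_sumE /= -expr2 trace_expand.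
  by rewrite !tder_leibniz /= fr_bumpX fr_bump1 !mulr0 !mul0r !addr0 mul0r addr0 mulr1 mul1r.
have LNE i : fr_coord fr i (L (N (fr_sec fr i)) x) =
    \sum_j fr_coord fr j (N (fr_sec fr i) x) * l j i x.
  rewrite fiber_endo_spec {1}NE linear_sum.
  under eq_bigr do rewrite linearZ /= -fiber_endo_spec.
  by rewrite lin_sum.
transitivity (\sum_i (\sum_j (l i j x * fr_coord fr i (N (fr_sec fr j) x) +
      cdop_symbol N x (l i j) * (i == j)%:R) -
    \sum_j fr_coord fr j (N (fr_sec fr i) x) * l j i x)); last first.
  apply: eq_bigr => i _; rewrite /= linD linN LNE; congr (_ - _).
  rewrite NL [in RHS]big_split linD !lin_sum -[RHS]big_split; apply: eq_bigr => j _ /=.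
  by rewrite fr_dual b1 mul1r.
rewrite sumrB; under [X in _ = X - _]eq_bigr do rewrite big_split /=.
rewrite big_split /= [X in X + _ - _]exchange_big /= addrAC.
under [X in X - _ + _]eq_bigr do under eq_bigr do rewrite mulrC.
rewrite subrr add0r; apply: eq_bigr => i _.
rewrite (bigD1 i) //= eqxx mulr1 big1 ?addr0 // => j /negPf ji.
by rewrite eq_sym ji mulr0.
Qed.

End Derivations.
(* A reflexive decision procedure for identities in abelian groups. *)
Inductive zexp := ZVar of nat | ZAdd of zexp & zexp | ZOpp of zexp | ZZero.

Fixpoint zeval (V : zmodType) (env : seq V) (e : zexp) : V :=
  match e with
  | ZVar i => nth 0 env i
  | ZAdd a b => zeval env a + zeval env b
  | ZOpp a => - zeval env a
  | ZZero => 0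
  end.

Fixpoint zcoef (e : zexp) (i : nat) : int :=
  match e with
  | ZVar j => if i == j then 1 else 0
  | ZAdd a b => zcoef a i + zcoef b i
  | ZOpp a => - zcoef a i
  | ZZero => 0
  end.

Lemma zevalE (V : zmodType) (env : seq V) n e : size env = n ->
  zeval env e = \sum_(i < n) nth 0 env i *~ zcoef e i.
Proof.
move=> nE; elim: e => [j|a IHa b IHb|a IHa|] /=.
- have [jn|nj] := ltnP j n.
    rewrite (bigD1 (Ordinal jn)) //= eqxx mulr1z big1 ?addr0 // => i.
    by rewrite -val_eqE /= => /negPf ->; rewrite mulr0z.
  rewrite nth_default ?nE // big1 // => i _; rewrite ifF ?mulr0z //.
  by apply/negbTE; rewrite neq_ltn (leq_trans (ltn_ord i) nj).
- by rewrite IHa IHb -big_split; apply: eq_bigr => i _; rewrite mulrzDr.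
- by rewrite IHa -sumrN; apply: eq_bigr => i _; rewrite mulrNz.
- by rewrite big1 // => i _; rewrite mulr0z.
Qed.

Lemma zeval_eq (V : zmodType) (env : seq V) n e e' : size env = n ->
  all (fun i => zcoef e i == zcoef e' i) (iota 0 n) -> zeval env e = zeval env e'.
Proof.
move=> nE /allP ee; rewrite !(zevalE _ nE); apply: eq_bigr => i _.
by congr (_ *~ _); apply/eqP/ee; rewrite mem_iota /=.
Qed.

(* Atoms are compared up to unification because the same operation may occur
   with different paths through the algebraic hierarchy. *)
Ltac zmod_mem x l := lazymatch l with
  | nil => constr:(false)
  | ?y :: ?l' =>
      match goal with
      | _ => let _ := match goal with _ => unify x y end in constr:(true)
      | _ => zmod_mem x l'
      end
  end.
Ltac zmod_index x l := lazymatch l with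
  | ?y :: ?l' =>
      match goal with
      | _ => let _ := match goal with _ => unify x y end in constr:(O)
      | _ => let i := zmod_index x l' in constr:(S i)
      end
  end.
Ltac zmod_length l := lazymatch l with
  | nil => constr:(O)
  | _ :: ?l' => let i := zmod_length l' in constr:(S i)
  end.
Ltac zmod_atoms t l := lazymatch t with
  | (?a + ?b)%R => let l' := zmod_atoms a l in zmod_atoms b l'
  | (- ?a)%R => zmod_atoms a l
  | 0%R => l
  | _ => let b := zmod_mem t l in
         lazymatch b with true => l | false => constr:(t :: l) end
  end.
Ltac zmod_quote t l := lazymatch t with
  | (?a + ?b)%R =>
      let a' := zmod_quote a l in let b' := zmod_quote b l in constr:(ZAdd a' b')
  | (- ?a)%R => let a' := zmod_quote a l in constr:(ZOpp a')
  | 0%R => constr:(ZZero)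
  | _ => let i := zmod_index t l in constr:(ZVar i)
  end.
Ltac zmod_solve := lazymatch goal with
  | |- @eq ?T ?a ?b =>
      let l := zmod_atoms a (@nil T) in let l := zmod_atoms b l in
      let n := zmod_length l in
      let a' := zmod_quote a l in let b' := zmod_quote b l in
      refine (@zeval_eq _ l n a' b' erefl _); vm_compute; reflexivity
  end.

(** * Curvature *)

Section Curvature.
Variables (R : realType) (M : manifold R) (A : algebroid M) (E : vbundle M).
Implicit Types (D : connection A E) (a b c : section A) (z w : section E).

Lemma nablaDr D a z w : D a (z + w) = D a z + D a w.
Proof.
by case: (nabla_cdo D a) => lin _ _ _; have := lin 1 z w; rewrite !scale1r.
Qed.

Lemma nablaDl D a b z : D (a + b) z = D a z + D b z.
Proof. by have := nabla_linear D 1 a b z; rewrite !scale1r. Qed.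

Lemma nabla0l D z : D 0 z = 0.
Proof. by apply: (addrI (D 0 z)); rewrite -nablaDl !addr0. Qed.

Lemma nablaNl D a z : D (- a) z = - D a z.
Proof. by apply: (addrI (D a z)); rewrite -nablaDl !subrr nabla0l. Qed.

Lemma nabla_smooth D a : smooth_vfield (fun x => anchor (a x)).
Proof. by case: (nabla_cdo D a). Qed.

Lemma nabla_leibniz D a : leibniz_for (D a) (fun x => anchor (a x)).
Proof. by case: (nabla_cdo D a). Qed.

Definition cdop_of D a : cdop E :=
  Cdop (nablaDr D a) (nabla_smooth D a) (nabla_leibniz D a).

Lemma bracketDl a a' b : bracket (a + a') b = bracket a b + bracket a' b.
Proof. by have := bracket_linearl 1 a a' b; rewrite !scale1r. Qed.

Lemma bracketDr a b b' : bracket a (b + b') = bracket a b + bracket a b'.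
Proof. by have := bracket_linearr 1 a b b'; rewrite !scale1r. Qed.

Lemma bracketC a b : bracket a b = - bracket b a.
Proof.
have := bracket_alt (a + b); rewrite bracketDl !bracketDr !bracket_alt add0r addr0.
by move=> /eqP; rewrite addr_eq0 => /eqP.
Qed.

Lemma bracketNr a b : bracket a (- b) = - bracket a b.
Proof.
apply: (addrI (bracket a b)); rewrite -bracketDr !subrr.
by apply: (addrI (bracket a 0)); rewrite -bracketDr !addr0.
Qed.

Lemma bracket0r a : bracket a 0 = 0.
Proof. by apply: (addrI (bracket a 0)); rewrite -bracketDr !addr0. Qed.

Lemma bracket0l a : bracket 0 a = 0.
Proof. by rewrite bracketC bracket0r oppr0. Qed.

Lemma anchor0 (x : M) f : anchor (0 : abundle A x) f = 0.
Proof.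
have := anchor_linear (-1) (0 : abundle A x) 0 f.
by rewrite scaler0 addr0 mulN1r addNr.
Qed.

(* The anchor is a Lie algebra morphism: compare the coefficients of c in the
   Jacobi identity for a, b, f c. The connection only serves to know that the
   anchors of a and b are smooth vector fields. *)
Lemma anchor_bracket D a b f x : anchor (bracket a b x) f =
  anchor (a x) (vapply (cdop_of D b) f) - anchor (b x) (vapply (cdop_of D a) f).
Proof.
(* If every section of [A] vanishes at [x], both sides are 0; otherwise coefficients of [c x] can be
   compared. *)
have [[c cx]|nc] := pselect (exists c : section A, c x != 0); last first.
  have all0 (c : section A) : c x = 0.
    by apply/eqP; apply: contra_notT nc => cx; exists c.
  by rewrite !all0 !anchor0 subrr.
pose af := vapply (cdop_of D a) f; pose bf := vapply (cdop_of D b) f.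
have leib a' f' c' : bracket a' (sec_mul f' c') =
    sec_mul f' (bracket a' c') + sec_mul (vapply (cdop_of D a') f') c'.
  by apply: sec_eq => y /=; rewrite bracket_leibniz.
have J := bracket_jacobi a b (sec_mul f c).
rewrite [bracket (sec_mul f c) a]bracketC [bracket (sec_mul f c) (bracket a b)]bracketC in J.
rewrite !(leib, bracketNr, bracketDr) in J.
have J' := bracket_jacobi a b c.
rewrite [bracket c a]bracketC [bracket c (bracket a b)]bracketC !bracketNr in J'.
have {}J := congr1 (fun s : section A => s x) J; have {}J' := congr1 (fun s : section A => f x *: s x) J'.
rewrite /= in J J'; rewrite scaler0 !scalerDr !scalerN in J'.
rewrite -J' in J.
set X := LHS; set Y := anchor (a x) _; set Z := anchor (b x) _.
have : (Y - Z - X) *: c x = 0.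
  rewrite !scalerBl; apply: (addrI (f x *: bracket a (bracket b c) x -
    f x *: bracket b (bracket a c) x - f x *: bracket (bracket a b) c x)).
  rewrite addr0 -[RHS]J /X /Y /Z; zmod_solve.
by move/eqP; rewrite scaler_eq0 (negPf cx) orbF subr_eq0 => /eqP ->.
Qed.

(** The Leibniz terms of the two compositions leave the commutator of the anchors, which
    [anchor_bracket] identifies with the symbol of the bracket term. *)
Definition curv D a b : tens E.
Proof.
apply: (@Tens _ _ _ (curvature (@bracket _ _ A) D a b) 0) => [z w|f z].
  by rewrite /curvature !nablaDr; zmod_solve.
have leib c := cdopM (cdop_of D c); rewrite /= in leib.
rewrite /curvature !(leib, nablaDr).
have -> : vapply (cdop_of D (bracket a b)) f =
    vapply (cdop_of D a) (vapply (cdop_of D b) f) - vapply (cdop_of D b) (vapply (cdop_of D a) f).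
  by apply: sfun_eq => x /=; rewrite (anchor_bracket D).
have -> g g' : sec_mul (g - g') z = sec_mul g z - sec_mul g' z.
  by apply: sec_eq => x /=; rewrite scalerBl.
rewrite !(sec_mulD, sec_mulN); zmod_solve.
Defined.

Lemma nabla_diffM D D' a f z : D a (sec_mul f z) - D' a (sec_mul f z) =
  sec_mul f (D a z - D' a z).
Proof.
by apply: sec_eq => x /=; rewrite !nabla_leibniz opprD addrACA subrr addr0 scalerBr.
Qed.

Definition nabla_diff D D' a : tens E.
Proof.
apply: (@Tens _ _ _ (fun z => D a z - D' a z) 0) => [z w|f z].
  by rewrite !nablaDr opprD addrACA.
exact: nabla_diffM.
Defined.

End Curvature.
(* With n the operators of a connection and p, q, r its derivatives in the
   directions of the parameter space attached to a, b, c, the terms Q, D, Q0 are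
   the curvature, its covariant derivative, and the curvature at a bracket. *)
Lemma bianchi_identity (S V : zmodType) (br : S -> S -> S) (n p q r : S -> V -> V)
    (a b c : S) (z : V) :
  (forall x y, br x y = - br y x) ->
  br (br a b) c + br (br b c) a + br (br c a) b = 0 ->
  (forall x v w, n x (v + w) = n x v + n x w) ->
  (forall x y v, n (x + y) v = n x v + n y v) ->
  (forall x v, n x (- v) = - n x v) -> (forall x v, n (- x) v = - n x v) ->
  let Q p q a b z := p b z - q a z + (n a (n b z) - n b (n a z) - n (br a b) z) in
  let D p q r a b c z := p b (n c z) + n b (p c z) - p c (n b z) - n c (p b z)
    - p (br b c) z + (n a (Q q r b c z) - Q q r b c (n a z)) in
  let Q0 r a b c z := - r (br a b) z
    + (n (br a b) (n c z) - n c (n (br a b) z) - n (br (br a b) c) z) in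
  D p q r a b c z + D q r p b c a z + D r p q c a b z =
  Q0 r a b c z + Q0 p b c a z + Q0 q c a b z.
Proof.
move=> brC J nDr nDl nNr nNl /=.
have -> : br (br a b) c = - br (br b c) a - br (br c a) b.
  by apply/eqP; rewrite -subr_eq0 opprD !opprK addrA J.
rewrite !(nDr, nNr, nDl, nNl); zmod_solve.
Qed.

(** * Commutators and traces of sums and products *)

Section AdSums.
Variables (R : realType) (M : manifold R) (E : vbundle M).
Implicit Types (N : cdop E) (L : tens E).

Lemma ad0 N : ad N 0 = 0.
Proof.
by have := ad_linear N (-1) 0 0; rewrite !scaleN1r oppr0 addr0 addNr.
Qed.

Lemma ad_sum N (I : Type) (r : seq I) (c : I -> R) (F : I -> tens E) :
  ad N (\sum_(i <- r) c i *: F i) = \sum_(i <- r) c i *: ad N (F i).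
Proof. by elim: r => [|i r IH]; rewrite ?big_nil ?ad0 // !big_cons ad_linear IH. Qed.

Lemma ad1 N : ad N 1 = 0.
Proof. by apply: tens_eq => [z|] //=; rewrite subrr. Qed.

Lemma ad_prod N p (F : nat -> tens E) :
  ad N (\prod_(l < p) F l) = \sum_(m < p) slot m (ad N (F m)) F.
Proof.
elim: p => [|p IH]; first by rewrite !big_ord0 ad1.
rewrite big_ord_recr /= adM IH [RHS]big_ord_recr /= mulr_suml; congr (_ + _).
  apply: eq_bigr => m _; rewrite /slot big_ord_recr /= ifF //.
  by rewrite -val_eqE /= gtn_eqF.
rewrite /slot big_ord_recr /= eqxx; congr (_ * _); apply: eq_bigr => l _.
by rewrite -val_eqE /= ltn_eqF.
Qed.

Lemma slot_sum p (m : 'I_p) (I : Type) (r : seq I) (c : I -> R) (X : I -> tens E) f :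
  slot m (\sum_(i <- r) c i *: X i) f = \sum_(i <- r) c i *: slot m (X i) f.
Proof.
rewrite slot_split mulr_sumr mulr_suml; apply: eq_bigr => i _.
by rewrite slot_split -scalerAr -scalerAl.
Qed.

Lemma Tr_sum (I : Type) (r : seq I) (c : I -> R) (F : I -> tens E) :
  Tr (\sum_(i <- r) c i *: F i) = \sum_(i <- r) c i *: Tr (F i).
Proof.
elim: r => [|i r IH]; last by rewrite !big_cons Tr_linear IH.
rewrite !big_nil; have := Tr_linear (-1) (0 : tens E) 0.
by rewrite !scaleN1r oppr0 addr0 addNr.
Qed.

End AdSums.

Lemma pderN (R : realType) n (V : lmodType R) (f : ('I_n -> R) -> V) g :
  pder f g -> pder (fun b => - f b) (fun j b => - g j b).
Proof.
by apply: (@pder_linear R n V V -%R) => c x y; rewrite opprD scalerN.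
Qed.

(** * Affine families of connections *)

Section AffineFamily.
Variables (R : realType) (M : manifold R) (A : algebroid M) (E : vbundle M).
Variables (k : nat) (nb : 'I_k.+1 -> connection A E).
Local Notation S := (@const_section R M A k).
Implicit Types (a b c : section A) (t : 'I_k.+1 -> R) (X : 'rV[R]_k) (u v : S).

Definition theta (j : 'I_k.+1) a : tens E := nabla_diff (nb j) (nb ord0) a.

Definition thetas (w : 'I_k.+1 -> R) a : tens E := \sum_j w j *: theta j a.

(** Component 0 has no influence on [thetas], because [theta ord0] is 0. *)
Definition extend X (j : 'I_k.+1) : R := if unlift ord0 j is Some i then X 0 i else 0.

Definition nabla_t t a : cdop E := cdop_add (cdop_of (nb ord0) a) (thetas t a).

Lemma thetaD j a b : theta j (a + b) = theta j a + theta j b.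
Proof.
apply: tens_eq => [z|] /=; last by rewrite addr0.
by rewrite !nablaDl opprD addrACA.
Qed.

Lemma thetasD w a b : thetas w (a + b) = thetas w a + thetas w b.
Proof.
by rewrite -big_split; apply: eq_bigr => j _; rewrite thetaD scalerDr.
Qed.

Lemma thetas0 w : thetas w 0 = 0.
Proof. by apply: (addrI (thetas w 0)); rewrite -thetasD !addr0. Qed.

Lemma thetasN w a : thetas w (- a) = - thetas w a.
Proof. by apply: (addrI (thetas w a)); rewrite -thetasD !subrr thetas0. Qed.

Lemma thetas_ext0 a : thetas (extend 0) a = 0.
Proof.
rewrite /thetas big1 // => j _; rewrite /extend.
by case: unlift => [i|]; rewrite ?mxE scale0r.
Qed.

Lemma thetas_extD X Y a : thetas (extend (X + Y)) a = thetas (extend X) a + thetas (extend Y) a.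
Proof.
rewrite -big_split; apply: eq_bigr => j _ /=; rewrite -scalerDl /extend.
by case: unlift => [i|]; rewrite ?mxE ?addr0.
Qed.

Lemma thetas_extE X a : thetas (extend X) a = \sum_i X 0 i *: theta (lift ord0 i) a.
Proof.
rewrite /thetas big_ord_recl {1}/extend unlift_none scale0r add0r.
by apply: eq_bigr => i _; rewrite /extend liftK.
Qed.

Lemma thetas_sc w a : tens_sc (thetas w a) = 0.
Proof.
rewrite /thetas; elim: (index_enum _) => [|j r IH]; first by rewrite big_nil.
by rewrite big_cons /= IH mulr0 addr0.
Qed.

Lemma nabla_tDl t a b z : nabla_t t (a + b) z = nabla_t t a z + nabla_t t b z.
Proof. by rewrite /= nablaDl thetasD /= addrACA. Qed.

Lemma nabla_tNl t a z : nabla_t t (- a) z = - nabla_t t a z.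
Proof. by rewrite /= nablaNl thetasN /= opprD. Qed.

(** Sorted by degree in [t], which makes the polynomial dependence visible; [curv_tE] gives the
    usual expression of the curvature. *)
Definition curv_t t v u : tens E :=
  thetas (extend v.1) u.2 - thetas (extend u.1) v.2 + curv (nb ord0) v.2 u.2 +
  (ad (cdop_of (nb ord0) v.2) (thetas t u.2) - ad (cdop_of (nb ord0) u.2) (thetas t v.2)
   - thetas t (bracket v.2 u.2)) +
  (thetas t v.2 * thetas t u.2 - thetas t u.2 * thetas t v.2).

(** The first variation of the curvature when the connection varies by [tau]: the covariant exterior
    derivative of [tau], as [curv_derE] shows. *)
Definition curv_der (tau : section A -> tens E) t v u : tens E :=
  ad (cdop_of (nb ord0) v.2) (tau u.2) - ad (cdop_of (nb ord0) u.2) (tau v.2)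
   - tau (bracket v.2 u.2) +
  (tau v.2 * thetas t u.2 + thetas t v.2 * tau u.2
   - (tau u.2 * thetas t v.2 + thetas t u.2 * tau v.2)).

Lemma pder_curv v u :
  pder (fun t => curv_t t v u) (fun j t => curv_der (theta j) t v u).
Proof.
have th a : pder (fun t => thetas t a) (fun j _ => theta j a) :=
  pder_linear_form (fun j => theta j a).
have adth N a : pder (fun t => ad N (thetas t a)) (fun j _ => ad N (theta j a)).
  by apply: pder_linear (th a) => c x y; exact: ad_linear.
have := pderD (pderD (pder_cst _ (thetas (extend v.1) u.2 - thetas (extend u.1) v.2
    + curv (nb ord0) v.2 u.2))
  (pderD (pderD (adth (cdop_of (nb ord0) v.2) u.2) (pderN (adth (cdop_of (nb ord0) u.2) v.2)))
     (pderN (th (bracket v.2 u.2)))))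
  (pderD (pderM (th v.2) (th u.2)) (pderN (pderM (th u.2) (th v.2)))).
by apply: pder_ext => // j b; rewrite add0r.
Qed.

Lemma curv_tE t v u z : curv_t t v u z =
  thetas (extend v.1) u.2 z - thetas (extend u.1) v.2 z +
  (nabla_t t v.2 (nabla_t t u.2 z) - nabla_t t u.2 (nabla_t t v.2 z)
   - nabla_t t (bracket v.2 u.2) z).
Proof.
rewrite /curv_t /= /curvature !(nablaDr, tensD); zmod_solve.
Qed.

Lemma curv_derE tau t v u z : curv_der tau t v u z =
  tau v.2 (nabla_t t u.2 z) + nabla_t t v.2 (tau u.2 z) - tau u.2 (nabla_t t v.2 z)
  - nabla_t t u.2 (tau v.2 z) - tau (bracket v.2 u.2) z.
Proof.
rewrite /curv_der /= !(nablaDr, tensD); zmod_solve.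
Qed.

Lemma curv_der_sum (I : Type) (r : seq I) (c : I -> R) (tau : I -> section A -> tens E) t v u :
  curv_der (fun a => \sum_(i <- r) c i *: tau i a) t v u =
  \sum_(i <- r) c i *: curv_der (tau i) t v u.
Proof.
rewrite /curv_der; move: (thetas t v.2) (thetas t u.2) => T1 T2.
rewrite !ad_sum !mulr_suml !mulr_sumr -2!sumrB -2!big_split -sumrB -big_split /=.
apply: eq_bigr => i _; rewrite !(scalerDr, scalerBr, scalerN).
by rewrite -!scalerAl -!scalerAr.
Qed.

Lemma curv_t_sc t v u : tens_sc (curv_t t v u) = 0.
Proof. by rewrite /curv_t /= !thetas_sc; ring. Qed.

Lemma curv_t_anti t v u : curv_t t v u = - curv_t t u v.
Proof.
apply: tens_eq => [z|]; last by rewrite tens_scN !curv_t_sc oppr0.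
rewrite tens_oppE !curv_tE bracketC nabla_tNl; zmod_solve.
Qed.

Lemma curv_tD t v v' u : curv_t t (v + v') u = curv_t t v u + curv_t t v' u.
Proof.
apply: tens_eq => [z|]; last by rewrite tens_scD !curv_t_sc addr0.
rewrite tens_addE !curv_tE [(v + v').1]/= [(v + v').2]/= thetas_extD thetasD.
rewrite bracketDl !nabla_tDl !cdopD !tens_addE; zmod_solve.
Qed.

Lemma curv_tN t v u : curv_t t (- v) u = - curv_t t v u.
Proof.
apply: (addrI (curv_t t v u)); rewrite -curv_tD !subrr.
by apply: (addrI (curv_t t 0 u)); rewrite -curv_tD !addr0.
Qed.

(** The covariant derivative of the curvature along a constant section: its derivative in [t] along
    [u.1] plus the commutator with the operator of [u.2]. *)
Definition curv_D t (u v w : S) : tens E :=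
  curv_der (thetas (extend u.1)) t v w + ad (nabla_t t u.2) (curv_t t v w).

Lemma curv_der_sc tau t v u :
  (forall a, tens_sc (tau a) = 0) -> tens_sc (curv_der tau t v u) = 0.
Proof. by move=> tau0; rewrite /curv_der /= !tau0; ring. Qed.

(* Keeps the unifier from comparing the definitions in curv_bianchi. *)
#[local] Opaque thetas nabla_t curv_t curv_der.

Lemma curv_bianchi t (u v w : S) :
  curv_D t u v w + curv_D t v w u + curv_D t w u v =
  curv_t t (const_bracket u v) w + curv_t t (const_bracket v w) u +
  curv_t t (const_bracket w u) v.
Proof.
apply: tens_eq => [z|]; last first.
  have sc0 L L' : tens_sc L = 0 -> tens_sc L' = 0 -> tens_sc (L + L') = 0 :> R.
    by move=> L0 L0'; rewrite tens_scD L0 L0' addr0.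
  have Dsc u' v' w' : tens_sc (curv_D t u' v' w') = 0.
    by apply: sc0; [apply: curv_der_sc; exact: thetas_sc|].
  transitivity (0 : R); last symmetry.
    by apply: (sc0); [apply: (sc0)|]; exact: Dsc.
  by apply: (sc0); [apply: (sc0)|]; exact: curv_t_sc.
have J : bracket (bracket u.2 v.2) w.2 + bracket (bracket v.2 w.2) u.2 +
    bracket (bracket w.2 u.2) v.2 = 0.
  have := bracket_jacobi u.2 v.2 w.2.
  rewrite [bracket u.2 _]bracketC [bracket v.2 (bracket _ _)]bracketC [bracket w.2 (bracket _ _)]bracketC.
  by move/eqP; rewrite -!opprD oppr_eq0 => /eqP <-; zmod_solve.
have := @bianchi_identity (section A) (section E) (@bracket R M A)
  (fun a z => nabla_t t a z) (fun a z => thetas (extend u.1) a z)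
  (fun a z => thetas (extend v.1) a z) (fun a z => thetas (extend w.1) a z)
  u.2 v.2 w.2 z (@bracketC R M A) J (fun x => cdopD (nabla_t t x)) (nabla_tDl t)
  (fun x => cdopN (nabla_t t x)) (nabla_tNl t).
move=> B; cbv zeta beta in B.
have DE u' v' w' : curv_D t u' v' w' z =
    curv_der (thetas (extend u'.1)) t v' w' z +
    (nabla_t t u'.2 (curv_t t v' w' z) - curv_t t v' w' (nabla_t t u'.2 z)) by [].
have add3 (L1 L2 L3 : tens E) : (L1 + L2 + L3) z = L1 z + L2 z + L3 z by [].
rewrite (add3 (curv_D _ _ _ _)) (add3 (curv_t _ _ _)) 3!DE 3!curv_derE 9!curv_tE.
(* Brackets of constant sections have no component along R^k. *)
rewrite ![(const_bracket _ _).1]/= ![(const_bracket _ _).2]/= !thetas_ext0.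
rewrite ![(0 : tens E) _]/=.
match type of B with ?b1 = ?b2 =>
  transitivity b1; [zmod_solve|transitivity b2; [exact: B|zmod_solve]] end.
Qed.

Variable p : nat.

(** This is 2^p times ch_p of the affine family, see [ch_affE]. *)
Definition form t (s : seq S) : smoothfun M := Tr (altpow (curv_t t) p s).

Definition form_der (j : 'I_k.+1) t (s : seq S) : smoothfun M :=
  Tr (alt (2 * p) (fun y : nat -> S =>
    \sum_(m < p) slot m (curv_der (theta j) t (y (2 * m)%N) (y (2 * m).+1))
      (fun l => curv_t t (y (2 * l)%N) (y (2 * l).+1))) (nth 0 s)).

Lemma pder_form s : pder (fun t => form t s) (fun j t => form_der j t s).
Proof.
apply: pder_linear (@Tr_linear R M E) _; rewrite /altpow /alt.
apply: pder_sum => tau.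
apply: (@pder_linear _ _ _ _ (fun L : tens E => (-1) ^+ tau *: L)) => [c x y|].
  by rewrite scalerDr !scalerA mulrC.
pose y := nth 0 s \o papp tau.
apply: (@pder_prod _ _ _ p (fun l t => curv_t t (y (2 * l)%N) (y (2 * l).+1))
  (fun l j t => curv_der (theta j) t (y (2 * l)%N) (y (2 * l).+1))) => l.
exact: pder_curv.
Qed.

Lemma nth_delete (T : zmodType) i (s : seq T) k' : nth 0 (delete i s) k' = nth 0 s (bump i k').
Proof.
rewrite /delete nth_cat size_take nth_drop /bump.
have [is_|si] := ltnP i (size s).
  have [ki|ik] := ltnP k' i; first by rewrite nth_take // leqNgt ki.
  by congr nth; lia.
have [ks|sk] := ltnP k' (size s).
  by rewrite take_oversize // leqNgt (leq_trans ks).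
rewrite !nth_default //; first exact: leq_trans sk (leq_addl _ _).
exact: leq_trans (leq_trans si (leqnSn _)) (leq_addr _ _).
Qed.

(** The trace of [alt_qprod_closed]: the two parts of [curv_D] become the derivative in [t] and, by
    [Tr_ad], the derivative along the anchor. *)
Lemma form_closed t (s : seq S) (x : M) : (0 < p)%N ->
  \sum_(i < (2 * p).+1) (-1) ^+ i *
    (\sum_(l < k) (nth 0 s i).1 0 l * form_der (lift ord0 l) t (delete i s) x +
     anchor ((nth 0 s i).2 x) (form t (delete i s))) +
  \sum_(j < (2 * p).+1) \sum_(i < (2 * p).+1 | (i < j)%N) (-1) ^+ (i + j) *
    form t (const_bracket (nth 0 s i) (nth 0 s j) :: delete i (delete j s)) x = 0.
Proof.
move=> p0; pose tr (L : tens E) := Tr L x.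
have trL (c : R) L L' : tr (c *: L + L') = c * tr L + tr L' by rewrite /tr Tr_linear.
have trD L L' : tr (L + L') = tr L + tr L' by rewrite -{1}[L]scale1r trL mul1r.
have tr0 : tr 0 = 0 by apply: (addrI (tr 0)); rewrite -trD !addr0.
have trZ (c : R) L : tr (c *: L) = c * tr L by rewrite -[c *: L]addr0 trL tr0 addr0.
have tr_sum (I : finType) (P : pred I) (F : I -> tens E) :
    tr (\sum_(i | P i) F i) = \sum_(i | P i) tr (F i) by exact: big_morph.
have inj (n : nat) (L L' : tens E) : n.+1%:R *: L = n.+1%:R *: L' -> L = L'.
  by apply: scalerI; rewrite pnatr_eq0.
have brC (u v : S) : const_bracket u v = - const_bracket v u.
  by rewrite /const_bracket bracketC; congr pair; rewrite /= oppr0.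
have := alt_qprod_closed (curv_t_anti t) (curv_tN t) brC (curv_bianchi t) inj (nth 0 s) p0.
move/(congr1 tr); rewrite trD tr0 !tr_sum => e; rewrite -[RHS]e; congr (_ + _).
  apply: eq_bigr => i _; rewrite trZ; congr (_ * _).
  set v := nth 0 s i.
  have <- : cdop_symbol (nabla_t t v.2) x (form t (delete i s)) = anchor (v.2 x) (form t (delete i s)).
    by [].
  rewrite /form Tr_ad -/(tr _) /altpow.
  have -> : nth 0 (delete i s) = nth 0 s \o bump i by apply/funext => k'; rewrite nth_delete.
  set y0 := nth 0 s \o bump i; pose G (l : 'I_k) (y : nat -> S) : tens E :=
    \sum_(m < p) slot m (curv_der (theta (lift ord0 l)) t (y (2 * m)%N) (y (2 * m).+1))
      (fun l => curv_t t (y (2 * l)%N) (y (2 * l).+1)).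
  have -> : \sum_(l < k) v.1 0 l * form_der (lift ord0 l) t (delete i s) x =
      tr (\sum_(l < k) v.1 0 l *: alt (2 * p) (G l) y0).
    rewrite tr_sum; apply: eq_bigr => l _; rewrite trZ /form_der.
    by have -> : nth 0 (delete i s) = y0 by apply/funext => k'; rewrite nth_delete.
  rewrite -trD; congr tr; rewrite /alt ad_sum.
  under eq_bigr do rewrite scaler_sumr; rewrite exchange_big -big_split /=.
  apply: eq_bigr => tau _; move: (y0 \o papp tau) => y.
  have -> : \sum_(l < k) v.1 0 l *: ((-1) ^+ tau *: G l y) = (-1) ^+ tau *: (\sum_(l < k) v.1 0 l *: G l y).
    by rewrite scaler_sumr; apply: eq_bigr => l _; rewrite !scalerA mulrC.
  rewrite -scalerDr; congr (_ *: _); rewrite /qprod.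
  rewrite (ad_prod _ p (fun l => curv_t t (y (2 * l)%N) (y (2 * l).+1))) /G /dqprod.
  under eq_bigr do rewrite scaler_sumr; rewrite exchange_big -big_split /=.
  apply: eq_bigr => m _; rewrite /curv_D.
  have -> : thetas (extend v.1) = fun a => \sum_l v.1 0 l *: theta (lift ord0 l) a.
    by apply/funext => a; rewrite thetas_extE.
  by rewrite curv_der_sum slotD slot_sum.
apply: eq_bigr => j _; rewrite [RHS]tr_sum; apply: eq_bigr => i _; rewrite [RHS]trZ.
rewrite /form /altpow.
have -> // : nth 0 (const_bracket (nth 0 s i) (nth 0 s j) :: delete i (delete j s)) =
    ins 0 (const_bracket (nth 0 s i) (nth 0 s j)) ((nth 0 s \o bump j) \o bump i).
rewrite (nth_cat_ins [::]) /=; congr ins.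
by apply/funext => k'; rewrite !nth_delete.
Qed.

End AffineFamily.

(** * Chern-Simons forms *)

Section FiberEndomorphisms.
Variables (R : realType) (M : manifold R) (E : vbundle M) (x : M).
Implicit Types L : tens E.

Lemma fiber_endoD L L' : fiber_endo (L + L') x = fiber_endo L x + fiber_endo L' x.
Proof.
by apply: fiber_endoE => z; rewrite tens_addE /= !fiber_endo_spec lfunE.
Qed.

Lemma fiber_endoZ (c : R) L : fiber_endo (c *: L) x = c *: fiber_endo L x.
Proof. by apply: fiber_endoE => z; rewrite /= fiber_endo_spec lfunE. Qed.

Lemma fiber_endo0 : fiber_endo (0 : tens E) x = 0.
Proof. by apply: fiber_endoE => z; rewrite lfunE. Qed.

Lemma fiber_endo_sum (I : Type) (r : seq I) (F : I -> tens E) :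
  fiber_endo (\sum_(i <- r) F i) x = \sum_(i <- r) fiber_endo (F i) x.
Proof.
elim: r => [|i r IH]; first by rewrite !big_nil fiber_endo0.
by rewrite !big_cons fiber_endoD IH.
Qed.

Lemma fiber_endo_prod p (F : 'I_p -> tens E) : fiber_endo (\prod_(l < p) F l) x =
  \big[@comp_lfun _ _ _ _ / \1%VF]_(l < p) fiber_endo (F l) x.
Proof.
elim: p F => [|p IH] F.
  by rewrite !big_ord0; apply: fiber_endoE => z; rewrite lfunE.
rewrite !big_ord_recl -IH; apply: fiber_endoE => z.
by rewrite comp_lfunE -!fiber_endo_spec.
Qed.

Lemma fiber_cochain_pow (S : zmodType) (Q : S -> S -> tens E) p (u : seq S) :
  cochain_pow p (fun v w => fiber_endo (Q v w) x) u =
  (2 ^+ p)^-1 *: fiber_endo (altpow Q p u) x.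
Proof.
rewrite /cochain_pow /altpow /alt fiber_endo_sum; congr (_ *: _).
apply: eq_bigr => tau _; rewrite fiber_endoZ fiber_endo_prod; congr (_ *: _).
apply: eq_bigr => l _ /=.
by rewrite -(papp_ord tau (even_ord l)) -(papp_ord tau (odd_ord l)).
Qed.

End FiberEndomorphisms.

Lemma is_derive_affine (R : realType) k (f : 'rV[R]_k -> R) (t X : 'rV[R]_k) d :
  (forall h : R, f (h *: X + t) = f t + h * d) -> is_derive t X f d.
Proof.
move=> fE; have L : (fun h => h^-1 *: ((f \o shift t) (h *: X) - f t)) @ 0^' --> d.
  apply/cvgrPdist_le => e e0; near=> h.
  have h0 : h != 0 by near: h; exact: nbhs_dnbhs_neq.
  rewrite /= fE [f t + _]addrC addrK /GRing.scale /= mulKf // subrr normr0; exact: ltW.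
by apply: DeriveDef; [apply/cvg_ex; exists d|exact: cvg_lim].
Unshelve. all: by end_near. Qed.

Lemma lfun_traceZ (R : realType) (V : vectType R) (c : R) (phi : 'End(V)) :
  lfun_trace (c *: phi) = c * lfun_trace phi.
Proof.
rewrite /lfun_trace -mxtraceZ; congr mxtrace; apply/matrixP => i j.
by rewrite !mxE /= lfunE linearZ.
Qed.

Lemma linear_form_separation (R : realType) (V : vectType R) (u v : V) :
  (forall phi : {linear V -> R^o}, phi u = phi v) -> u = v.
Proof.
move=> e; rewrite (coord_vbasis (memvf u)) [RHS](coord_vbasis (memvf v)).
by apply: eq_bigr => i _; rewrite (e (coord (vbasis {:V}) i)).
Qed.

Section AffineConnection.
Variables (R : realType) (M : manifold R) (A : algebroid M) (E : vbundle M).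
Variables (k : nat) (nb : 'I_k.+1 -> connection A E).
Local Notation S := (@const_section R M A k).
Implicit Types (a b : section A) (t X : 'rV[R]_k) (u v : S) (z : section E).

(** Linear forms separate the points of a fibre, so that the description in [family_derive] has at
    most one solution. *)
Lemma family_deriveE X t (s : @Defs.family R M E k) z :
  (forall x (phi : {linear E x -> R^o}),
    is_derive t X (fun t' => phi (s t' x) : R) (phi (z x))) ->
  family_derive X t s = z.
Proof.
move=> sz; rewrite /family_derive; case: xgetP => [z' _ /= sz'|/(_ z)//].
apply: sec_eq => x; apply: linear_form_separation => phi.
by have [_ <-] := sz' x phi; have [_ <-] := sz x phi.
Qed.

Lemma nabla_t_barycentric t a z : nabla_t nb (barycentric 1 t) a z =
  (1 - \sum_(i < k) t 0 i) *: nb ord0 a z + \sum_(i < k) t 0 i *: nb (lift ord0 i) a z.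
Proof.
rewrite /= /thetas tens_sumE big_ord_recl /= subrr scaler0 add0r.
under eq_bigr do rewrite barycentric_lift scalerBr.
by rewrite sumrB -scaler_suml scalerBl scale1r addrA addrAC.
Qed.

Lemma nabla_aff_cst u z t :
  nabla_aff nb u (fun=> z) t = nabla_t nb (barycentric 1 t) u.2 z.
Proof.
have D0 : family_derive u.1 t (fun=> z) = 0.
  by apply: family_deriveE => x phi; rewrite linear0; exact: is_derive_cst.
by rewrite /nabla_aff D0 add0r nabla_t_barycentric.
Qed.

(** In each fibre the family is affine in [t]; its derivative along [v.1] is the linear part. *)
Lemma nabla_aff_nabla_t v b z t :
  nabla_aff nb v (fun t' => nabla_t nb (barycentric 1 t') b z) t =
  thetas nb (extend v.1) b z + nabla_t nb (barycentric 1 t) v.2 (nabla_t nb (barycentric 1 t) b z).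
Proof.
suff D : family_derive v.1 t (fun t' => nabla_t nb (barycentric 1 t') b z) =
    thetas nb (extend v.1) b z by rewrite /nabla_aff D [nabla_t _ _ v.2 _]nabla_t_barycentric.
apply: family_deriveE => x phi; apply: is_derive_affine => h.
have phiE t' : phi (nabla_t nb (barycentric 1 t') b z x) = phi (nb ord0 b z x) +
    \sum_i t' 0 i * phi (theta nb (lift ord0 i) b z x).
  rewrite /= /thetas tens_sumE big_ord_recl /= subrr scaler0 add0r linearD.
  rewrite sec_sumE linear_sum; congr (_ + _); apply: eq_bigr => i _.
  by rewrite barycentric_lift linearZ.
rewrite !phiE thetas_extE tens_sumE sec_sumE linear_sum -addrA; congr (_ + _).
rewrite mulr_sumr -big_split; apply: eq_bigr => i _.
have -> : phi ((v.1 0 i *: theta nb (lift ord0 i) b) z x) =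
    v.1 0 i * phi (theta nb (lift ord0 i) b z x) by exact: linearZ.
by rewrite !mxE /=; ring.
Qed.

Lemma curvature_aff v u z t :
  curvature (@const_bracket R M A k) (nabla_aff nb) v u (fun=> z) t =
  curv_t nb (barycentric 1 t) v u z.
Proof.
have affE w : nabla_aff nb w (fun=> z) = fun t' => nabla_t nb (barycentric 1 t') w.2 z.
  by apply/funext => t'; exact: nabla_aff_cst.
rewrite curv_tE /curvature !affE.
transitivity (nabla_aff nb v (fun t' => nabla_t nb (barycentric 1 t') u.2 z) t -
  nabla_aff nb u (fun t' => nabla_t nb (barycentric 1 t') v.2 z) t -
  nabla_t nb (barycentric 1 t) (bracket v.2 u.2) z) => //.
rewrite !nabla_aff_nabla_t.
move: (nabla_t _ _ _ (nabla_t _ _ _ z)) (nabla_t _ _ _ (nabla_t _ _ _ z)) => N1 N2.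
zmod_solve.
Qed.

Lemma ch_affE p (s : seq S) t x :
  ch_aff p nb s t x = (2 ^+ p)^-1 * form nb p (barycentric 1 t) s x.
Proof.
rewrite /ch_aff.
have -> : (fun v w : S => fiber_endo
       (fun z => curvature (@const_bracket R M A k) (nabla_aff nb) v w (fun=> z) t) x) =
    (fun v w => fiber_endo (curv_t nb (barycentric 1 t) v w) x).
  apply/funext => v; apply/funext => w; have -> // : (fun z => curvature (@const_bracket R M A k) (nabla_aff nb) v w (fun=> z) t) =
    tens_fun (curv_t nb (barycentric 1 t) v w).
  by apply/funext => z; exact: curvature_aff.
by rewrite fiber_cochain_pow lfun_traceZ.
Qed.

End AffineConnection.

(** * Integration of polynomial families over the simplex *)

Section PolynomialIntegrals.
Variables (R : realType) (k : nat).
Implicit Types f g : ('I_k.+1 -> R) -> R.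

Definition simplex_integral f : R :=
  integral_simplex (fun t : 'rV[R]_k => f (barycentric 1 t)).

Definition is_meval (V : lmodType R) (f : ('I_k.+1 -> R) -> V) := exists s, f =1 meval s.

Lemma simplex_integralE f (s : seq (('I_k.+1 -> nat) * R^o)) : f =1 meval s ->
  simplex_integral f = \sum_(l <- s) dirichlet R l.1 * l.2.
Proof.
move=> fs; rewrite /simplex_integral -integral_simplex_meval.
by congr integral_simplex; apply/funext => t; rewrite fs.
Qed.

(** For polynomials the integral is a finite sum over monomials, so that linearity needs no
    integrability argument. *)
Lemma simplex_integral_linear (c : R) f g : is_meval (f : _ -> R^o) -> is_meval (g : _ -> R^o) ->
  is_meval (fun b => c * f b + g b : R^o) /\
  simplex_integral (fun b => c * f b + g b) = c * simplex_integral f + simplex_integral g.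
Proof.
move=> [s fs] [s' gs].
have E : (fun b => c * f b + g b) =1
    meval ([seq (l.1, c * l.2) | l <- s] ++ s' : seq (('I_k.+1 -> nat) * R^o)).
  move=> b; rewrite meval_cat -gs fs /meval big_map mulr_sumr; congr (_ + _).
  by apply: eq_bigr => l _; rewrite /GRing.scale /= mulrCA.
split; first by exists ([seq (l.1, c * l.2) | l <- s] ++ s').
rewrite (simplex_integralE E) (simplex_integralE fs) (simplex_integralE gs).
rewrite big_cat big_map mulr_sumr; congr (_ + _).
by apply: eq_bigr => l _; rewrite /= mulrCA.
Qed.

Lemma is_meval0 : is_meval (fun=> 0 : R^o).
Proof. by exists [::] => b; rewrite /meval big_nil. Qed.

Lemma simplex_integral0 : simplex_integral (fun=> 0) = 0.
Proof. by rewrite (@simplex_integralE _ [::]) ?big_nil // => b; rewrite /meval big_nil. Qed.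

Lemma simplex_integral_sum (I : Type) (r : seq I) (P : pred I) (c : I -> R)
    (F : I -> ('I_k.+1 -> R) -> R) : (forall i, is_meval (F i : _ -> R^o)) ->
  is_meval (fun b => \sum_(i <- r | P i) c i * F i b : R^o) /\
  simplex_integral (fun b => \sum_(i <- r | P i) c i * F i b) =
  \sum_(i <- r | P i) c i * simplex_integral (F i).
Proof.
move=> mF; elim: r => [|i r [mr Ir]].
  have -> : (fun b => \sum_(i <- [::] | P i) c i * F i b) = fun=> 0.
    by apply/funext => b; rewrite big_nil.
  by rewrite simplex_integral0 big_nil; split => //; exact: is_meval0.
rewrite big_cons; case Pi: (P i).
  have -> : (fun b => \sum_(j <- i :: r | P j) c j * F j b) =
      fun b => c i * F i b + \sum_(j <- r | P j) c j * F j b.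
    by apply/funext => b; rewrite big_cons Pi.
  by have [m1 ->] := simplex_integral_linear (c i) (mF i) mr; rewrite Ir.
have -> // : (fun b => \sum_(j <- i :: r | P j) c j * F j b) =
    fun b => \sum_(j <- r | P j) c j * F j b.
by apply/funext => b; rewrite big_cons Pi.
Qed.

End PolynomialIntegrals.

Lemma pder_meval (R : realType) k (V : lmodType R) (f : ('I_k.+1 -> R) -> V) g :
  pder f g -> is_meval f /\ forall j, is_meval (g j).
Proof.
by move=> [s fs gs]; split => [|j]; [exists s|exists (mderiv j s)].
Qed.

Lemma is_meval_at (R : realType) (M : manifold R) k
    (F : ('I_k.+1 -> R) -> smoothfun M) x :
  is_meval F -> is_meval (fun b => F b x : R^o).
Proof.
move=> [s Fs]; exists [seq (l.1, (l.2 : smoothfun M) x : R^o) | l <- s] => b.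
by rewrite Fs /meval sfun_sumE big_map.
Qed.

(** Differentiation under the integral sign: [G] is the sum of the coefficients weighted with the
    integrals of the monomials, and tangent vectors are linear. *)
Lemma integral_smooth (R : realType) (M : manifold R) k
    (F : ('I_k.+1 -> R) -> smoothfun M) : is_meval F ->
  exists G : smoothfun M, (forall x, G x = simplex_integral (fun b => F b x)) /\
    forall x (X : tangent x), is_meval (fun b => X (F b) : R^o) /\
      X G = simplex_integral (fun b => X (F b)).
Proof.
move=> [s Fs]; exists (\sum_(l <- s) dirichlet R l.1 *: l.2); split=> [x|x X].
  rewrite (@simplex_integralE _ _ _ [seq (l.1, (l.2 : smoothfun M) x : R^o) | l <- s]).
    by rewrite sfun_sumE big_map.
  by move=> b; rewrite Fs /meval sfun_sumE big_map.
have E : (fun b => X (F b)) =1 meval [seq (l.1, X l.2 : R^o) | l <- s].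
  move=> b; rewrite Fs /meval tder_sum big_map; apply: eq_bigr => l _.
  by rewrite tderZ.
split; first by exists [seq (l.1, X l.2 : R^o) | l <- s].
rewrite (simplex_integralE E) tder_sum big_map; apply: eq_bigr => l _.
by rewrite tderZ.
Qed.

Lemma to_smoothE (R : realType) (M : manifold R) (F : smoothfun M) (h : M -> R) :
  h =1 F -> to_smooth h = F.
Proof.
move=> hF; rewrite /to_smooth; case: pselect => [sh|[]]; first exact: sfun_eq.
by rewrite (_ : h = F); [exact: sfunP|apply/funext].
Qed.

Lemma altpow_congr (R : numDomainType) (Rg : algType R) (S S' : zmodType)
    (Q : S -> S -> Rg) (Q' : S' -> S' -> Rg) p (s : seq S) (s' : seq S') :
  (forall i j, Q (nth 0 s i) (nth 0 s j) = Q' (nth 0 s' i) (nth 0 s' j)) ->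
  altpow Q p s = altpow Q' p s'.
Proof.
by move=> QQ; apply: eq_bigr => tau _; congr (_ *: _); apply: eq_bigr => l _; exact: QQ.
Qed.

(** * Restriction to the faces *)

Section Faces.
Variables (R : realType) (M : manifold R) (A : algebroid M) (E : vbundle M).
Variables (k p : nat).

Definition frame_list : seq (@const_section R M A k) :=
  [seq (delta_mx 0 j, 0) | j <- enum 'I_k].

Definition consts (a : seq (section A)) : seq (@const_section R M A k) :=
  [seq (0, b) | b <- a].

Lemma size_frame_list : size frame_list = k.
Proof. by rewrite size_map size_enum_ord. Qed.

Lemma nth_frame_list (i : 'I_k) : nth 0 frame_list i = (delta_mx 0 i, 0).
Proof.
by rewrite (nth_map i) ?size_enum_ord // nth_ord_enum.
Qed.

Variable nb : 'I_k.+1 -> connection A E.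

(** Where the coordinates add up to 1 the base connection [nb ord0] loses its special role, which
    allows comparison with the face that omits it. *)
Lemma nabla_tE t a z : \sum_j t j = 1 ->
  nabla_t nb t a z = \sum_j t j *: nb j a z.
Proof.
move=> t1; rewrite /= /thetas tens_sumE.
have -> : \sum_i (t i *: theta nb i a) z = \sum_i (t i *: nb i a z - t i *: nb ord0 a z).
  by apply: eq_bigr => i _; rewrite /= scalerBr.
by rewrite sumrB -scaler_suml t1 scale1r addrC subrK.
Qed.

Lemma sum_barycentric (t : 'rV[R]_k) : \sum_j barycentric 1 t j = 1.
Proof.
rewrite big_ord_recl barycentric0.
have -> : \sum_(i < k) barycentric 1 t (lift ord0 i) = \sum_(i < k) t 0 i.
  by apply: eq_bigr => i _; rewrite barycentric_lift.
by rewrite subrK.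
Qed.

Lemma thetas_delta i a z : thetas nb (extend (delta_mx 0 i)) a z =
  nb (lift ord0 i) a z - nb ord0 a z.
Proof.
rewrite thetas_extE tens_sumE (bigD1 i) //= mxE !eqxx scale1r big1 ?addr0 // => j ji.
by rewrite mxE (negPf ji) andbF scale0r.
Qed.

Lemma nth_consts (a : seq (section A)) i : nth 0 (consts a) i = (0, nth 0 a i).
Proof.
have [ia|ai] := ltnP i (size a); first by rewrite (nth_map 0).
by rewrite !nth_default // size_map.
Qed.

Lemma form_meval s : is_meval (fun b => form nb p b s).
Proof. by have [] := pder_meval (pder_form nb p s). Qed.

Lemma form_der_meval j s : is_meval (fun b => form_der nb p j b s).
Proof. by have [] := pder_meval (pder_form nb p s). Qed.

(** Every term contains [theta ord0], the difference of a connection with itself. *)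
Lemma form_der0 b s : form_der nb p ord0 b s = 0.
Proof.
have th0 a : theta nb ord0 a = 0.
  by apply: tens_eq => [z|] //=; rewrite subrr.
rewrite /form_der; have -> : alt (2 * p) (fun y : nat -> @const_section R M A k =>
    \sum_(m < p) slot m (curv_der nb (theta nb ord0) b (y (2 * m)%N) (y (2 * m).+1))
      (fun l => curv_t nb b (y (2 * l)%N) (y (2 * l).+1))) (nth 0 s) = 0.
  rewrite /alt big1 // => tau _; rewrite big1 ?scaler0 // => m _.
  rewrite slot_split /curv_der !th0 !ad0 !mulr0 !mul0r.
  by rewrite !(oppr0, addr0, mulr0, mul0r).
have := Tr_linear (-1) (0 : tens E) 0; rewrite !scaleN1r oppr0 addr0 => ->.
by rewrite addNr.
Qed.

Lemma form0 b (s : seq (@const_section R M A k)) : (0 < p)%N ->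
  form nb p b (0 :: s) = 0.
Proof.
move=> p0; have inj (n : nat) (L L' : tens E) : n.+1%:R *: L = n.+1%:R *: L' -> L = L'.
  by apply: scalerI; rewrite pnatr_eq0.
have p20 : (0 < 2 * p)%N by rewrite muln_gt0.
have := @altpowB _ _ _ (curv_t nb b) (curv_t_anti nb b) (curv_tN nb b) (curv_tD nb b) p [::] s 0 0 p20.
rewrite /= !subr0 subrr /form => ->.
have := Tr_linear (-1) (0 : tens E) 0; rewrite !scaleN1r oppr0 addr0 => ->.
by rewrite addNr.
Qed.

End Faces.

(** Treats a single connection like several: R^0 is one point, which lies in the simplex, and there
    [thetas] vanishes. *)
Lemma csE (R : realType) (M : manifold R) (A : algebroid M) (E : vbundle M) p k
    (nb : 'I_k.+1 -> connection A E) (a : seq (section A)) x :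
  cs p nb a x = (2 ^+ p)^-1 *
    simplex_integral (fun b => form nb p b (frame_list A k ++ consts k a) x).
Proof.
case: k nb => [|k] nb.
  rewrite /cs /ch (fiber_cochain_pow x (curv (nb ord0))) lfun_traceZ; congr (_ * _).
  rewrite /simplex_integral /integral_simplex /= indicE mem_set ?mul1r; last first.
    by split => [[]//|]; rewrite big_ord0 ler01.
  have -> : frame_list A 0 = [::] by apply: size0nil; rewrite size_frame_list.
  rewrite /form /= /trace_at; congr (lfun_trace (fiber_endo (tens_fun _) x)).
  apply: altpow_congr => i j; rewrite !nth_consts.
  apply: tens_eq => [z|]; last by rewrite curv_t_sc.
  rewrite curv_tE /= !thetas_ext0 subrr add0r.
  have th t b w : thetas nb t b w = 0.
    by rewrite /thetas tens_sumE big_ord1 /= subrr scaler0.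
  by rewrite !th !addr0.
rewrite /= /integral_simplex.
have := simplex_integral_linear ((2 ^+ p)^-1)
  (is_meval_at x (form_meval p nb (frame_list A k.+1 ++ consts k.+1 a))) (is_meval0 R k.+1).
case=> _; rewrite simplex_integral0 addr0 => <-.
congr integral_rV; apply/funext => t; congr (_ * _).
by rewrite ch_affE addr0.
Qed.

Section FaceForms.
Variables (R : realType) (M : manifold R) (A : algebroid M) (E : vbundle M).
Variables (k p : nat) (nb : 'I_k.+2 -> connection A E).
Local Notation S1 := (@const_section R M A k.+1).
Local Notation S0 := (@const_section R M A k).

(** Vectors on the two simplices are compared by the variation of the connection that they cause,
    which is insensitive to the change of base connection for j = 0. *)
Definition face_rel (j : 'I_k.+2) (v : S1) (v' : S0) := v.2 = v'.2 /\
  forall a z, thetas nb (extend v.1) a z = thetas (fun i : 'I_k.+1 => nb (lift j i)) (extend v'.1) a z.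

(** By [curv_tE] the curvature depends on the connection at the point and on its variation only, and
    both agree on the face. *)
Lemma face_curv j (b : 'I_k.+1 -> R) v v' u u' : \sum_i b i = 1 ->
  face_rel j v v' -> face_rel j u u' ->
  curv_t nb (face j b) v u = curv_t (fun i : 'I_k.+1 => nb (lift j i)) b v' u'.
Proof.
move=> b1 [v2 v1] [u2 u1]; apply: tens_eq => [z|]; last by rewrite !curv_t_sc.
have face1 : \sum_i face j b i = 1.
  rewrite (bigD1_ord j) //= /face unlift_none add0r -[RHS]b1.
  by apply: eq_bigr => i _; rewrite liftK.
have nE a w : nabla_t nb (face j b) a w = nabla_t (fun i : 'I_k.+1 => nb (lift j i)) b a w.
  rewrite !nabla_tE // (bigD1_ord j) //= {1}/face unlift_none scale0r add0r.
  by apply: eq_bigr => i _; rewrite /face liftK.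
by rewrite !curv_tE v1 u1 v2 u2 !nE.
Qed.

Lemma face_form j (b : 'I_k.+1 -> R) (s : seq S1) (s' : seq S0) x : \sum_i b i = 1 ->
  (forall q, face_rel j (nth 0 s q) (nth 0 s' q)) ->
  form nb p (face j b) s x = form (fun i : 'I_k.+1 => nb (lift j i)) p b s' x.
Proof.
move=> b1 ss; rewrite /form.
have -> // : altpow (curv_t nb (face j b)) p s = altpow (curv_t (fun i : 'I_k.+1 => nb (lift j i)) b) p s'.
by apply: altpow_congr => i i'; apply: face_curv.
Qed.

Lemma face_rel_cat j (s : seq S1) (a : seq (section A)) : size s = k ->
  (forall i : 'I_k, face_rel j (nth 0 s i) (nth 0 (frame_list A k) i)) ->
  forall q, face_rel j (nth 0 (s ++ consts k.+1 a) q) (nth 0 (frame_list A k ++ consts k a) q).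
Proof.
move=> sk sf q; rewrite !nth_cat sk size_frame_list.
have [qk|kq] := ltnP q k; first exact: sf (Ordinal qk).
by rewrite !nth_consts; split => // a' z; rewrite !thetas_ext0.
Qed.

Lemma form_face_lift (i : 'I_k.+1) (b : 'I_k.+1 -> R) (a : seq (section A)) x :
  \sum_i b i = 1 ->
  form nb p (face (lift ord0 i) b) (delete i (frame_list A k.+1) ++ consts k.+1 a) x =
  form (fun l : 'I_k.+1 => nb (lift (lift ord0 i) l)) p b (frame_list A k ++ consts k a) x.
Proof.
move=> b1; apply: face_form => //; apply: face_rel_cat.
  by rewrite size_cat size_take size_drop size_frame_list ltn_ord /=; have := ltn_ord i; lia.
move=> l; rewrite nth_delete -[bump i l]/(lift i l : nat) !nth_frame_list; split => // a' z.
rewrite /= !thetas_delta; congr (nb _ _ _ - nb _ _ _); apply: val_inj;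
  by rewrite /= /bump /=; lia.
Qed.

(* The frame of the face [b_0 = 0] consists of the differences e_l - e_0 for
   l > 0; expand them by multilinearity. *)
Lemma form_face0 (b : 'I_k.+1 -> R) (a : seq (section A)) x :
  \sum_i b i = 1 -> (k.+1 <= 2 * p)%N ->
  \sum_(i < k.+1) (-1) ^+ i *
    form nb p (face ord0 b) (delete i (frame_list A k.+1) ++ consts k.+1 a) x =
  form (fun l : 'I_k.+1 => nb (lift ord0 l)) p b (frame_list A k ++ consts k a) x.
Proof.
move=> b1 kp; pose v0 : S1 := (delta_mx 0 ord0, 0).
pose vs : seq S1 := [seq (delta_mx 0 (lift ord0 l), 0) | l <- enum 'I_k].
have fE : frame_list A k.+1 = v0 :: vs.
  by rewrite /frame_list enum_ordSl /= -map_comp.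
have szvs : size vs = k by rewrite size_map size_enum_ord.
(* These differences correspond to the frame of the smaller simplex, whose base connection is number
   1. *)
rewrite -(@face_form _ _ ([seq v - v0 | v <- vs] ++ consts k.+1 a)) //; last first.
  apply: face_rel_cat => [|l]; first by rewrite size_map.
  rewrite (nth_map 0) ?szvs // (nth_map l) ?size_enum_ord // nth_ord_enum nth_frame_list.
  split => [|a' z]; first by rewrite /= subrr.
  have -> : thetas nb (extend ((delta_mx 0 (lift ord0 l), 0) - v0 : S1).1) a' z =
      thetas nb (extend (delta_mx 0 (lift ord0 l))) a' z - thetas nb (extend (delta_mx 0 ord0)) a' z.
    rewrite !thetas_extE -tens_oppE -tens_addE -sumrN -big_split.
    congr (tens_fun _ z); apply: eq_bigr => i _ /=.
    by rewrite -scalerBl !mxE.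
  rewrite !thetas_delta /=; set y := nb ord0 a' z.
  by rewrite opprB addrA subrK.
have inj (n : nat) (L L' : tens E) : n.+1%:R *: L = n.+1%:R *: L' -> L = L'.
  by apply: scalerI; rewrite pnatr_eq0.
rewrite /form (altpow_sub (curv_t_anti nb _) (curv_tN nb _) inj (curv_tD nb _)); last first.
  by rewrite szvs ltnW.
by rewrite Tr_sum sfun_sumE szvs fE.
Qed.

End FaceForms.

Lemma delete_cat (T : Type) i (s1 s2 : seq T) : (i < size s1)%N ->
  delete i (s1 ++ s2) = delete i s1 ++ s2.
Proof.
move=> i1; rewrite /delete take_cat i1 drop_cat ltn_neqAle i1 andbT.
case: eqP => [i1E|_] /=; last by rewrite catA.
by rewrite i1E subnn drop0 drop_size cats0.
Qed.

Lemma delete_cat_size (T : Type) i (s1 s2 : seq T) :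
  delete (size s1 + i) (s1 ++ s2) = s1 ++ delete i s2.
Proof.
have n j : (size s1 + j < size s1)%N = false by lia.
by rewrite /delete -addnS take_cat drop_cat !n !addKn catA.
Qed.

(** * Closedness on coordinate vectors and constant sections *)

Section ClosednessOnFrames.
Variables (R : realType) (M : manifold R) (A : algebroid M) (E : vbundle M).
Variables (k p : nat) (nb : 'I_k.+1 -> connection A E).
Hypothesis p_gt0 : (0 < p)%N.
Local Notation S := (@const_section R M A k).
Local Notation F := (form nb p).

Lemma consts_delete i (a : seq (section A)) :
  delete i (consts k a) = consts k (delete i a).
Proof. by rewrite /consts /delete map_cat map_take map_drop. Qed.

Lemma delete_frame_cat i (s : seq S) :
  delete (k + i) (frame_list A k ++ s) = frame_list A k ++ delete i s.
Proof. by have := delete_cat_size i (frame_list A k) s; rewrite size_frame_list. Qed.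

Lemma const_bracketr0 (u : S) d : const_bracket u (d, 0) = 0.
Proof. by rewrite /const_bracket bracket0r. Qed.

Lemma const_bracketl0 (u : S) d : const_bracket (d, 0) u = 0.
Proof. by rewrite /const_bracket bracket0l. Qed.

Lemma form_move b (v : S) (s s' : seq S) : (size s < 2 * p)%N ->
  F b (v :: s ++ s') = (-1) ^+ size s *: F b (s ++ v :: s').
Proof.
move=> sp; rewrite /form (altpow_move _ v) //.
set L := altpow _ _ _.
have := Tr_linear ((-1) ^+ size s) L 0; rewrite addr0 => ->.
have := Tr_linear (-1) (0 : tens E) 0; rewrite !scaleN1r oppr0 addr0 => ->.
by rewrite addNr addr0 scalerA -expr2 sqrr_sign scale1r.
Qed.

(* Keeps [/=] and unification from exposing the trace inside a form. *)
Local Opaque form form_der.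

(** The sign (-1)^k has two sources: in the anchor terms the positions of the [a] are shifted by
    [k], and each bracket is moved behind [k] coordinate vectors. *)
Definition closed_lhs (a : seq (section A)) x b : R :=
  \sum_(i < k) (-1) ^+ i *
    form_der nb p (lift ord0 i) b (delete i (frame_list A k) ++ consts k a) x +
  (-1) ^+ k * (\sum_(i < size a) (-1) ^+ i *
      anchor (a`_i x) (F b (frame_list A k ++ consts k (delete i a))) +
    \sum_(j < size a) \sum_(i < size a | (i < j)%N) (-1) ^+ (i + j) *
      F b (frame_list A k ++ consts k (bracket a`_i a`_j :: delete i (delete j a))) x).

Lemma form_closed_frame (a : seq (section A)) x b : (k + size a = (2 * p).+1)%N ->
  closed_lhs a x b = 0.
Proof.
move=> ka; rewrite -[RHS](form_closed nb b (frame_list A k ++ consts k a) x p_gt0) -ka.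
(* Four kinds of terms: derivatives in t, derivatives along the anchor, brackets with a coordinate
   vector, which vanish, and brackets of two of the [a]. *)
have split4 (c P P' X X' Y Y' Z : R) : P = P' -> c * X = X' -> Z = 0 -> c * Y = Y' ->
    P + c * (X + Y) = (P' + X') + (Z + Y').
  by move=> -> <- -> <-; rewrite add0r mulrDr addrA.
rewrite [X in _ = X + _]big_split_ord [X in _ = _ + X]big_split_ord.
apply: split4.
- apply: eq_bigr => i _; congr (_ * _); rewrite /=.
  rewrite nth_cat size_frame_list ltn_ord nth_frame_list /= anchor0 addr0.
  rewrite delete_cat ?size_frame_list // (bigD1 i) //= mxE !eqxx mul1r big1 ?addr0 // => l li.
  by rewrite mxE (negPf li) andbF mul0r.
- rewrite mulr_sumr; apply: eq_bigr => i _; rewrite mulrA -exprD; congr (_ * _); rewrite /=.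
  rewrite nth_cat size_frame_list ltnNge leq_addr /= addKn nth_consts /=.
  rewrite big1 ?add0r => [|l _]; last by rewrite mxE mul0r.
  by rewrite delete_frame_cat consts_delete.
- rewrite big1 // => j _; rewrite big1 // => i ij /=; rewrite !nth_cat size_frame_list ltn_ord (ltn_trans ij (ltn_ord j)).
  by rewrite (nth_frame_list A j) const_bracketr0 form0 ?mulr0.
rewrite mulr_sumr; apply: eq_bigr => j _.
rewrite big_split_ord /= [X in _ = X + _]big1 ?add0r => [|i _]; last first.
  rewrite /= !nth_cat size_frame_list ltn_ord (nth_frame_list A i).
  by rewrite const_bracketl0 form0 ?mulr0.
rewrite mulr_sumr; under [RHS]eq_bigl do rewrite ltn_add2l.
apply: eq_bigr => i ij.
rewrite !nth_cat size_frame_list !ltnNge !leq_addr /= !addKn !nth_consts /const_bracket /=.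
rewrite !delete_frame_cat !consts_delete form_move; last first.
  by rewrite size_frame_list; move: (ltn_ord j); lia.
rewrite /= size_frame_list.
have kk : (-1) ^+ k * (-1) ^+ k = 1 :> R by rewrite -expr2 sqrr_sign.
rewrite !exprD; set e := (-1) ^+ k in kk *.
set X := (F b _ x); rewrite -[LHS]mul1r -kk; ring.
Qed.

(** As the integral of a polynomial family [cs] is smooth, so that [to_smooth] does not take its
    default value and the anchor passes under the integral. *)
Lemma dA_csE (a : seq (section A)) x :
  2 ^+ p * dA (cs p nb) a x =
  \sum_(i < size a) (-1) ^+ i * simplex_integral (fun b =>
      anchor (a`_i x) (F b (frame_list A k ++ consts k (delete i a)))) +
  \sum_(j < size a) \sum_(i < size a | (i < j)%N) (-1) ^+ (i + j) *
    simplex_integral (fun b =>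
      F b (frame_list A k ++ consts k (bracket a`_i a`_j :: delete i (delete j a))) x).
Proof.
have p2 : 2 ^+ p != 0 :> R by rewrite expf_neq0 // pnatr_eq0.
rewrite /dA mulrDr !mulr_sumr; congr (_ + _); apply: eq_bigr => i _; last first.
  by rewrite mulr_sumr; apply: eq_bigr => j _; rewrite csE mulrCA mulVKf.
have [G [GE /(_ x (anchor (a`_i x))) [_ XG]]] :=
  integral_smooth (form_meval p nb (frame_list A k ++ consts k (delete i a))).
rewrite (@to_smoothE _ _ ((2 ^+ p)^-1 *: G)) => [|y]; last by rewrite csE /= GE.
by rewrite tderZ XG mulrCA mulVKf.
Qed.

Lemma simplex_integral_closed (a : seq (section A)) x : (k + size a = (2 * p).+1)%N ->
  \sum_(i < k) (-1) ^+ i * simplex_integral (fun b =>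
    form_der nb p (lift ord0 i) b (delete i (frame_list A k) ++ consts k a) x) +
  (-1) ^+ k * (2 ^+ p * dA (cs p nb) a x) = 0.
Proof.
move=> ka; rewrite dA_csE !pair_big_dep /=.
pose FD (i : 'I_k) b : R :=
  form_der nb p (lift ord0 i) b (delete i (frame_list A k) ++ consts k a) x.
pose FA (i : 'I_(size a)) b : R := 
  anchor (a`_i x) (F b (frame_list A k ++ consts k (delete i a))).
pose FB (q : 'I_(size a) * 'I_(size a)) b : R :=
  F b (frame_list A k ++ consts k (bracket a`_q.2 a`_q.1 :: delete q.2 (delete q.1 a))) x.
have [mD ID] : is_meval (fun b => \sum_(i < k) (-1) ^+ i * FD i b : R^o) /\ _ :=
  simplex_integral_sum _ _ _ (fun i => is_meval_at x (form_der_meval p nb _ _)).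
have mFA i : is_meval (FA i : _ -> R^o).
  have [G [_ /(_ x (anchor (a`_i x))) []]] :=
    integral_smooth (form_meval p nb (frame_list A k ++ consts k (delete i a))).
  by [].
have [mA IA] := simplex_integral_sum (index_enum _) xpredT (fun i : 'I_(size a) => (-1) ^+ i) mFA.
have [mB IB] := simplex_integral_sum (index_enum _)
  (fun q : 'I_(size a) * 'I_(size a) => (q.2 < q.1)%N) (fun q => (-1) ^+ (q.2 + q.1))
  (F := FB) (fun q => is_meval_at x (form_meval p nb _)).
have [mAB IAB] := simplex_integral_linear 1 mA mB.
have [_] := simplex_integral_linear ((-1) ^+ k) mAB mD.
rewrite IAB IA IB ID mul1r addrC => <-.
rewrite -[RHS](simplex_integral0 R k); congr simplex_integral; apply/funext => b.
by rewrite -[RHS](form_closed_frame x b ka) /closed_lhs pair_big_dep /= mul1r [LHS]addrC.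
Qed.

End ClosednessOnFrames.

(** * Stokes' formula for the trace forms *)

Section StokesForms.
Local Opaque form form_der.
Variables (R : realType) (M : manifold R) (A : algebroid M) (E : vbundle M).
Variables (k p : nat) (nb : 'I_k.+2 -> connection A E).
Hypothesis kp : (k.+1 <= 2 * p)%N.
Local Notation F := (form nb p).

(** Each derivative in t gives the face 0 minus the face i+1. The latter are the terms with j > 0;
    the copies of the face 0 add up to j = 0 by [form_face0]. *)
Lemma cs_faces (a : seq (section A)) x :
  \sum_(i < k.+1) (-1) ^+ i * simplex_integral (fun b => form_der nb p (lift ord0 i) b
    (delete i (frame_list A k.+1) ++ consts k.+1 a) x) =
  2 ^+ p * \sum_(j < k.+2) (-1) ^+ j * cs p (fun i : 'I_k.+1 => nb (lift j i)) a x.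
Proof.
have p2 : 2 ^+ p != 0 :> R by rewrite expf_neq0 // pnatr_eq0.
have cs2 c (nb' : 'I_k.+1 -> connection A E) : 2 ^+ p * (c * cs p nb' a x) =
    c * simplex_integral (fun b => form nb' p b (frame_list A k ++ consts k a) x).
  by rewrite csE mulrCA mulVKf.
pose s (i : 'I_k.+1) := delete i (frame_list A k.+1) ++ consts k.+1 a.
pose Fx i (b : 'I_k.+2 -> R) : R^o := F b (s i) x.
have mF j i : is_meval (fun b => Fx i (face j b)).
  have [r Fr] := is_meval_at x (form_meval p nb (s i)).
  eexists => b; rewrite /Fx Fr; exact: meval_face.
have stokes i : simplex_integral (fun b => form_der nb p (lift ord0 i) b (s i) x) =
    simplex_integral (fun b => Fx i (face ord0 b)) -
    simplex_integral (fun b => Fx i (face (lift ord0 i) b)).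
  have evx : pder (Fx i) (fun j b => form_der nb p j b (s i) x : R^o).
    by apply: (pder_linear (T := fun f : smoothfun M => f x : R^o)) (pder_form nb p (s i)).
  apply/eqP; rewrite -(addrK (simplex_integral (fun b => Fx i (face (lift ord0 i) b))) (simplex_integral _)).
  rewrite /simplex_integral (stokes_simplex (lift ord0 i) ord0 evx).
  have -> : integral_simplex (fun t => form_der nb p ord0 (barycentric 1 t) (s i) x) = 0.
    rewrite -[RHS](simplex_integral0 R k.+1); congr integral_simplex.
    by apply/funext => t; rewrite form_der0.
  by rewrite add0r.
under eq_bigr do rewrite stokes mulrBr.
rewrite sumrB [X in _ = _ * X]big_ord_recl [RHS]mulrDr; congr (_ + _).
  rewrite cs2 expr0 mul1r.
  have [_ <-] := simplex_integral_sum (index_enum _) xpredT (fun i : 'I_k.+1 => (-1) ^+ i) (mF ord0).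
  rewrite /simplex_integral; congr integral_simplex; apply/funext => t.
  by rewrite -form_face0 // sum_barycentric.
rewrite -sumrN mulr_sumr; apply: eq_bigr => i _.
have -> : simplex_integral (fun b => Fx i (face (lift ord0 i) b)) =
    simplex_integral (fun b => form (fun l : 'I_k.+1 => nb (lift (lift ord0 i) l)) p b
      (frame_list A k ++ consts k a) x).
  rewrite /simplex_integral; congr integral_simplex; apply/funext => t.
  by rewrite /Fx form_face_lift // sum_barycentric.
by rewrite cs2 lift0 exprS mulN1r mulNr.
Qed.

End StokesForms.

Theorem theorem1 (R : realType) (M : manifold R) (A : algebroid M)
    (E : vbundle M) :
  (forall (k p : nat) (nb : 'I_k.+2 -> connection A E), (k.+1 <= 2 * p)%N ->
     forall (a : ((2 * p - k.+1).+1).-tuple (section A)) (x : M),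
       (-1) ^+ k.+2 * dA (cs p nb) a x =
       \sum_(j < k.+2) (-1) ^+ j * cs p (fun i : 'I_k.+1 => nb (lift j i)) a x)
  /\
  (forall (p : nat) (nb0 : connection A E), (0 < p)%N ->
     forall (a : ((2 * p).+1).-tuple (section A)) (x : M),
       dA (cs p (fun _ : 'I_1 => nb0)) a x = 0).
Proof.
have p2 p : 2 ^+ p != 0 :> R by rewrite expf_neq0 // pnatr_eq0.
split=> [k p nb kp a x|p nb0 p0 a x].
  have p0 : (0 < p)%N by lia.
  have ka : (k.+1 + size a = (2 * p).+1)%N by rewrite size_tuple; lia.
  (* [simplex_integral_closed] has the sign (-1)^(k+1) in front of the differential; moving that
     term to the other side gives (-1)^(k+2). *)
  apply: (mulfI (p2 p)); rewrite -cs_faces //; apply/eqP; rewrite eq_sym -subr_eq0.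
  rewrite -[X in _ == X](simplex_integral_closed nb p0 x ka).
  by rewrite [(-1) ^+ k.+2]exprS mulN1r mulNr mulrN opprK mulrCA.
(* Without coordinate vectors the sum of derivatives in t is empty. *)
have ka : (0 + size a = (2 * p).+1)%N by rewrite size_tuple.
apply: (mulfI (p2 p)); rewrite mulr0 -[RHS](simplex_integral_closed (fun _ : 'I_1 => nb0) p0 x ka).
by rewrite big_ord0 add0r expr0 mul1r.
Qed.
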